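(* Let $m,n\ge1$, let $\vartheta_1$ be an $n\times m$ matrix with $\vartheta_1^*\vartheta_1>0$, and put $c=\vartheta_1\vartheta_1^*$. There is no self-adjoint $m\times m$ matrix function $u(x,t)$ on the quarter-plane $x\ge0$, $t\ge0$ satisfying all of the following: (a) $u_t+3(uu_x+u_xu)-u_{xxx}=0$ on the quarter-plane; (b) $u$ is bounded on the quarter-plane, and the corresponding matrix functions $G$ and $F$ (defined in the context) are continuously differentiable there; (c) $u(0,t)=u_{xx}(0,t)=0$ for $t\ge0$, and $$u(x,0)=2x^4\vartheta_1^*\Big(I_n+\tfrac13x^3c\Big)^{-1}c\Big(I_n+\tfrac13x^3c\Big)^{-1}\vartheta_1-4x\,\vartheta_1^*\Big(I_n+\tfrac13x^3c\Big)^{-1}\vartheta_1,\qquad x\ge0;$$ (d) the Weyl functions $M(t,z)$ of $u(\cdot,t)$ satisfy $\displaystyle\lim_{t\to\infty}M(t,z)=\frac{i\sqrt z-1}{i\sqrt z+1}I_m$ $(z\in\mathbb C_+)$.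
   Context: $\mathbb C_+=\{z:\Im z>0\}$; $I_k$ is the $k\times k$ identity matrix; for $z\in\mathbb C_+$ the branch of $\sqrt z$ is chosen with $\sqrt z\in\mathbb C_+$. Put $$G=\begin{bmatrix}0&I_m\\ u-zI_m&0\end{bmatrix},\quad F=\begin{bmatrix}u_x&-2(u+2zI_m)\\ u_{xx}-2(u+2zI_m)(u-zI_m)&-u_x\end{bmatrix},\quad T=\frac1{\sqrt2}\begin{bmatrix} iI_m&I_m\\ iI_m&-I_m\end{bmatrix}.$$ Weyl function $M(t,z)$: let $\Psi(x,t,z)$ be the $2m\times 2m$ solution of $\Psi_x=G\Psi$, $\Psi(0,t,z)=I_{2m}$, and put $\widetilde\Psi(x,t,z)=(\Psi(x,t,0)T)^{-1}\Psi(x,t,z)T$. Let $\mathcal A(l,t,z)=\widetilde\Psi(l,t,\overline z)^*$ with $m\times m$ blocks $\mathcal A_{kj}$. For $z\in\mathbb C_+$, $l>0$ put $$M(l,t,z)=i\big(\mathcal A_{11}P_l+\mathcal A_{12}Q_l\big)\big(\mathcal A_{21}P_l+\mathcal A_{22}Q_l\big)^{-1},$$ where $P_l,Q_l$ are any $m\times m$ matrix functions meromorphic in $z\in\mathbb C_+$ with $P_l^*P_l+Q_l^*Q_l>0$, $P_l^*Q_l+Q_l^*P_l\ge0$. For bounded self-adjoint $u$ the limit $M(t,z)=\lim_{l\to\infty}M(l,t,z)$ exists and is independent of the choice of $P_l,Q_l$; it is the Weyl function at time $t$. (For $u\equiv0$ it equals $\frac{i\sqrt z-1}{i\sqrt z+1}I_m$.)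 *)

(* Defs.v *)
(* The complex field is R[i] for an arbitrary R : realType. *)
From HB Require Import structures.
From mathcomp Require Import all_boot all_order all_algebra.
From mathcomp Require Import all_classical all_reals all_analysis.
From mathcomp Require Import complex.

Set Implicit Arguments.
Unset Strict Implicit.
Unset Printing Implicit Defensive.

Import Order.TTheory GRing.Theory Num.Theory.
Import numFieldNormedType.Exports.

Local Open Scope complex_scope.
Local Open Scope classical_set_scope.
Local Open Scope sesquilinear_scope.
Local Open Scope ring_scope.

(* The library puts the norm topology of a numFieldType K on the alias K^o and
   on abstract K only; these instances transport it to the concrete R[i], and
   hence to matrices over R[i]. *)
HB.instance Definition _ (R : rcfType) := GRing.ComAlgebra.copy R[i] R[i]^o.
HB.instance Definition _ (R : rcfType) := Vector.copy R[i] R[i]^o.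
HB.instance Definition _ (R : rcfType) := NormedModule.copy R[i] R[i]^o.

Section Positivity.
Context {R : realType} {n : nat}.

(* In R[i], 0 < z means that z is real and positive; a matrix whose quadratic
   form is real is Hermitian. *)
Definition posdefmx (A : 'M[R[i]]_n) : Prop :=
  forall v : 'cV[R[i]]_n, v != 0 -> 0 < (v^t* *m A *m v) 0 0.

Definition possemidefmx (A : 'M[R[i]]_n) : Prop :=
  forall v : 'cV[R[i]]_n, 0 <= (v^t* *m A *m v) 0 0.

End Positivity.

Section HalfLineDerivative.
Context {R : realType} {p q : nat}.
Implicit Types (f : R -> 'M[R[i]]_(p, q)) (g : R -> R -> 'M[R[i]]_(p, q)).

(* Derivatives along the half-line [0, +oo[ : two-sided at x > 0, one-sided at
   x = 0. Values of f on the negative half-line are irrelevant. *)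
Definition half_quotient f (x y : R) : 'M[R[i]]_(p, q) :=
  ((y - x)^-1)%:C *: (f y - f x).

Definition half_derivable f (x : R) : Prop :=
  cvg (half_quotient f x y @[y --> within [set y | 0 <= y] x^']).

Definition half_derive f (x : R) : 'M[R[i]]_(p, q) :=
  lim (half_quotient f x y @[y --> within [set y | 0 <= y] x^']).

Definition dx g : R -> R -> 'M[R[i]]_(p, q) :=
  fun x t => half_derive (g ^~ t) x.

Definition dt g : R -> R -> 'M[R[i]]_(p, q) :=
  fun x t => half_derive (g x) t.

Definition quarter_plane : set (R * R) := [set a | 0 <= a.1 /\ 0 <= a.2].

Definition quarter_C1 g : Prop :=
  [/\ forall x t, 0 <= x -> 0 <= t ->
        half_derivable (g ^~ t) x /\ half_derivable (g x) t,
      {within quarter_plane, continuous (fun a => dx g a.1 a.2)} &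
      {within quarter_plane, continuous (fun a => dt g a.1 a.2)}].

End HalfLineDerivative.

Section Meromorphic.
Context {R : realType} {p q : nat}.
Implicit Types f : R[i] -> 'M[R[i]]_(p, q).

Definition holomorphic_at f (z : R[i]) : Prop :=
  \forall w \near z, derivable f w 1.

(* A meromorphic function is represented by a total function; its value at a
   pole is arbitrary. *)
Definition meromorphic_at f (z : R[i]) : Prop :=
  exists k : nat, exists2 h : R[i] -> 'M[R[i]]_(p, q), holomorphic_at h z &
    \forall w \near z^', f w = (w - z) ^- k *: h w.

End Meromorphic.

Section KdV.
Context {R : realType} {m : nat}.
Implicit Types (v : 'M[R[i]]_m) (z : R[i]).

Definition Gmx v z : 'M[R[i]]_(m + m) :=
  block_mx 0 1%:M (v - z%:M) 0.

Definition Fmx v vx vxx z : 'M[R[i]]_(m + m) :=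
  block_mx vx (- (2 *: (v + (2 * z)%:M)))
           (vxx - 2 *: ((v + (2 * z)%:M) *m (v - z%:M))) (- vx).

Definition Tmx : 'M[R[i]]_(m + m) :=
  (sqrtC 2)^-1 *: block_mx 'i%:M 1%:M 'i%:M (- 1%:M).

Definition fundamental_solution (v : R -> 'M[R[i]]_m) z
    (Y : R -> 'M[R[i]]_(m + m)) : Prop :=
  Y 0 = 1%:M /\
  forall x, 0 <= x ->
    half_derivable Y x /\ half_derive Y x = Gmx (v x) z *m Y x.

Definition normalized_solution (Psi : R[i] -> R -> 'M[R[i]]_(m + m))
    (x : R) z : 'M[R[i]]_(m + m) :=
  invmx (Psi 0 x *m Tmx) *m Psi z x *m Tmx.

Definition Amx (Psi : R[i] -> R -> 'M[R[i]]_(m + m)) (l : R) z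
    : 'M[R[i]]_(m + m) :=
  (normalized_solution Psi l (z^*))^t*.

Definition moebius (A : 'M[R[i]]_(m + m)) (P Q : 'M[R[i]]_m) : 'M[R[i]]_m :=
  'i *: ((ulsubmx A *m P + ursubmx A *m Q) *m
         invmx (dlsubmx A *m P + drsubmx A *m Q)).

(* The inequalities are required wherever they make sense, i.e. away from the
   poles of P and Q. *)
Definition admissible_pair (P Q : R[i] -> 'M[R[i]]_m) : Prop :=
  forall z, 0 < 'Im z ->
    [/\ meromorphic_at P z, meromorphic_at Q z &
        holomorphic_at P z -> holomorphic_at Q z ->
        posdefmx ((P z)^t* *m P z + (Q z)^t* *m Q z) /\
        possemidefmx ((P z)^t* *m Q z + (Q z)^t* *m P z)].

(* M is the Weyl function of the potential v on the half-line. For a given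
   choice of (P, Q) the limit is taken at those z where P l and Q l have no
   pole for large l; there the values of P l and Q l are meaningful. The
   constant choices P = Q = 1 show that this constrains M at every z in the
   upper half-plane. *)
Definition weyl_function (v : R -> 'M[R[i]]_m) (M : R[i] -> 'M[R[i]]_m)
    : Prop :=
  exists2 Psi : R[i] -> R -> 'M[R[i]]_(m + m),
    forall z, fundamental_solution v z (Psi z) &
    forall P Q : R -> R[i] -> 'M[R[i]]_m,
      (forall l, 0 < l -> admissible_pair (P l) (Q l)) ->
      forall z, 0 < 'Im z ->
        (\forall l \near +oo, holomorphic_at (P l) z /\
                              holomorphic_at (Q l) z) ->
        moebius (Amx Psi l z) (P l z) (Q l z) @[l --> +oo] --> M z.

End KdV.

Section InitialProfile.
Context {R : realType} {m n : nat}.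

Definition initial_profile (theta : 'M[R[i]]_(n, m)) (x : R) : 'M[R[i]]_m :=
  let c := theta *m theta^t* in
  let r := invmx (1%:M + (x ^+ 3 / 3)%:C *: c) in
  (2 * x ^+ 4)%:C *: (theta^t* *m r *m c *m r *m theta)
  - (4 * x)%:C *: (theta^t* *m r *m theta).

End InitialProfile.

(* Main.v *)
(* Let z be in the upper half-plane and let y = (y1, y2) be a Weyl solution of
   y_x = G y, carried in time by y_t = F y.  Its flux Im (y1^* y2) decreases in x
   and, as u is bounded, does not decrease along the lines x + C t = const for
   large C.  So the flux at time t is nonnegative for every x, because it is at
   time 0; hence y remains a Weyl solution and y(0, t) is governed by M(t, z).
   At x = 0, where u = u_xx = 0, write z = k^2: the form Im (conj k y1^* y2) has
   t-derivative 4 Im (k^3) (|y2|^2 + |k|^2 |y1|^2), so it is nonincreasing when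
   Im (k^3) < 0 < Im (k^2).  For the initial potential y2 = (i k - k^-2
   theta^* theta) y1, which makes the form negative for small k.  The Weyl
   function of the zero potential corresponds to y2 = i k y1, for which the form
   is |k y1|^2, so (d) makes it positive for large t. *)

Require Import Defs.
From HB Require Import structures.
From mathcomp Require Import all_boot all_order all_algebra.
From mathcomp Require Import all_classical all_reals all_analysis.
From mathcomp Require Import complex.
From mathcomp Require Import ring lra.

Set Implicit Arguments.
Unset Strict Implicit.
Unset Printing Implicit Defensive.

Import Order.TTheory GRing.Theory Num.Theory.
Import numFieldNormedType.Exports.

Local Open Scope complex_scope.
Local Open Scope classical_set_scope.
Local Open Scope sesquilinear_scope.
Local Open Scope ring_scope.

(** No regularity of [Psi t] in [t] is given: the Weyl data provide a fundamental matrix for each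
    [t] separately. The carried solution is therefore [Psi t z x *m Y t], where [Y] solves the time
    equation at [x = 0] only. For other [x] the time equation comes from a Gronwall estimate in [x]
    of the defect of the difference quotient, where zero curvature removes the first-order terms;
    mixed second derivatives are avoided. No global bound on u_x or u_xx is given. Both cancel from
    the time derivative of the flux, which leaves terms in |y1|^2 controlled by [u] and [z]; these
    are what the slope [C] pays for. The unknown boundary value of u_x cancels from the boundary
    form in the same way. Passing from nonnegative flux to M(t, z) needs no theory of Weyl discs.
    The limit is the same for all admissible families, so for each [l] the pair may be read off from
    the solution itself, and then the Moebius transform acts correctly on the boundary value at
    every finite [l]. The initial potential arises from the zero potential by double commutation at
    energy 0, hence its Weyl solutions are explicit. *)

(** * Entrywise l1 norm of complex matrices *)

Section L1Norm.
Context {R : realType}.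
Implicit Types x y z : R[i].

(* The norms of [R[i]] and of its matrices take their values in [R[i]]; the
   l1 norm is submultiplicative and has values in [R]. *)
Definition l1c z : R := `|complex.Re z| + `|complex.Im z|.

Lemma cReM x y : complex.Re (x * y) =
  complex.Re x * complex.Re y - complex.Im x * complex.Im y.
Proof. by case: x y => [a b] [c d]. Qed.

Lemma cImM x y : complex.Im (x * y) =
  complex.Re x * complex.Im y + complex.Im x * complex.Re y.
Proof. by case: x y => [a b] [c d]. Qed.

Lemma cReJ x : complex.Re (x^*) = complex.Re x.
Proof. by case: x. Qed.

Lemma cReD x y : complex.Re (x + y) = complex.Re x + complex.Re y.
Proof. by case: x y => [? ?] []. Qed.

Lemma cImD x y : complex.Im (x + y) = complex.Im x + complex.Im y.
Proof. by case: x y => [? ?] []. Qed.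

Lemma cReN x : complex.Re (- x) = - complex.Re x.
Proof. by case: x. Qed.

Lemma cImN x : complex.Im (- x) = - complex.Im x.
Proof. by case: x. Qed.

Lemma cReB x y : complex.Re (x - y) = complex.Re x - complex.Re y.
Proof. by rewrite cReD cReN. Qed.

Lemma cImB x y : complex.Im (x - y) = complex.Im x - complex.Im y.
Proof. by rewrite cImD cImN. Qed.

Lemma cRe_le_l1c x : `|complex.Re x| <= l1c x.
Proof. by rewrite lerDl. Qed.

Lemma cIm_le_l1c x : `|complex.Im x| <= l1c x.
Proof. by rewrite lerDr. Qed.

Lemma l1c_ge0 z : 0 <= l1c z. Proof. by rewrite addr_ge0. Qed.

Lemma l1c0 : l1c 0 = 0. Proof. by rewrite /l1c /= normr0 addr0. Qed.

Lemma l1c_eq0 z : l1c z <= 0 -> z = 0.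
Proof.
case: z => [a b]; rewrite /l1c /= => h.
have [ha hb] : `|a| = 0 /\ `|b| = 0.
  by have := normr_ge0 a; have := normr_ge0 b; split; lra.
by rewrite (normr0_eq0 ha) (normr0_eq0 hb).
Qed.

Lemma l1cD x y : l1c (x + y) <= l1c x + l1c y.
Proof.
case: x y => [a b] [c d]; rewrite /l1c /=.
by have := ler_normD a c; have := ler_normD b d; lra.
Qed.

Lemma l1cN x : l1c (- x) = l1c x.
Proof. by case: x => [a b]; rewrite /l1c /= !normrN. Qed.

Lemma l1cJ x : l1c (x^*) = l1c x.
Proof. by case: x => [a b]; rewrite /l1c /= normrN. Qed.

Lemma l1cM x y : l1c (x * y) <= l1c x * l1c y.
Proof.
case: x y => [a b] [c d]; rewrite /l1c /=.
have := ler_normB (a * c) (b * d); have := ler_normD (a * d) (b * c).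
by rewrite !normrM; lra.
Qed.

Lemma l1c_real (a : R) x : l1c (a%:C * x) = `|a| * l1c x.
Proof.
case: x => [c d]; rewrite /l1c /= !mul0r subr0 addr0.
by rewrite !normrM mulrDr.
Qed.

Context {p q : nat}.
Implicit Types A B : 'M[R[i]]_(p, q).

Definition l1norm A : R := \sum_i \sum_j l1c (A i j).

Lemma l1norm_ge0 A : 0 <= l1norm A.
Proof. by do 2!apply: sumr_ge0 => ? _; exact: l1c_ge0. Qed.

Lemma l1norm0 : l1norm (0 : 'M[R[i]]_(p, q)) = 0.
Proof. by do 2!apply: big1 => ? _; rewrite mxE l1c0. Qed.

Lemma l1norm_entry A i j : l1c (A i j) <= l1norm A.
Proof.
rewrite /l1norm (bigD1 i)//= (bigD1 j)//= -addrA lerDl addr_ge0//.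
  by apply: sumr_ge0 => ? _; exact: l1c_ge0.
by do 2!apply: sumr_ge0 => ? _; exact: l1c_ge0.
Qed.

Lemma l1norm_eq0 A : l1norm A <= 0 -> A = 0.
Proof.
move=> A0; apply/matrixP => i j; rewrite mxE; apply: l1c_eq0.
exact: le_trans (l1norm_entry _ _ _) A0.
Qed.

Lemma l1normD A B : l1norm (A + B) <= l1norm A + l1norm B.
Proof.
rewrite /l1norm -big_split; apply: ler_sum => i _.
by rewrite -big_split; apply: ler_sum => j _; rewrite mxE l1cD.
Qed.

Lemma l1normN A : l1norm (- A) = l1norm A.
Proof. by do 2!apply: eq_bigr => ? _; rewrite mxE l1cN. Qed.

Lemma l1normB A B : l1norm (A - B) <= l1norm A + l1norm B.
Proof. by rewrite -(l1normN B) l1normD. Qed.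

Lemma l1normZ (a : R) A : l1norm (a%:C *: A) = `|a| * l1norm A.
Proof.
rewrite /l1norm mulr_sumr; apply: eq_bigr => i _.
by rewrite mulr_sumr; apply: eq_bigr => j _; rewrite mxE l1c_real.
Qed.

Lemma l1normZc (a : R[i]) A : l1norm (a *: A) <= l1c a * l1norm A.
Proof.
rewrite /l1norm mulr_sumr; apply: ler_sum => i _.
by rewrite mulr_sumr; apply: ler_sum => j _; rewrite mxE l1cM.
Qed.

Lemma l1norm_const (e : R) A :
  (forall i j, l1c (A i j) <= e) -> l1norm A <= (p * q)%:R * e.
Proof.
move=> Ae; apply: (@le_trans _ _ (\sum_(i < p) \sum_(j < q) e)).
  by do 2!apply: ler_sum => ? _.
rewrite (eq_bigr (fun=> q%:R * e)).
  by rewrite sumr_const card_ord -[X in X <= _]mulr_natl natrM mulrA.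
by move=> i _; rewrite sumr_const card_ord -[LHS]mulr_natl.
Qed.

End L1Norm.

Section L1NormProduct.
Context {R : realType}.

Lemma l1normM (p q r : nat) (A : 'M[R[i]]_(p, q)) (B : 'M[R[i]]_(q, r)) :
  l1norm (A *m B) <= l1norm A * l1norm B.
Proof.
rewrite /l1norm mulr_suml; apply: ler_sum => i _.
apply: (@le_trans _ _ (\sum_k \sum_j l1c (A i j) * l1c (B j k))).
  apply: ler_sum => k _; rewrite mxE.
  elim/big_ind2 : _ => [|x y z t xy zt|j _]; first by rewrite l1c0.
    by apply: le_trans (l1cD _ _) _; rewrite lerD.
  exact: l1cM.
rewrite exchange_big mulr_suml; apply: ler_sum => j _ /=.
rewrite -mulr_sumr ler_wpM2l ?l1c_ge0// (bigD1 j)//= lerDl.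
by do 2!apply: sumr_ge0 => ? _; exact: l1c_ge0.
Qed.

Lemma l1norm_adj (p q : nat) (A : 'M[R[i]]_(p, q)) : l1norm (A^t*) = l1norm A.
Proof.
rewrite /l1norm exchange_big; apply: eq_bigr => i _; apply: eq_bigr => j _.
by rewrite !mxE l1cJ.
Qed.

Lemma l1norm_col (p q r : nat) (A : 'M[R[i]]_(p, r)) (B : 'M[R[i]]_(q, r)) :
  l1norm (col_mx A B) = l1norm A + l1norm B.
Proof.
rewrite /l1norm big_split_ord; congr (_ + _); apply: eq_bigr => i _;
  by apply: eq_bigr => j _; rewrite ?col_mxEu ?col_mxEd.
Qed.

Lemma l1norm_row (p q r : nat) (A : 'M[R[i]]_(r, p)) (B : 'M[R[i]]_(r, q)) :
  l1norm (row_mx A B) = l1norm A + l1norm B.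
Proof.
rewrite /l1norm -big_split; apply: eq_bigr => i _.
rewrite big_split_ord; congr (_ + _); apply: eq_bigr => j _;
  by rewrite ?row_mxEl ?row_mxEr.
Qed.

Lemma l1norm_usub (p q r : nat) (A : 'M[R[i]]_(p + q, r)) :
  l1norm (usubmx A) <= l1norm A.
Proof. by rewrite -{2}(vsubmxK A) l1norm_col lerDl l1norm_ge0. Qed.

Lemma l1norm_dsub (p q r : nat) (A : 'M[R[i]]_(p + q, r)) :
  l1norm (dsubmx A) <= l1norm A.
Proof. by rewrite -{2}(vsubmxK A) l1norm_col lerDr l1norm_ge0. Qed.

Lemma l1norm_lsub (p q r : nat) (A : 'M[R[i]]_(r, p + q)) :
  l1norm (lsubmx A) <= l1norm A.
Proof. by rewrite -{2}(hsubmxK A) l1norm_row lerDl l1norm_ge0. Qed.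

End L1NormProduct.

(** * Differential calculus relative to a subset of the real line *)

Section Differentiability.
Context {R : realType}.
Implicit Types (D : set R) (x : R).

Section Def.
Context {p q : nat}.
Implicit Types (f g : R -> 'M[R[i]]_(p, q)).

(* Derivatives relative to [D], which covers the one-sided derivatives at the
   ends of an interval or half-line. *)
Definition diff_at D f x (l : 'M[R[i]]_(p, q)) := forall e, 0 < e ->
  \forall y \near within D (nbhs x),
    l1norm (f y - f x - (y - x)%:C *: l) <= e * `|y - x|.

Definition cont_at D f x := forall e, 0 < e ->
  \forall y \near within D (nbhs x), l1norm (f y - f x) <= e.

End Def.

Lemma near_within_dist D x (e : R) : 0 < e ->
  \forall y \near within D (nbhs x), `|y - x| <= e.
Proof.
move=> e0; apply: cvg_within.
by near=> y; rewrite distrC ltW//; near: y; exact: nbhsx_ballx (PosNum e0).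
Unshelve. all: by end_near. Qed.

Section Basic.
Context {p q : nat}.
Implicit Types (f g : R -> 'M[R[i]]_(p, q)) (l k : 'M[R[i]]_(p, q)).

Lemma diff_at_le D f x l C :
  (forall e, 0 < e -> \forall y \near within D (nbhs x),
    l1norm (f y - f x - (y - x)%:C *: l) <= C * e * `|y - x|) ->
  diff_at D f x l.
Proof.
move=> H e e0; have C0 : 0 < `|C| + 1 by rewrite ltr_wpDl.
have := H (e / (`|C| + 1)); rewrite divr_gt0// => /(_ isT).
apply: filterS => y /le_trans; apply; rewrite ler_wpM2r//.
rewrite mulrCA ger_pMr// ler_pdivrMr// mul1r.
by have := ler_norm C; lra.
Qed.

Lemma diff_at_cont D f x l : diff_at D f x l -> cont_at D f x.
Proof.
move=> H e e0; have l0 : 0 < 1 + l1norm l by rewrite ltr_pwDl// l1norm_ge0.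
near=> y.
have h1 : l1norm (f y - f x - (y - x)%:C *: l) <= 1 * `|y - x|.
  by near: y; apply: H.
have -> : f y - f x = (f y - f x - (y - x)%:C *: l) + (y - x)%:C *: l.
  by rewrite subrK.
apply: le_trans (l1normD _ _) _; rewrite l1normZ.
apply: (@le_trans _ _ (`|y - x| * (1 + l1norm l))).
  by rewrite mulrDr mulr1 lerD2r -[leRHS]mul1r.
rewrite -ler_pdivlMr//.
by near: y; apply: near_within_dist; rewrite divr_gt0.
Unshelve. all: by end_near. Qed.

Lemma diff_at_sub D D' f x l : D' `<=` D -> diff_at D f x l ->
  diff_at D' f x l.
Proof.
move=> DD' H e /H; rewrite !near_withinE; apply: filterS => y h /DD'; exact: h.
Qed.

Lemma cont_at_sub D D' f x : D' `<=` D -> cont_at D f x ->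
  cont_at D' f x.
Proof.
move=> DD' H e /H; rewrite !near_withinE; apply: filterS => y h /DD'; exact: h.
Qed.

Lemma diff_at_ext D f g x l : D x -> (forall y, D y -> f y = g y) ->
  diff_at D f x l -> diff_at D g x l.
Proof.
move=> Dx fg H e /H; rewrite !near_withinE; apply: filterS => y h Dy.
by rewrite -!fg//; exact: h.
Qed.

Lemma diff_at_eq D f x l l' : diff_at D f x l -> l = l' -> diff_at D f x l'.
Proof. by move=> h <-. Qed.

Lemma diff_at_cst D (c : 'M[R[i]]_(p, q)) x : diff_at D (fun=> c) x 0.
Proof.
move=> e e0; near=> y.
by rewrite subrr scaler0 subr0 l1norm0 mulr_ge0// ltW.
Unshelve. all: by end_near. Qed.

Lemma diff_atD D f g x l k : diff_at D f x l -> diff_at D g x k ->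
  diff_at D (fun y => f y + g y) x (l + k).
Proof.
move=> fl gk; apply: (@diff_at_le _ _ _ _ 2) => e e0.
near=> y.
have -> : f y + g y - (f x + g x) - (y - x)%:C *: (l + k) =
   (f y - f x - (y - x)%:C *: l) + (g y - g x - (y - x)%:C *: k).
  by apply/matrixP => i j; rewrite !mxE; ring.
apply: le_trans (l1normD _ _) _; rewrite -mulrA mulr2n mulrDl mul1r lerD//.
  by near: y; exact: fl.
by near: y; exact: gk.
Unshelve. all: by end_near. Qed.

Lemma cont_at_bounded D f x : cont_at D f x ->
  \forall y \near within D (nbhs x), l1norm (f y) <= l1norm (f x) + 1.
Proof.
move=> /(_ 1 ltr01); apply: filterS => y h.
rewrite -[f y](subrK (f x)); apply: le_trans (l1normD _ _) _.
by rewrite addrC lerD2l.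
Qed.

(** The properness hypothesis says that [x] is an accumulation point of [D]. At an isolated point of
    [D] every matrix would be a derivative. *)
Lemma diff_at_uniq D f x l k : ProperFilter (within D (x^')) ->
  diff_at D f x l -> diff_at D f x k -> l = k.
Proof.
move=> PF fl fk; apply/eqP; rewrite -subr_eq0; apply/eqP; apply: l1norm_eq0.
apply/ler_addgt0Pl => e e0; rewrite addr0.
have e20 : 0 < e / 2 by rewrite divr_gt0.
suff [y [/= yx hl hk]] : exists y, [/\ y != x, 
     l1norm (f y - f x - (y - x)%:C *: l) <= e / 2 * `|y - x| &
     l1norm (f y - f x - (y - x)%:C *: k) <= e / 2 * `|y - x|].
  have yx0 : 0 < `|y - x| by rewrite normr_gt0 subr_eq0.
  rewrite -(ler_pM2l yx0) -l1normZ.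
  have -> : (y - x)%:C *: (l - k) = (f y - f x - (y - x)%:C *: k) -
     (f y - f x - (y - x)%:C *: l).
    by apply/matrixP => i j; rewrite !mxE; ring.
  by apply: le_trans (l1normB _ _) _; lra.
apply: (@filter_ex _ (within D x^')).
have nb (P : set R) : (\forall y \near within D (nbhs x), P y) ->
    \forall y \near within D x^', P y.
  rewrite !near_withinE; apply: filterS => y h _; exact: h.
apply: filter_app (nb _ (fl _ e20)); apply: filter_app (nb _ (fk _ e20)).
have : within D x^' [set y | y != x] 
  by apply: (@filterS _ (nbhs x) _ setT) filterT => y _ yx _; exact: yx.
by apply: filterS => y yx hk hl; split.
Qed.

End Basic.

(** Only real linearity of [L] is asked, because the adjoint is conjugate-linear over the complex
    field. *)
Lemma diff_at_map (p q p' q' : nat) (L : 'M[R[i]]_(p, q) -> 'M[R[i]]_(p', q'))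
    (c : R) D f x l :
  (forall A B, L (A - B) = L A - L B) ->
  (forall (a : R) A, L (a%:C *: A) = a%:C *: L A) ->
  (forall A, l1norm (L A) <= c * l1norm A) ->
  diff_at D f x l -> diff_at D (L \o f) x (L l).
Proof.
move=> LB LZ Lc fl; apply: (@diff_at_le _ _ _ _ _ _ `|c|) => e e0.
apply: filterS (fl e e0) => y h /=.
rewrite -LZ -!LB; apply: le_trans (Lc _) _.
apply: (@le_trans _ _ (`|c| * l1norm (f y - f x - (y - x)%:C *: l)));
  last by rewrite -mulrA ler_wpM2l// h.
by rewrite ler_wpM2r// ?l1norm_ge0// ler_norm.
Qed.

Lemma diff_atN (p q : nat) D (f : R -> 'M[R[i]]_(p, q)) x l :
  diff_at D f x l -> diff_at D (fun y => - f y) x (- l).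
Proof.
apply: (@diff_at_map _ _ _ _ (fun A => - A) 1) => [A B|a A|A].
- by rewrite opprD.
- by rewrite scalerN.
- by rewrite mul1r l1normN.
Qed.

Lemma diff_atZ (p q : nat) D (f : R -> 'M[R[i]]_(p, q)) (a : R[i]) x l :
  diff_at D f x l -> diff_at D (fun y => a *: f y) x (a *: l).
Proof.
apply: (@diff_at_map _ _ _ _ (fun A => a *: A) (l1c a)) => [A B|b A|A].
- by rewrite scalerBr.
- by rewrite !scalerA mulrC.
- exact: l1normZc.
Qed.

Lemma diff_at_adj (p q : nat) D (f : R -> 'M[R[i]]_(p, q)) x l :
  diff_at D f x l -> diff_at D (fun y => (f y)^t*) x (l^t*).
Proof.
apply: (@diff_at_map _ _ _ _ (fun A => A^t*) 1) => [A B|b A|A].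
- by apply/matrixP => i j; rewrite !mxE rmorphB.
- apply/matrixP => i j; rewrite !mxE rmorphM; congr (_ * _).
  exact: conjc_real.
- by rewrite l1norm_adj mul1r.
Qed.

Lemma diff_at_usub (p q r : nat) D (f : R -> 'M[R[i]]_(p + q, r)) x l :
  diff_at D f x l -> diff_at D (fun y => usubmx (f y)) x (usubmx l).
Proof.
apply: (@diff_at_map _ _ _ _ usubmx 1) => [A B|b A|A].
- by rewrite linearB.
- by rewrite linearZ.
- by rewrite mul1r l1norm_usub.
Qed.

Lemma diff_at_dsub (p q r : nat) D (f : R -> 'M[R[i]]_(p + q, r)) x l :
  diff_at D f x l -> diff_at D (fun y => dsubmx (f y)) x (dsubmx l).
Proof.
apply: (@diff_at_map _ _ _ _ dsubmx 1) => [A B|b A|A].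
- by rewrite linearB.
- by rewrite linearZ.
- by rewrite mul1r l1norm_dsub.
Qed.

Lemma diff_at_lsub (p q r : nat) D (f : R -> 'M[R[i]]_(r, p + q)) x l :
  diff_at D f x l -> diff_at D (fun y => lsubmx (f y)) x (lsubmx l).
Proof.
apply: (@diff_at_map _ _ _ _ lsubmx 1) => [A B|b A|A].
- by rewrite linearB.
- by rewrite linearZ.
- by rewrite mul1r l1norm_lsub.
Qed.

Lemma diff_atM (p q r : nat) D (f : R -> 'M[R[i]]_(p, q))
    (g : R -> 'M[R[i]]_(q, r)) x l k :
  diff_at D f x l -> diff_at D g x k ->
  diff_at D (fun y => f y *m g y) x (l *m g x + f x *m k).
Proof.
move=> fl gk.
apply: (@diff_at_le _ _ _ _ _ _ (l1norm (g x) + 1 + l1norm l + l1norm (f x)))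
  => e e0; near=> y.
have -> : f y *m g y - f x *m g x - (y - x)%:C *: (l *m g x + f x *m k) =
  (f y - f x - (y - x)%:C *: l) *m g y + (y - x)%:C *: l *m (g y - g x)
  + f x *m (g y - g x - (y - x)%:C *: k).
  rewrite !mulmxBl !mulmxBr scalerDr -!scalemxAl -scalemxAr.
  set a := f y *m _; set b := f x *m g x; set c := f x *m g y.
  set d := _ *: (l *m g y); set d' := _ *: (l *m g x); set k' := _ *: _.
  by rewrite addrA !opprD; apply/matrixP => i j; rewrite !mxE; ring.
have hg : l1norm (g y) <= l1norm (g x) + 1.
  by near: y; apply: cont_at_bounded; exact: diff_at_cont gk.
have hf : l1norm (f y - f x - (y - x)%:C *: l) <= e * `|y - x|.
  by near: y; exact: fl.
have hk : l1norm (g y - g x - (y - x)%:C *: k) <= e * `|y - x|.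
  by near: y; exact: gk.
have hc : l1norm (g y - g x) <= e.
  by near: y; exact: (diff_at_cont gk).
apply: le_trans (l1normD _ _) _.
apply: le_trans (lerD (l1normD _ _) (lexx _)) _.
apply: (@le_trans _ _ (e * `|y - x| * (l1norm (g x) + 1)
    + `|y - x| * l1norm l * e + l1norm (f x) * (e * `|y - x|))); last first.
  by rewrite le_eqVlt; apply/orP; left; apply/eqP; ring.
apply: lerD; first apply: lerD.
- by apply: le_trans (l1normM _ _) _; apply: ler_pM; rewrite ?l1norm_ge0.
- apply: le_trans (l1normM _ _) _; rewrite l1normZ.
  by apply: ler_pM; rewrite ?mulr_ge0 ?l1norm_ge0.
- by apply: le_trans (l1normM _ _) _; apply: ler_pM; rewrite ?l1norm_ge0.
Unshelve. all: by end_near. Qed.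

Lemma diff_at_col (p q r : nat) D (f : R -> 'M[R[i]]_(p, r))
    (g : R -> 'M[R[i]]_(q, r)) x l k :
  diff_at D f x l -> diff_at D g x k ->
  diff_at D (fun y => col_mx (f y) (g y)) x (col_mx l k).
Proof.
move=> fl gk; apply: (@diff_at_le _ _ _ _ _ _ 2) => e e0; near=> y.
rewrite scale_col_mx !opp_col_mx !add_col_mx l1norm_col.
rewrite -mulrA mulr2n mulrDl mul1r lerD//.
  by near: y; exact: fl.
by near: y; exact: gk.
Unshelve. all: by end_near. Qed.

Lemma diff_at_invmx (p : nat) D (f : R -> 'M[R[i]]_p) x l :
  D x -> (forall y, D y -> f y \in unitmx) -> diff_at D f x l ->
  diff_at D (fun y => invmx (f y)) x (- (invmx (f x) *m l *m invmx (f x))).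
Proof.
move=> Dx fu fl.
set N := l1norm (invmx (f x)); have N0 : 0 <= N by exact: l1norm_ge0.
have N1 : 0 < N + 1 by rewrite ltr_wpDl.
have dinv y : D y -> invmx (f y) - invmx (f x) =
    - (invmx (f y) *m (f y - f x) *m invmx (f x)).
  move=> Dy; rewrite mulmxBr mulmxBl mulVmx ?fu// mul1mx -mulmxA mulmxV ?fu//.
  by rewrite mulmx1 opprB.
(* Once [f y] is within [1 / (2 (N + 1))] of [f x], the identity [dinv] bounds the change of the
   inverse by half of the new inverse, which the left-hand side absorbs. *)
have bnd : \forall y \near within D (nbhs x), D y -> l1norm (invmx (f y)) <= 2 * N.
  have e0 : 0 < (2 * (N + 1))^-1 by rewrite invr_gt0 mulr_gt0.
  apply: filterS (diff_at_cont fl e0) => y h Dy.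
  have -> : invmx (f y) = invmx (f x) + (invmx (f y) - invmx (f x)).
    by rewrite addrC subrK.
  have h1 : l1norm (invmx (f y) *m (f y - f x) *m invmx (f x)) <=
      l1norm (invmx (f y)) / 2.
    apply: le_trans (l1normM _ _) _.
    apply: le_trans (ler_wpM2r (l1norm_ge0 _) (l1normM _ _)) _.
    rewrite -mulrA ler_wpM2l ?l1norm_ge0//.
    apply: le_trans (ler_wpM2r (l1norm_ge0 _) h) _.
    rewrite -/N invfM -mulrA ger_pMr ?invr_gt0// mulrC ler_pdivrMr//; lra.
  have := l1normD (invmx (f x)) (invmx (f y) - invmx (f x)).
  rewrite {2}dinv// l1normN addrC subrK -/N; lra.
apply: (@diff_at_le _ _ _ _ _ _ (2 * N * N + 2 * N * N * l1norm l * N)) => e e0.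
have e1 : 0 < e by [].
have nD : \forall y \near within D (nbhs x), D y.
  by rewrite near_withinE; apply: nearW.
near=> y.
have Dy : D y by near: y.
have hb : l1norm (invmx (f y)) <= 2 * N by move: Dy; near: y.
have hl : l1norm (f y - f x - (y - x)%:C *: l) <= e * `|y - x|.
  by near: y; exact: fl.
have hc : l1norm (f y - f x) <= e.
  by near: y; exact: (diff_at_cont fl).
have -> : invmx (f y) - invmx (f x) -
    (y - x)%:C *: (- (invmx (f x) *m l *m invmx (f x))) =
  - (invmx (f y) *m (f y - f x - (y - x)%:C *: l) *m invmx (f x))
  - (y - x)%:C *: ((invmx (f y) - invmx (f x)) *m l *m invmx (f x)).
  rewrite {1}dinv//; move: (f y - f x) (invmx (f y)) (invmx (f x)) => d A B.
  rewrite !(mulmxBr, mulmxBl) -!scalemxAr -!scalemxAl.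
  by apply/matrixP => i j; rewrite !mxE; ring.
apply: le_trans (l1normB _ _) _; rewrite l1normN l1normZ.
apply: (@le_trans _ _ (2 * N * (e * `|y - x|) * N +
    `|y - x| * (2 * N * e * N * l1norm l * N))); last first.
  by rewrite le_eqVlt; apply/orP; left; apply/eqP; ring.
apply: lerD.
  apply: le_trans (l1normM _ _) _; rewrite -/N.
  apply: le_trans (ler_wpM2r N0 (l1normM _ _)) _.
  by rewrite ler_wpM2r//; apply: ler_pM; rewrite ?l1norm_ge0.
rewrite ler_wpM2l// dinv//.
apply: le_trans (l1normM _ _) _; rewrite -/N ler_wpM2r//.
apply: le_trans (l1normM _ _) _; rewrite ler_wpM2r ?l1norm_ge0// l1normN.
apply: le_trans (l1normM _ _) _; rewrite -/N ler_wpM2r//.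
by apply: le_trans (l1normM _ _) _; apply: ler_pM; rewrite ?l1norm_ge0.
Unshelve. all: by end_near. Qed.

End Differentiability.

(** * Mean value inequality and Gronwall bound *)

Lemma within_continuous_dist {R : realType} (h : R -> R) a b :
  (forall x, a <= x <= b -> forall e, 0 < e ->
    \forall y \near within `[a, b] (nbhs x), `|h y - h x| <= e) ->
  {within `[a, b], continuous h}.
Proof.
move=> H; apply/subspace_continuousP => x; rewrite /= in_itv /= => xab.
apply/cvgrPdist_le => e e0; apply: filterS (H x xab e e0) => y.
by rewrite distrC.
Qed.

Lemma is_derive_expRM {R : realType} (k x : R) :
  is_derive x 1 (fun s => expR (k * s)) (k * expR (k * x)).
Proof.
have h : is_derive x 1 (fun s : R => k * s) k.
  by apply: is_derive_eq; rewrite ?scaler0 ?add0r ?addr0 /GRing.scale /= ?mulr1.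
have := @is_derive1_comp _ expR (fun s : R => k * s) x _ _ (is_derive_expR _) h.
by rewrite mulrC.
Qed.

Lemma is_derive_continuous {R : realType} (g : R -> R) (x l : R) :
  is_derive x 1 g l -> {for x, continuous g}.
Proof. by case => /derivable1_diffP /differentiable_continuous. Qed.

Section MeanValue.
Context {R : realType} {p q : nat}.
Implicit Types (f : R -> 'M[R[i]]_(p, q)) (L : 'M[R[i]]_(p, q) -> R).

(** Bounded functionals that are linear over the reals only, so that real and imaginary parts of
    entries qualify. *)
Definition real_functional L := [/\ forall A B, L (A - B) = L A - L B,
  forall (a : R) A, L (a%:C *: A) = a * L A &
  exists c, forall A, `|L A| <= c * l1norm A].

Lemma functional_cont L f D x : real_functional L -> cont_at D f x ->
  forall e, 0 < e ->
    \forall y \near within D (nbhs x), `|L (f y) - L (f x)| <= e.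
Proof.
move=> [LB LZ [c Lc]] fc e e0.
have c0 : 0 < `|c| + 1 by rewrite ltr_wpDl.
apply: filterS (fc (e / (`|c| + 1)) (divr_gt0 e0 c0)) => y.
rewrite ler_pdivlMr// => h; rewrite -LB; apply: le_trans (Lc _) _.
apply: le_trans h; rewrite mulrC ler_wpM2l ?l1norm_ge0//.
by have := ler_norm c; lra.
Qed.

Lemma functional_derive L f a b x l : real_functional L -> a < x < b ->
  diff_at `[a, b] f x l -> is_derive x 1 (L \o f) (L l).
Proof.
move=> [LB LZ [c Lc]] /andP[ax xb] fl.
have c0 : 0 < `|c| + 1 by rewrite ltr_wpDl.
suff H : h^-1 *: (((L \o f) \o shift x) (h *: (1 : R)) - (L \o f) x)
    @[h --> (0 : R)^'] --> L l.
  by apply: DeriveDef; [exact: (cvgP _ H)|exact: (cvg_lim _ H)].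
apply/cvgrPdist_le => e e0.
have := fl (e / (`|c| + 1)) (divr_gt0 e0 c0).
rewrite near_withinE => fn.
have {}fn : \forall y \near x,
    l1norm (f y - f x - (y - x)%:C *: l) <= e / (`|c| + 1) * `|y - x|.
  have hab : \forall y \near x, y \in `]a, b[%R.
    by apply: near_in_itvoo; rewrite in_itv/= ax.
  apply: filterS2 hab fn => y; rewrite in_itv/= => /andP[ay yb]; apply => /=.
  by rewrite in_itv/= !ltW.
have [d /= d0 dn] := (@nbhs_ballP _ _ x _).1 fn.
near=> h.
have h0 : h != 0 by near: h; exact: nbhs_dnbhs_neq.
have hd : `|h| < d by near: h; exact: dnbhs0_lt.
have := dn (h + x); rewrite /ball /= opprD addrCA subrr addr0 normrN => /(_ hd).
rewrite addrK => hf.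
rewrite /= scaler1 -(ler_pM2l (_ : 0 < `|h|)) ?normr_gt0// -normrM mulrBr.
rewrite /GRing.scale /= mulVKf// -LZ -LB distrC -LB.
apply: le_trans (Lc _) _.
apply: (@le_trans _ _ ((`|c| + 1) * l1norm (f (h + x) - f x - h%:C *: l))).
  by rewrite ler_wpM2r ?l1norm_ge0//; have := ler_norm c; lra.
apply: le_trans (ler_wpM2l (ltW c0) hf) _.
by rewrite mulrA mulrCA mulfV ?gt_eqF// mulr1 mulrC.
Unshelve. all: by end_near. Qed.

(** The scalar mean value theorem applied to [L \o f - g]. Taking [g] constant gives the
    monotonicity of the flux and of the boundary form; taking [L] norming gives the estimates in
    [l1norm]. *)
Lemma mean_value_functional L f (f' : R -> 'M[R[i]]_(p, q)) (g g' : R -> R) a b :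
  a <= b -> real_functional L ->
  (forall s, a <= s <= b -> diff_at `[a, b] f s (f' s)) ->
  (forall s : R, is_derive s 1 g (g' s)) ->
  (forall s, a <= s <= b -> L (f' s) <= g' s) ->
  L (f b) - L (f a) <= g b - g a.
Proof.
rewrite le_eqVlt => /predU1P[->|ab] Lr fd gd Lg; first by rewrite !subrr.
have hd x : x \in `]a, b[%R ->
    is_derive x 1 (fun s => (L \o f) s - g s) (L (f' x) - g' x).
  rewrite in_itv/= => /andP[ax xb]; have xab : a <= x <= b by rewrite !ltW.
  have d1 := functional_derive Lr (introT andP (conj ax xb)) (fd x xab).
  have d2 := gd x.
  exact: is_deriveB.
have hc : {within `[a, b], continuous (fun s => (L \o f) s - g s)}.
  apply: within_continuous_dist => x xab e e0.
  have e20 : 0 < e / 2 by rewrite divr_gt0.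
  have h1 := functional_cont Lr (diff_at_cont (fd x xab)) e20.
  have h2 : \forall y \near within `[a, b] (nbhs x), `|g x - g y| <= e / 2.
    apply: cvg_within; have /cvgrPdist_le := is_derive_continuous (gd x).
    exact.
  apply: filterS2 h1 h2 => y h1 h2 /=.
  rewrite (_ : _ - _ = (L (f y) - L (f x)) + (g x - g y)); last by ring.
  by apply: le_trans (ler_normD _ _) _; lra.
have [c] := MVT ab hd hc; rewrite in_itv/= => /andP[ac cb] hE.
have Lgc : L (f' c) <= g' c by apply: Lg; rewrite (ltW ac) (ltW cb).
have : (L (f' c) - g' c) * (b - a) <= 0.
  by rewrite mulr_le0_ge0// ?subr_le0// subr_ge0 ltW.
by rewrite -hE /=; lra.
Qed.

(* A norming functional reduces the mean value inequality to the scalar case. *)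
Lemma real_functional_sign (A : 'M[R[i]]_(p, q)) :
  exists2 L, real_functional L &
    L A = l1norm A /\ forall B, L B <= l1norm B.
Proof.
pose s (x : R) : R := if 0 <= x then 1 else -1.
have sn x y : s x * y <= `|y|.
  rewrite /s; case: ifP => _; rewrite ?mul1r ?mulN1r ?ler_norm//.
  by rewrite -normrN ler_norm.
have sx x : s x * x = `|x|.
  rewrite /s; case: ifPn => [x0|]; first by rewrite mul1r ger0_norm.
  by rewrite -ltNge => x0; rewrite mulN1r ltr0_norm.
pose L (B : 'M[R[i]]_(p, q)) : R := \sum_i \sum_j
  (s (complex.Re (A i j)) * complex.Re (B i j) +
   s (complex.Im (A i j)) * complex.Im (B i j)).
have LB B : L B <= l1norm B.
  by do 2!apply: ler_sum => ? _; exact: lerD.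
have LZ (a : R) B : L (a%:C *: B) = a * L B.
  rewrite /L mulr_sumr; apply: eq_bigr => i _.
  rewrite mulr_sumr; apply: eq_bigr => j _; rewrite mxE cReM cImM /=.
  by rewrite !mul0r subr0 addr0; ring.
have Lsub B C : L (B - C) = L B - L C.
  rewrite /L -sumrB; apply: eq_bigr => i _.
  rewrite -sumrB; apply: eq_bigr => j _; rewrite !mxE.
  by case: (B i j) (C i j) => [b1 b2] [c1 c2] /=; ring.
exists L; last split => //.
  split => //; exists 1 => B; rewrite mul1r ler_norml LB andbT.
  rewrite lerNl; have := LB ((-1)%:C *: B); rewrite LZ mulN1r.
  by rewrite l1normZ normrN normr1 mul1r.
by do 2!apply: eq_bigr => ? _; rewrite !sx.
Qed.

Lemma mean_value f (f' : R -> 'M[R[i]]_(p, q)) (g g' : R -> R) a b :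
  a <= b ->
  (forall s, a <= s <= b -> diff_at `[a, b] f s (f' s)) ->
  (forall s : R, is_derive s 1 g (g' s)) ->
  (forall s, a <= s <= b -> l1norm (f' s) <= g' s) ->
  l1norm (f b - f a) <= g b - g a.
Proof.
move=> ab fd gd fg.
have [L Lr [<- LB]] := real_functional_sign (f b - f a).
have [LD _ _] := Lr; rewrite LD.
by apply: (mean_value_functional ab Lr fd gd) => s sab; apply: le_trans (LB _) (fg s sab).
Qed.

Lemma mean_value_linear f (f' : R -> 'M[R[i]]_(p, q)) (c : R) a b :
  a <= b ->
  (forall s, a <= s <= b -> diff_at `[a, b] f s (f' s)) ->
  (forall s, a <= s <= b -> l1norm (f' s) <= c) ->
  l1norm (f b - f a) <= c * (b - a).
Proof.
move=> ab fd fc; rewrite mulrBr.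
apply: (@mean_value f f' (fun s => c * s) (fun=> c)) => // s.
by apply: is_derive_eq; rewrite ?scaler0 ?add0r ?addr0 /GRing.scale /= ?mulr1.
Qed.

Lemma l1norm_functional_cont f a b : 
  (forall s, a <= s <= b -> cont_at `[a, b] f s) ->
  {within `[a, b], continuous (fun s => l1norm (f s))}.
Proof.
move=> fc; apply: within_continuous_dist => x xab e e0.
apply: filterS (fc x xab e e0) => y; apply: le_trans.
rewrite ler_norml; apply/andP; split.
  rewrite lerNl opprB; have := l1normB (f y) (f y - f x).
  by rewrite subKr; lra.
by have := l1normD (f y - f x) (f x); rewrite subrK; lra.
Qed.

Lemma gronwall f (f' : R -> 'M[R[i]]_(p, q)) (K e X : R) :
  0 <= X -> 0 < K -> 0 <= e ->
  (forall s, 0 <= s <= X -> diff_at `[0, X] f s (f' s)) ->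
  (forall s, 0 <= s <= X -> l1norm (f' s) <= K * l1norm (f s) + e) ->
  forall x, 0 <= x <= X ->
    l1norm (f x) <= 2 * (l1norm (f 0) + e * X) * expR (2 * K * X).
Proof.
move=> X0 K0 e0 fd fK.
(* Compare the maximum of [exp (- 2 K s) |f s|] with itself. *)
pose w s := expR (- (2 * K) * s) * l1norm (f s).
have wc : {within `[0, X], continuous w}.
  apply/subspace_continuousP => x xX; apply: cvgM.
    apply: cvg_within_filter.
    exact: is_derive_continuous (is_derive_expRM _ _).
  suff /subspace_continuousP : {within `[0, X], continuous (fun s => l1norm (f s))}.
    exact.
  by apply: l1norm_functional_cont => s sX; exact: diff_at_cont (fd s sX).
have [x0] := EVT_max X0 wc; rewrite in_itv/= => /andP[x00 x0X] wmax.
pose B := w x0.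
have B0 : 0 <= B by rewrite mulr_ge0 ?expR_ge0 ?l1norm_ge0.
have wB s : 0 <= s <= X -> l1norm (f s) <= B * expR (2 * K * s).
  move=> sX; have := wmax s; rewrite in_itv/= => /(_ sX).
  rewrite -(ler_pM2r (expR_gt0 (2 * K * s))) /w mulrAC -expRD.
  by rewrite mulNr addNr expR0 mul1r.
have E1 : l1norm (f x0) = B * expR (2 * K * x0).
  by rewrite /B /w mulrAC -expRD mulNr addNr expR0 mul1r.
have gd (s : R) : is_derive s 1 (fun s => (B / 2) * expR (2 * K * s) + e * s)
    (K * (B * expR (2 * K * s)) + e).
  have h1 := is_derive_expRM (2 * K) s.
  apply: is_derive_eq; rewrite ?scaler0 ?add0r ?addr0 /GRing.scale /= ?mulr1.
  by field.
have hm : l1norm (f x0 - f 0) <=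
    (B / 2) * expR (2 * K * x0) + e * x0 - ((B / 2) * expR (2 * K * 0) + e * 0).
  apply: (mean_value x00 _ gd) => s /andP[s0 sx0].
    apply: diff_at_sub (fd s _); last by rewrite s0 (le_trans sx0).
    by move=> y /=; rewrite !in_itv/= => /andP[-> /le_trans ->].
  have sX : 0 <= s <= X by rewrite s0 (le_trans sx0).
  by apply: le_trans (fK s sX) _; rewrite lerD2r ler_pM2l// wB.
have h2 : l1norm (f x0) <= l1norm (f 0) + l1norm (f x0 - f 0).
  by have := l1normD (f 0) (f x0 - f 0); rewrite addrCA subrr addr0.
have h3 : e * x0 <= e * X by rewrite ler_wpM2l.
(* At the maximum point the integrated bound contributes only half of [B * expR (2 * K * x0)],
   thanks to the weight with rate [2 * K]. Absorbing this half produces the factor 2. *)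
have BE : B <= 2 * (l1norm (f 0) + e * X).
  have E2 : B <= B * expR (2 * K * x0).
    by rewrite ler_peMr// -expR0 ler_expR !mulr_ge0// ltW.
  by move: hm h2; rewrite mulr0 expR0 mulr1 mulr0 addr0 E1; lra.
move=> x xX; apply: le_trans (wB x xX) _.
have [_ xX'] := andP xX.
by apply: ler_pM; rewrite ?expR_ge0// ler_expR ler_wpM2l// mulr_ge0// ltW.
Qed.

Lemma constant_of_diff0 f a b : a <= b ->
  (forall s, a <= s <= b -> diff_at `[a, b] f s 0) -> f b = f a.
Proof.
move=> ab fd; apply/eqP; rewrite -subr_eq0; apply/eqP; apply: l1norm_eq0.
by have := @mean_value_linear f (fun=> 0) 0 a b ab fd; rewrite mul0r; apply => s _; rewrite l1norm0.
Qed.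

End MeanValue.

Lemma is_derive_near {R : realType} (h : R -> R) (x l e : R) :
  is_derive x 1 h l -> 0 < e ->
  \forall y \near x, `|h y - h x - (y - x) * l| <= e * `|y - x|.
Proof.
move=> [hd hl] e0.
have : k^-1 *: ((h \o shift x) (k *: (1 : R)) - h x) @[k --> (0 : R)^'] --> l.
  by rewrite -hl; exact: hd.
move/cvgrPdist_le => /(_ e e0); rewrite near_withinE => /nbhs_ballP[d /= d0 hn].
apply/nbhs_ballP; exists d => // y; rewrite /ball /= => yx.
have [->|yx0] := eqVneq y x; first by rewrite !subrr mul0r subr0 normr0 mulr0.
have := hn (y - x); rewrite /ball /= sub0r normrN distrC => /(_ yx).
rewrite subr_eq0 => /(_ yx0); rewrite scaler1 subrK /GRing.scale /= => H.
have yx1 : 0 < `|y - x| by rewrite normr_gt0 subr_eq0.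
rewrite -(ler_pM2l yx1) -normrM mulrBr mulVKf ?subr_eq0// in H.
by rewrite [leLHS]distrC (distrC x y) [leRHS]mulrC.
Qed.

(** * Antiderivatives and existence for linear differential equations *)

Section Antiderivative.
Context {R : realType}.

(** The retraction of the line onto [[0, T]]. Composing with it extends a continuous function on the
    interval to the whole line, so that its primitive has a two-sided derivative at the end points
    as well. *)
Let clamp (T x : R) := (`|x| - `|x - T| + T) / 2.

Let clamp_id (T x : R) : 0 <= x <= T -> clamp T x = x.
Proof.
move=> /andP[x0 xT]; rewrite /clamp ger0_norm// ler0_norm ?subr_le0//; lra.
Qed.

Let clamp_in (T x : R) : 0 <= T -> 0 <= clamp T x <= T.
Proof.
move=> T0; rewrite /clamp.
have [x0|x0] := ler0P x; have [y0|y0] := ler0P (x - T); apply/andP; split; lra.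
Qed.

Let clamp_cont (T : R) : continuous (clamp T).
Proof.
move=> x; apply: cvgM; last exact: cvg_cst.
apply: cvgD; last exact: cvg_cst; apply: cvgB.
  exact: norm_continuous.
by apply: cvg_norm; apply: cvgB; [exact: cvg_id|exact: cvg_cst].
Qed.

Lemma real_antiderivative (h : R -> R) T : 0 <= T ->
  {within `[0, T], continuous h} ->
  exists H : R -> R, forall s, 0 <= s <= T -> is_derive s 1 H (h s).
Proof.
move=> T0 /subspace_continuousP hc; pose hT := h \o clamp T.
have hTc : continuous hT.
  move=> x; apply/cvgrPdist_le => e e0.
  have cx : clamp T x \in `[0, T]%R by rewrite in_itv/= clamp_in.
  have := hc _ cx; move=> /cvgrPdist_le /(_ e e0); rewrite near_withinE => nh.
  have {}nh : \forall y \near x, clamp T y \in `[0, T]%R ->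
      `|h (clamp T x) - h (clamp T y)| <= e by exact: (@clamp_cont T x _ nh).
  near=> y; suff : clamp T y \in `[0, T]%R by near: y.
  by rewrite in_itv/= clamp_in.
(* The integral starts at -1, and integrability is needed up to [T + 1], to make every point of
   [[0, T]] interior. *)
pose H x := (\int[lebesgue_measure]_(t in [set` Interval (BLeft (- 1)) (BRight x)])
  hT t)%R.
exists H => s /andP[s0 sT].
have sT1 : s < T + 1 by lra.
have hi : lebesgue_measure.-integrable `[(- 1), (T + 1)] (EFin \o hT).
  apply: continuous_compact_integrable; first exact: segment_compact.
  exact: continuous_subspaceT.
have [|d1 d2] := @continuous_FTC1 R hT (BLeft (- 1)) s (T + 1) sT1 hi _ (hTc s).
  by rewrite /= lte_fin; lra.
apply: DeriveDef => //; rewrite -derive1E d2 /hT /= clamp_id//.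
by rewrite s0.
Unshelve. all: by end_near. Qed.

Lemma antiderivative (p q : nat) (f : R -> 'M[R[i]]_(p, q)) T : 0 <= T ->
  (forall s, 0 <= s <= T -> cont_at `[0, T] f s) ->
  exists F : R -> 'M[R[i]]_(p, q), F 0 = 0 /\
    forall s, 0 <= s <= T -> diff_at `[0, T] F s (f s).
Proof.
move=> T0 fc.
have part (P : R[i] -> R) : (forall x y, P (x - y) = P x - P y) ->
    (forall x, `|P x| <= l1c x) -> forall i j,
    exists H : R -> R, forall s, 0 <= s <= T -> is_derive s 1 H (P (f s i j)).
  move=> PB Pl i j; apply: real_antiderivative => //.
  apply: within_continuous_dist => x xT e e0; apply: filterS (fc x xT e e0) => y.
  move=> h; rewrite -PB; apply: le_trans (Pl _) _; apply: le_trans h.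
  by have := l1norm_entry (f y - f x) i j; rewrite !mxE.
have /choice[HR HRE] : forall ij : 'I_p * 'I_q, exists H : R -> R,
    forall s, 0 <= s <= T -> is_derive s 1 H (complex.Re (f s ij.1 ij.2)).
  by move=> ij; exact: part cReB cRe_le_l1c _ _.
have /choice[HI HIE] : forall ij : 'I_p * 'I_q, exists H : R -> R,
    forall s, 0 <= s <= T -> is_derive s 1 H (complex.Im (f s ij.1 ij.2)).
  by move=> ij; exact: part cImB cIm_le_l1c _ _.
pose F s : 'M[R[i]]_(p, q) :=
  \matrix_(i, j) Complex (HR (i, j) s - HR (i, j) 0) (HI (i, j) s - HI (i, j) 0).
exists F; split; first by apply/matrixP => i j; rewrite !mxE !subrr.
move=> s sT; apply: (@diff_at_le _ _ _ _ _ _ _ ((p * q)%:R * 2)) => e e0.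
apply: cvg_within.
have nR : \forall y \near s, forall ij, `|HR ij y - HR ij s -
    (y - s) * complex.Re (f s ij.1 ij.2)| <= e * `|y - s|.
  exact: (@filter_forall _ _ _ (nbhs s) _ (fun ij => is_derive_near (HRE ij s sT) e0)).
have nI : \forall y \near s, forall ij, `|HI ij y - HI ij s -
    (y - s) * complex.Im (f s ij.1 ij.2)| <= e * `|y - s|.
  exact: (@filter_forall _ _ _ (nbhs s) _ (fun ij => is_derive_near (HIE ij s sT) e0)).
apply: filterS2 nR nI => y nR nI; rewrite -!mulrA.
apply: l1norm_const => i j; rewrite mulr2n mulrDl mul1r.
have := nR (i, j); have := nI (i, j); rewrite /= => hI hR.
rewrite !mxE /l1c; case: (f s i j) hI hR => a b /= hI hR.
apply: lerD; [apply: le_trans hR|apply: le_trans hI];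
  by rewrite le_eqVlt; apply/orP; left; apply/eqP; congr `|_|; ring.
Qed.

End Antiderivative.

(** The intervals of centre [u n] and radius [2 * c / 2 ^+ n] are nested, because the radius halves
    while the centre moves by at most half of it. The supremum of the left ends lies in all of them,
    which gives the limit together with its rate. *)
Lemma geometric_limit {R : realType} (u : nat -> R) (c : R) : 0 <= c ->
  (forall n, `|u n.+1 - u n| <= c / 2 ^+ n) ->
  exists L, forall n, `|u n - L| <= 2 * c / 2 ^+ n.
Proof.
move=> c0 uc; pose d n : R := 2 * c / 2 ^+ n.
have dS n : d n.+1 = d n / 2 by rewrite /d exprS invfM; field; rewrite expf_neq0.
have d0 n : 0 <= d n by rewrite /d !mulr_ge0// invr_ge0 exprn_ge0.
have ud n : `|u n.+1 - u n| <= d n / 2.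
  by apply: le_trans (uc n) _; rewrite /d; lra.
have up k n : u (n + k)%N + d (n + k)%N <= u n + d n.
  elim: k => [|k IH]; first by rewrite addn0.
  apply: le_trans IH; rewrite addnS dS.
  by have := ud (n + k)%N; rewrite ler_norml => /andP[h1 h2]; lra.
have lo k n : u n - d n <= u (n + k)%N - d (n + k)%N.
  elim: k => [|k IH]; first by rewrite addn0.
  apply: le_trans IH _; rewrite addnS dS.
  by have := ud (n + k)%N; rewrite ler_norml => /andP[h1 h2]; lra.
have cross k n : u k - d k <= u n + d n.
  have := lo n k; have := up k n; rewrite addnC => h1 h2.
  by have := d0 (k + n)%N; lra.
pose E := [set u n - d n | n in [set: nat]].
have Es : has_sup E.
  by split; [exists (u 0%N - d 0%N); exists 0%N|exists (u 0%N + d 0%N) => _ [n _ <-]].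
exists (sup E) => n.
have h1 : u n - d n <= sup E by apply: sup_upper_bound => //; exists n.
have h2 : sup E <= u n + d n.
  by apply: ge_sup; [exists (u 0%N - d 0%N); exists 0%N|move=> _ [k _ <-]].
by rewrite ler_norml -/(d n); apply/andP; split; lra.
Qed.

Section LinearODE.
Context {R : realType}.

Lemma within_itv (T x : R) (P : set R) : 
  (\forall y \near within `[0, T] (nbhs x), P y) <->
  \forall y \near within `[0, T] (nbhs x), 0 <= y <= T -> P y.
Proof.
split; rewrite !near_withinE; apply: filterS => y /= h; rewrite ?in_itv/=.
  by move=> yT _; apply: h; rewrite in_itv.
by move=> yT; apply: h; rewrite ?in_itv.
Qed.

Lemma cont_at_limit (p q : nat) (u : nat -> R -> 'M[R[i]]_(p, q)) f (T c : R) :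
  (forall n s, 0 <= s <= T -> cont_at `[0, T] (u n) s) ->
  (forall n s, 0 <= s <= T -> l1norm (u n s - f s) <= c / 2 ^+ n) ->
  forall s, 0 <= s <= T -> cont_at `[0, T] f s.
Proof.
move=> uc uf s sT e e0.
have c0 : 0 <= c.
  by have := uf 0%N s sT; rewrite expr0 divr1; apply: le_trans; exact: l1norm_ge0.
have [n hn] : exists n, c / 2 ^+ n <= e / 4.
  have e40 : 0 < e / 4 by rewrite divr_gt0.
  have := archimedean.Num.Theory.archi_boundP (divr_ge0 c0 (ltW e40)).
  move: (archimedean.Num.Def.archi_bound _) => n hn.
  exists n; rewrite ler_pdivrMr ?exprn_gt0//.
  rewrite ltr_pdivrMr// in hn; apply: ltW; apply: lt_le_trans hn _.
  rewrite mulrC ler_pM2l// -natrX ler_nat.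
  by apply: ltnW; exact: ltn_expl.
have e20 : 0 < e / 2 by rewrite divr_gt0.
apply/within_itv; apply: filterS (uc n s sT _ e20) => y h yT.
have -> : f y - f s = (u n y - u n s) - (u n y - f y) + (u n s - f s).
  by apply/matrixP => i j; rewrite !mxE; ring.
apply: le_trans (l1normD _ _) _; apply: le_trans (lerD (l1normB _ _) (lexx _)) _.
have := uf n y yT; have := uf n s sT; lra.
Qed.

Lemma cont_atM (p q r : nat) D (f : R -> 'M[R[i]]_(p, q))
    (g : R -> 'M[R[i]]_(q, r)) x :
  cont_at D f x -> cont_at D g x -> cont_at D (fun y => f y *m g y) x.
Proof.
move=> fc gc e e0.
have f0 := l1norm_ge0 (f x); have g0 := l1norm_ge0 (g x).
pose c := l1norm (f x) + 1 + l1norm (g x) + 1.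
have c0 : 0 < c by rewrite /c; lra.
have ec : 0 < e / c by rewrite divr_gt0.
apply: filterS3 (cont_at_bounded fc) (fc _ ec) (gc _ ec) => y h1 h2 h3.
have -> : f y *m g y - f x *m g x = f y *m (g y - g x) + (f y - f x) *m g x.
  by rewrite mulmxBr mulmxBl addrA subrK.
apply: le_trans (l1normD _ _) _.
apply: le_trans (lerD (l1normM _ _) (l1normM _ _)) _.
apply: (@le_trans _ _ ((l1norm (f x) + 1) * (e / c) + (e / c) * l1norm (g x))).
  by apply: lerD; apply: ler_pM; rewrite ?l1norm_ge0.
rewrite [X in X + _]mulrC -mulrDr -[leRHS](divfK (lt0r_neq0 c0)).
by rewrite ler_pM2l// /c; lra.
Qed.

Lemma bounded_of_cont (p q : nat) (f : R -> 'M[R[i]]_(p, q)) T : 0 <= T ->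
  (forall s, 0 <= s <= T -> cont_at `[0, T] f s) ->
  exists2 K, 0 < K & forall s, 0 <= s <= T -> l1norm (f s) <= K.
Proof.
move=> T0 fc; have [x _ xm] := EVT_max T0 (l1norm_functional_cont fc).
exists (l1norm (f x) + 1); first by rewrite ltr_wpDl ?l1norm_ge0.
by move=> s sT; apply: le_trans (xm s _) _; rewrite ?in_itv// lerDl.
Qed.

(** Picard iteration. In the norm weighted by [expR (- (2 * K) * s)] the integral operator contracts
    by the factor 1/2, so the iterates converge geometrically on all of [[0, T]] at once, whatever
    the length of the interval. *)
Lemma linear_ode (p q : nat) (B : R -> 'M[R[i]]_p) (v : 'M[R[i]]_(p, q)) T :
  0 <= T -> (forall s, 0 <= s <= T -> cont_at `[0, T] B s) ->
  exists Y : R -> 'M[R[i]]_(p, q), Y 0 = v /\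
    forall s, 0 <= s <= T -> diff_at `[0, T] Y s (B s *m Y s).
Proof.
move=> T0 Bc; have [K K0 BK] := bounded_of_cont T0 Bc.
(* [A f] is the primitive of [f] vanishing at 0; it is set to 0 for discontinuous [f] to make the
   recursion total. *)
have /choice[A AE] : forall f : R -> 'M[R[i]]_(p, q), exists F,
    (forall s, 0 <= s <= T -> cont_at `[0, T] f s) -> F 0 = 0 /\
    forall s, 0 <= s <= T -> diff_at `[0, T] F s (f s).
  move=> f; have [fc|nfc] := pselect (forall s, 0 <= s <= T -> cont_at `[0, T] f s).
    by have [F FE] := antiderivative T0 fc; exists F.
  by exists (fun=> 0) => /nfc.
pose y := fix y n : R -> 'M[R[i]]_(p, q) :=
  if n is n'.+1 then fun s => v + A (fun s => B s *m y n' s) s else fun=> v.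
have yS n s : y n.+1 s = v + A (fun s => B s *m y n s) s by [].
have shift_diff f s : (forall s, 0 <= s <= T -> cont_at `[0, T] f s) ->
    0 <= s <= T -> diff_at `[0, T] (fun s => v + A f s) s (f s).
  move=> fc sT; have [_ h] := AE f fc.
  by rewrite -[f s]add0r; apply: diff_atD; [exact: diff_at_cst|exact: h].
have yc n s : 0 <= s <= T -> cont_at `[0, T] (y n) s.
  elim: n s => [|n IH] s sT.
    exact: diff_at_cont (diff_at_cst _ _ _).
  apply: diff_at_cont (shift_diff _ s _ sT) => t tT.
  by apply: cont_atM; [exact: Bc|exact: IH].
have Byc n s : 0 <= s <= T -> cont_at `[0, T] (fun s => B s *m y n s) s.
  by move=> sT; apply: cont_atM; [exact: Bc|exact: yc].
have y0 n : y n 0 = v.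
  by case: n => //= n; have [-> _] := AE _ (Byc n); rewrite addr0.
have yd n s : 0 <= s <= T -> diff_at `[0, T] (y n.+1) s (B s *m y n s).
  by move=> sT; exact: shift_diff (Byc n) sT.
have sub s : 0 <= s <= T -> forall r, 0 <= r <= s -> 0 <= r <= T.
  by move=> /andP[_ sT] r /andP[-> rs] /=; apply: le_trans sT.
have subI s : 0 <= s <= T -> `[0, s] `<=` `[0, T].
  by move=> sT r /=; rewrite !in_itv/=; exact: sub.
pose C := K * l1norm v * T.
have C0 : 0 <= C by rewrite !mulr_ge0 ?l1norm_ge0// ltW.
have est n s : 0 <= s <= T ->
    l1norm (y n.+1 s - y n s) <= C / 2 ^+ n * expR (2 * K * s).
  elim: n s => [|n IH] s sT.
    have [s0 sT'] := andP sT.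
    have : l1norm (y 1%N s - y 1%N 0) <= K * l1norm v * (s - 0).
      apply: (mean_value_linear (f' := fun r => B r *m y 0%N r) s0) => r rs;
      last first.
        apply: le_trans (l1normM _ _) _; rewrite ler_wpM2r ?l1norm_ge0//.
        by apply: BK; exact: sub rs.
      by apply: diff_at_sub (yd 0%N r _); [exact: subI|exact: sub rs].
    rewrite y0 expr0 divr1 subr0 => h; apply: le_trans h _.
    apply: (@le_trans _ _ C); first by rewrite ler_wpM2l// mulr_ge0 ?l1norm_ge0// ltW.
    by rewrite ler_peMr// -expR0 ler_expR !mulr_ge0// ltW.
  have [s0 sT'] := andP sT.
  pose c := C / 2 ^+ n.+1.
  have c0 : 0 <= c by rewrite /c divr_ge0// exprn_ge0.
  have cE : C / 2 ^+ n = 2 * c.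
    by rewrite /c exprS invfM; field; rewrite expf_neq0.
  have gd (r : R) : is_derive r 1 (fun r => c * expR (2 * K * r))
      (2 * K * c * expR (2 * K * r)).
    have h1 := is_derive_expRM (2 * K) r.
    apply: is_derive_eq; rewrite ?scaler0 ?add0r ?addr0 /GRing.scale /= ?mulr1.
    by ring.
  pose D r := y n.+2 r - y n.+1 r.
  have : l1norm (D s - D 0) <= c * expR (2 * K * s) - c * expR (2 * K * 0).
    apply: (mean_value (f' := fun r => B r *m y n.+1 r - B r *m y n r) s0 _ gd)
      => r rs.
      apply: diff_at_sub (subI _ sT) _.
      apply: diff_atD; first by apply: yd; exact: sub rs.
      by apply: diff_atN; apply: yd; exact: sub rs.
    rewrite -mulmxBr; apply: le_trans (l1normM _ _) _.
    have rT := sub _ sT _ rs.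
    apply: le_trans (ler_pM (l1norm_ge0 _) (l1norm_ge0 _) (BK r rT) (IH r rT)) _.
    by rewrite cE le_eqVlt; apply/orP; left; apply/eqP; ring.
  by rewrite /D !y0 subrr subr0 mulr0 expR0 -/c; lra.
pose C' := C * expR (2 * K * T).
have C'0 : 0 <= C' by rewrite mulr_ge0// expR_ge0.
have est' n s : 0 <= s <= T -> l1norm (y n.+1 s - y n s) <= C' / 2 ^+ n.
  move=> sT; apply: le_trans (est n s sT) _.
  rewrite mulrAC ler_wpM2r ?invr_ge0 ?exprn_ge0// ler_wpM2l// ler_expR.
  by rewrite ler_wpM2l; case/andP: sT => // _ _; rewrite mulr_ge0// ltW.
have lim (P : R[i] -> R) : (forall x y, P (x - y) = P x - P y) ->
    (forall x, `|P x| <= l1c x) -> forall k : R * 'I_p * 'I_q,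
    exists L, 0 <= k.1.1 <= T -> forall n,
      `|P (y n k.1.1 k.1.2 k.2) - L| <= 2 * C' / 2 ^+ n.
  move=> PB Pl [[s i] j] /=.
  have [sT|/negP nsT] := boolP (0 <= s <= T); last by exists 0.
  have [|L LE] := @geometric_limit R (fun n => P (y n s i j)) C' C'0 _;
    last by exists L.
  move=> n; rewrite -PB; apply: le_trans (Pl _) _; apply: le_trans (est' n s sT).
  by have := l1norm_entry (y n.+1 s - y n s) i j; rewrite !mxE.
have /choice[LR LRE] := lim _ cReB cRe_le_l1c; have /choice[LI LIE] := lim _ cImB cIm_le_l1c.
pose Y s : 'M[R[i]]_(p, q) := \matrix_(i, j) Complex (LR (s, i, j)) (LI (s, i, j)).
pose c := (p * q)%:R * (2 * (2 * C')).
have yY n s : 0 <= s <= T -> l1norm (y n s - Y s) <= c / 2 ^+ n.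
  move=> sT; rewrite /c -mulrA; apply: l1norm_const => i j.
  have -> : 2 * (2 * C') / 2 ^+ n = 2 * C' / 2 ^+ n + 2 * C' / 2 ^+ n by ring.
  rewrite !mxE /l1c cReB cImB; apply: lerD.
    exact: (LRE (s, i, j)).
  exact: (LIE (s, i, j)).
have Yc := cont_at_limit yc yY.
have BYc s : 0 <= s <= T -> cont_at `[0, T] (fun s => B s *m Y s) s.
  by move=> sT; apply: cont_atM; [exact: Bc|exact: Yc].
(* The limit [Y] is so far only known to be continuous. Its Picard image [Z] is differentiable by
   construction, and comparing both with [y n.+1] gives [Z = Y]. *)
pose Z s := v + A (fun s => B s *m Y s) s.
have Zd s : 0 <= s <= T -> diff_at `[0, T] Z s (B s *m Y s).
  exact: shift_diff.
have Z0 : Z 0 = v by rewrite /Z; have [-> _] := AE _ BYc; rewrite addr0.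
have ZY s : 0 <= s <= T -> Z s = Y s.
  move=> sT; apply/eqP; rewrite -subr_eq0; apply/eqP; apply: l1norm_eq0.
  have c0 : 0 <= c by rewrite /c mulr_ge0 ?ler0n// mulr_ge0// mulr_ge0.
  have [s0 sT'] := andP sT.
  have key n : l1norm (Z s - Y s) <= (2 * K * c * s + c) / 2 ^+ n.+1.
    pose D r := Z r - y n.+1 r.
    have h1 : l1norm (D s - D 0) <= K * (c / 2 ^+ n) * (s - 0).
      apply: (mean_value_linear (f' := fun r => B r *m Y r - B r *m y n r) s0)
        => r rs.
        apply: diff_at_sub (subI _ sT) _.
        apply: diff_atD; first by apply: Zd; exact: sub rs.
        by apply: diff_atN; apply: yd; exact: sub rs.
      rewrite -mulmxBr; apply: le_trans (l1normM _ _) _.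
      have rT := sub _ sT _ rs.
      apply: ler_pM; rewrite ?l1norm_ge0 ?BK//.
      by rewrite -opprB l1normN; exact: yY.
    rewrite /D Z0 y0 subrr !subr0 in h1.
    have h2 := yY n.+1 s sT.
    have -> : Z s - Y s = (Z s - y n.+1 s) + (y n.+1 s - Y s) by rewrite addrA subrK.
    apply: le_trans (l1normD _ _) _; apply: le_trans (lerD h1 h2) _.
    rewrite mulrDl lerD2r le_eqVlt; apply/orP; left; apply/eqP.
    by rewrite exprS; field; rewrite expf_neq0.
  apply/ler_addgt0Pl => e e0; rewrite addr0.
  pose d := 2 * K * c * s + c.
  have d0 : 0 <= d by rewrite addr_ge0// mulr_ge0// mulr_ge0// mulr_ge0// ltW.
  have := archimedean.Num.Theory.archi_boundP (divr_ge0 d0 (ltW e0)).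
  move: (archimedean.Num.Def.archi_bound _) => n hn.
  apply: le_trans (key n) _; rewrite -/d ler_pdivrMr ?exprn_gt0//.
  rewrite ltr_pdivrMr// in hn; apply: ltW; apply: lt_le_trans hn _.
  rewrite mulrC ler_pM2l// -natrX ler_nat.
  by apply: leq_trans (ltnW (ltn_expl n (ltnSn 1))) _; rewrite leq_exp2l// leqnSn.
exists Y; split; first by rewrite -ZY ?lexx// Z0.
move=> s sT; apply: diff_at_ext (Zd s sT); first by rewrite /= in_itv.
by move=> r /=; rewrite in_itv; exact: ZY.
Qed.

End LinearODE.

(** * Transport in time under zero curvature *)

Section FlatConnection.
Context {R : realType} {p q : nat}.

(* A solution of [y_x = G y] that solves [y_t = F y] at [x = 0] solves it for all
   [x], locally uniformly in [x], when [G_t - F_x + G F - F G = 0]. *)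
Lemma flat_connection (G F GT FX : R -> R -> 'M[R[i]]_p)
    (y : R -> R -> 'M[R[i]]_(p, q)) (T K : R) :
  0 < K ->
  (forall x t, 0 <= x -> 0 <= t <= T ->
    diff_at [set s | 0 <= s] (F ^~ t) x (FX x t)) ->
  (forall x t, 0 <= x -> 0 <= t <= T -> l1norm (G x t) <= K) ->
  (forall X t0 e, 0 <= X -> 0 <= t0 <= T -> 0 < e ->
    \forall t \near within `[0, T] (nbhs t0), forall x, 0 <= x <= X ->
      l1norm (G x t - G x t0 - (t - t0)%:C *: GT x t0) <= e * `|t - t0|) ->
  (forall X t0, 0 <= X -> 0 <= t0 <= T ->
    exists B, forall x, 0 <= x <= X -> l1norm (GT x t0) <= B) ->
  (forall x t, 0 <= x -> 0 <= t <= T ->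
    GT x t + G x t *m F x t = FX x t + F x t *m G x t) ->
  (forall x t, 0 <= x -> 0 <= t <= T ->
    diff_at [set s | 0 <= s] (y ^~ t) x (G x t *m y x t)) ->
  (forall t, 0 <= t <= T -> diff_at `[0, T] (y 0) t (F 0 t *m y 0 t)) ->
  forall X t0 e, 0 <= X -> 0 <= t0 <= T -> 0 < e ->
    \forall t \near within `[0, T] (nbhs t0), forall x, 0 <= x <= X ->
      l1norm (y x t - y x t0 - (t - t0)%:C *: (F x t0 *m y x t0))
      <= e * `|t - t0|.
Proof.
move=> K0 hF hG hGT hB flat hy h0 X t0 e X0 t0T e0.
have [B BE] := hB X t0 X0 t0T.
have B0 : 0 <= B.
  by apply: le_trans (l1norm_ge0 _) (BE 0 _); rewrite lexx.
have sub : `[0, X] `<=` [set s : R | 0 <= s].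
  by move=> s /=; rewrite in_itv/= => /andP[].
have yX t s : 0 <= t <= T -> 0 <= s <= X ->
    diff_at `[0, X] (y ^~ t) s (G s t *m y s t).
  by move=> tT /andP[s0 _]; apply: diff_at_sub (sub) (hy _ _ s0 tT).
have [M M0 ME] : exists2 M, 0 < M & forall s, 0 <= s <= X -> l1norm (y s t0) <= M.
  by apply: bounded_of_cont => // s sX; exact: diff_at_cont (yX t0 s t0T sX).
pose E := expR (2 * K * X).
have E0 : 0 <= E by exact: expR_ge0.
(* [C0], [C1] and [C2] are the constants that the two Gronwall passes below produce. None of them
   depends on [t], so the tolerance [d] can be fixed in advance. *)
pose C0 := 1 + l1norm (F 0 t0 *m y 0 t0).
have C00 : 0 <= C0 by rewrite addr_ge0// l1norm_ge0.
pose C1 := 2 * (C0 + (B + 1) * M * X) * E.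
have C10 : 0 <= C1.
  by rewrite !mulr_ge0// addr_ge0// !mulr_ge0// ?addr_ge0// ltW.
pose C2 := 2 * (1 + (M + (B + 1) * C1) * X) * E.
have C20 : 0 <= C2.
  by rewrite !mulr_ge0// addr_ge0// !mulr_ge0// addr_ge0 ?(ltW M0)// mulr_ge0// addr_ge0.
pose d := e / (C2 + 1).
have d0 : 0 < d by rewrite divr_gt0// ltr_wpDl.
suff main : \forall t \near within `[0, T] (nbhs t0), forall x, 0 <= x <= X ->
      l1norm (y x t - y x t0 - (t - t0)%:C *: (F x t0 *m y x t0))
      <= C2 * d * `|t - t0|.
  apply: filterS main => t H x /H h; apply: le_trans h _.
  rewrite ler_wpM2r// /d mulrCA ger_pMr// ler_pdivrMr ?mul1r ?lerDl//.
  by rewrite ltr_wpDl.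
apply/within_itv.
have Z0 : 0 <= (0 : R) <= X by rewrite lexx.
have n1 := hGT X t0 1 X0 t0T ltr01.
have n2 := hGT X t0 d X0 t0T d0.
have n3 := h0 t0 t0T 1 ltr01.
have n4 := h0 t0 t0T d d0.
have n5 := @near_within_dist R `[0, T] t0 d d0.
near=> t => tT.
have G1 x : 0 <= x <= X -> l1norm (G x t - G x t0 - (t - t0)%:C *: GT x t0)
    <= 1 * `|t - t0| by move: x; near: t.
have Gd x : 0 <= x <= X -> l1norm (G x t - G x t0 - (t - t0)%:C *: GT x t0)
    <= d * `|t - t0| by move: x; near: t.
have y1 : l1norm (y 0 t - y 0 t0 - (t - t0)%:C *: (F 0 t0 *m y 0 t0))
    <= 1 * `|t - t0| by near: t.
have yd : l1norm (y 0 t - y 0 t0 - (t - t0)%:C *: (F 0 t0 *m y 0 t0))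
    <= d * `|t - t0| by near: t.
have hd : `|t - t0| <= d by near: t.
pose h := `|t - t0|; have h_ge0 : 0 <= h by exact: normr_ge0.
have GG x : 0 <= x <= X -> l1norm (G x t - G x t0) <= (B + 1) * h.
  move=> xX.
  rewrite -[_ - _](subrK ((t - t0)%:C *: GT x t0)).
  apply: le_trans (l1normD _ _) _; rewrite l1normZ mulrDl addrC.
  by apply: lerD; [rewrite mulrC ler_wpM2r// BE|exact: G1].
have D0 : l1norm (y 0 t - y 0 t0) <= C0 * h.
  rewrite -[_ - _](subrK ((t - t0)%:C *: (F 0 t0 *m y 0 t0))).
  apply: le_trans (l1normD _ _) _; rewrite l1normZ mulrDl.
  by apply: lerD; [exact: y1|rewrite mulrC].
(* First Gronwall pass: a mere Lipschitz bound in time, uniform in [x]. It makes the product of the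
   increments of [G] and [y] quadratic in [h] in the second pass. *)
have D1 x : 0 <= x <= X -> l1norm (y x t - y x t0) <= C1 * h.
  move=> xX.
  have e1 : 0 <= (B + 1) * h * M.
    by rewrite mulr_ge0 ?(ltW M0)// mulr_ge0// addr_ge0.
  have := @gronwall R p q (fun x => y x t - y x t0)
    (fun x => G x t *m y x t - G x t0 *m y x t0) K _ X X0 K0 e1 _ _ x xX.
  move=> H; apply: le_trans (H _ _) _.
  - move=> s sX; apply: diff_atD; first exact: yX.
    by apply: diff_atN; exact: yX.
  - move=> s sX.
    have -> : G s t *m y s t - G s t0 *m y s t0 =
      G s t *m (y s t - y s t0) + (G s t - G s t0) *m y s t0.
      by rewrite mulmxBr mulmxBl addrA subrK.
    apply: le_trans (l1normD _ _) _.
    apply: le_trans (lerD (l1normM _ _) (l1normM _ _)) _.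
    have [s0 _] := andP sX.
    by apply: lerD; apply: ler_pM; rewrite ?l1norm_ge0 ?hG ?GG ?ME.
  rewrite /C1 -/E.
  apply: (@le_trans _ _ (2 * (C0 * h + (B + 1) * h * M * X) * E)).
    by rewrite ler_wpM2r// ler_wpM2l// lerD2r.
  by rewrite le_eqVlt; apply/orP; left; apply/eqP; ring.
move=> x xX.
have e2 : 0 <= d * h * (M + (B + 1) * C1).
  apply: mulr_ge0; first by rewrite mulr_ge0// ltW.
  by rewrite addr_ge0 ?(ltW M0)// mulr_ge0// addr_ge0.
(* Second pass, on the defect itself. By flatness its [x]-derivative is [G] times the defect, plus
   the defect of [G] acting on [y], plus a product of two increments. The last two are at most a
   constant times [d * h], the product because [h <= d]. *)
have := @gronwall R p q
  (fun x => y x t - y x t0 - (t - t0)%:C *: (F x t0 *m y x t0))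
  (fun x => G x t *m y x t - G x t0 *m y x t0 - (t - t0)%:C *:
     (FX x t0 *m y x t0 + F x t0 *m (G x t0 *m y x t0)))
  K _ X X0 K0 e2 _ _ x xX.
move=> H; apply: le_trans (H _ _) _.
- move=> s sX; have [s0 _] := andP sX.
  apply: diff_atD; first apply: diff_atD; first exact: yX.
    by apply: diff_atN; exact: yX.
  apply: diff_atN; apply: diff_atZ; apply: diff_atM; last exact: yX.
  by apply: diff_at_sub (sub) (hF _ _ s0 t0T).
- move=> s sX; have [s0 _] := andP sX.
  have -> : G s t *m y s t - G s t0 *m y s t0 - (t - t0)%:C *:
     (FX s t0 *m y s t0 + F s t0 *m (G s t0 *m y s t0)) =
    G s t0 *m (y s t - y s t0 - (t - t0)%:C *: (F s t0 *m y s t0)) +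
    ((G s t - G s t0 - (t - t0)%:C *: GT s t0) *m y s t0 +
    (G s t - G s t0) *m (y s t - y s t0)).
    rewrite [F s t0 *m (_ *m _)]mulmxA -mulmxDl -flat// mulmxDl.
    rewrite !(mulmxBr, mulmxBl) -!scalemxAr -!scalemxAl !mulmxA.
    by apply/matrixP => i j; rewrite !mxE; ring.
  apply: le_trans (l1normD _ _) _; apply: lerD.
    by apply: le_trans (l1normM _ _) _; apply: ler_pM; rewrite ?l1norm_ge0 ?hG.
  apply: le_trans (l1normD _ _) _; rewrite mulrDr.
  apply: le_trans (lerD (l1normM _ _) (l1normM _ _)) _.
  apply: lerD; first by apply: ler_pM; rewrite ?l1norm_ge0 ?Gd ?ME.
  apply: (@le_trans _ _ ((B + 1) * h * (C1 * d))).
    apply: ler_pM; rewrite ?l1norm_ge0 ?GG//.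
    by apply: le_trans (D1 s sX) _; rewrite ler_wpM2l.
  by rewrite le_eqVlt; apply/orP; left; apply/eqP; ring.
rewrite /C2 -/E -/h.
apply: (@le_trans _ _ (2 * (d * h + d * h * (M + (B + 1) * C1) * X) * E)).
  rewrite ler_wpM2r// ler_wpM2l// lerD2r; exact: yd.
by rewrite le_eqVlt; apply/orP; left; apply/eqP; ring.
Unshelve. all: by end_near. Qed.

End FlatConnection.

(** * One-sided derivatives and continuity on the quarter-plane *)

Section Bridge.
Context {R : realType}.

Lemma normc_le_l1c (x : R[i]) : `|x| <= (l1c x)%:C.
Proof.
rewrite normc_def lecR /l1c; case: x => a b /=.
rewrite -[leRHS]ger0_norm ?addr_ge0// -sqrtr_sqr ler_wsqrtr//.
rewrite sqrrD !real_normK ?num_real// lerD2r lerDl.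
by rewrite mulrn_wge0// mulr_ge0.
Qed.

Lemma l1c_le_normc (x : R[i]) (e : R) : `|x| <= e%:C -> l1c x <= 2 * e.
Proof.
rewrite normc_def lecR /l1c; case: x => a b /= h.
have ha : `|a| <= Num.sqrt (a ^+ 2 + b ^+ 2).
  by rewrite -sqrtr_sqr ler_wsqrtr// lerDl sqr_ge0.
have hb : `|b| <= Num.sqrt (a ^+ 2 + b ^+ 2).
  by rewrite -sqrtr_sqr ler_wsqrtr// lerDr sqr_ge0.
lra.
Qed.

(** The matrix topology is entrywise with radii in [R[i]]; a positive radius there is real, so real
    estimates in [l1norm] describe the same convergence. *)
Lemma cvg_l1norm (T : Type) (F : set_system T) (FF : Filter F) (p q : nat)
    (f : T -> 'M[R[i]]_(p, q)) (l : 'M[R[i]]_(p, q)) :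
  f x @[x --> F] --> l <->
  forall e, 0 < e -> \forall x \near F, l1norm (f x - l) <= e.
Proof.
split=> [/cvg_mx_entourageP H e e0|H].
  pose d := e / (2 * ((p * q)%:R + 1)).
  have n0 : 0 < (p * q)%:R + 1 :> R by rewrite ltr_wpDl.
  have d0 : 0 < d by rewrite divr_gt0// mulr_gt0.
  have dC : 0 < d%:C by rewrite ltcR.
  have ent : entourage [set xy : R[i] * R[i] | ball xy.1 (d%:C) xy.2].
    by rewrite -entourage_ballE; exists d%:C.
  have {}H : \forall x \near F, forall i j, (l i j, f x i j) \in
    [set xy : R[i] * R[i] | ball xy.1 (d%:C) xy.2] by exact: H _ ent.
  apply: filterS H => x h.
  apply: (@le_trans _ _ ((p * q)%:R * (2 * d))).
    apply: l1norm_const => i j; apply: l1c_le_normc.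
    have := h i j; rewrite inE /= -ball_normE /= distrC !mxE => /ltW.
    by [].
  rewrite (_ : _ * _ = (p * q)%:R / ((p * q)%:R + 1) * e); last first.
    by rewrite /d; field; rewrite gt_eqF.
  by rewrite ger_pMl// ler_pdivrMr// mul1r lerDl.
apply/cvg_mx_entourageP => A; rewrite -entourage_ballE => -[r /= r0 rA].
have rE : r = (complex.Re r)%:C by rewrite RRe_real// gtr0_real.
have r0' : 0 < complex.Re r by rewrite -ltcR -rE.
have := H (complex.Re r / 2) (divr_gt0 r0' (ltr0n _ 2)).
apply: filterS => x h i j; rewrite inE; apply: rA => /=.
rewrite -ball_normE /= distrC rE.
apply: le_lt_trans (normc_le_l1c _) _; rewrite ltcR.
have := l1norm_entry (f x - l) i j; rewrite !mxE; lra.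
Qed.

Local Notation halfline := [set s : R | 0 <= s].

Lemma itv_halfline (X : R) : `[0, X] `<=` halfline.
Proof. by move=> s /=; rewrite in_itv/= => /andP[]. Qed.

Lemma halfline_dnbhs_proper x : halfline x -> ProperFilter (within halfline x^').
Proof.
move=> /= x0; apply: Build_ProperFilter.
rewrite /within /= /dnbhs /within /= => /nbhs_ballP[d /= d0 H].
have := H (x + d / 2); rewrite /ball /= opprD addNKr normrN gtr0_norm ?divr_gt0//.
apply; first by rewrite ltr_pdivrMr// ltr_pMr// ltrDl.
  by rewrite gt_eqF// ltrDl divr_gt0.
by rewrite addr_ge0// divr_ge0// ltW.
Qed.

Section HalfDerivative.
Context {p q : nat}.
Implicit Types (f : R -> 'M[R[i]]_(p, q)).

Lemma half_quotient_cvg f x l :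
  (half_quotient f x y @[y --> within halfline x^'] --> l) <->
  diff_at halfline f x l.
Proof.
have key y e : y != x -> (l1norm (half_quotient f x y - l) <= e) =
    (l1norm (f y - f x - (y - x)%:C *: l) <= e * `|y - x|).
  move=> yx; have yx0 : 0 < `|y - x| by rewrite normr_gt0 subr_eq0.
  rewrite -(ler_pM2r yx0) [X in X <= _]mulrC -l1normZ /half_quotient.
  rewrite scalerBr scalerA -rmorphM mulfV ?subr_eq0//=.
  by rewrite scale1r.
rewrite cvg_l1norm; split=> H e e0; have := H e e0.
  rewrite !near_withinE; apply: filterS => y h y0.
  have [->|yx] := eqVneq y x; last by rewrite -key// h.
  by rewrite !subrr sub0r scale0r oppr0 l1norm0 normr0 mulr0.
rewrite !near_withinE; apply: filterS => y h yx y0.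
by rewrite key// h.
Qed.

Lemma half_derivableP f x : half_derivable f x ->
  diff_at halfline f x (half_derive f x).
Proof. by move=> h; apply/half_quotient_cvg. Qed.

Lemma half_deriveE f x l : 0 <= x -> diff_at halfline f x l ->
  half_derive f x = l.
Proof.
move=> x0 fl; have PF := halfline_dnbhs_proper x0.
apply: (diff_at_uniq PF) (fl); apply: half_derivableP.
by rewrite /half_derivable; move/half_quotient_cvg: fl; exact: cvgP.
Qed.

Lemma half_derivable_diff f x l : 0 <= x -> diff_at halfline f x l ->
  diff_at halfline f x (half_derive f x).
Proof. by move=> x0 fl; rewrite (half_deriveE x0 fl). Qed.

End HalfDerivative.

Section Quarter.
Context {p q : nat}.
Implicit Types (g : R -> R -> 'M[R[i]]_(p, q)).

Definition joint_cont (h : R * R -> 'M[R[i]]_(p, q)) :=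
  forall x t : R, 0 <= x -> 0 <= t -> forall e : R, 0 < e ->
  \forall a \near (x, t), 0 <= a.1 -> 0 <= a.2 ->
     l1norm (h a - h (x, t)) <= e.

Lemma within_quarter_joint (h : R * R -> 'M[R[i]]_(p, q)) :
  {within quarter_plane, continuous h} -> joint_cont h.
Proof.
move=> /subspace_continuousP hc x t x0 t0 e e0.
have /cvg_l1norm /(_ e e0) := hc (x, t) (conj x0 t0).
rewrite near_withinE; apply: filterS => -[x' t'] /= H x'0 t'0.
exact: H (conj x'0 t'0).
Qed.

(** The tube argument along the segment [[0, X]] at height [t]: near each point, both [h (x', t')]
    and [h (x', t)] are compared with the value at the centre, which explains the halved
    tolerance. *)
Lemma joint_cont_uniform (h : R * R -> 'M[R[i]]_(p, q)) (X t e : R) : joint_cont h ->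
  0 <= t -> 0 < e ->
  \forall t' \near within halfline (nbhs t), forall x, 0 <= x <= X ->
    l1norm (h (x, t') - h (x, t)) <= e.
Proof.
move=> hc t0 e0.
have /compact_near_coveringP/near_covering_withinP cov := @segment_compact R 0 X.
have H := cov _ (nbhs t)
  (fun t' x => 0 <= t' -> l1norm (h (x, t') - h (x, t)) <= e) (nbhs_filter t).
rewrite near_withinE; apply: filterS (H _) => [t' Ht' t'0 x xX|x].
  by apply: Ht' => //=; rewrite in_itv.
rewrite /= in_itv/= => /andP[x0 xX].
have e20 : 0 < e / 2 by rewrite divr_gt0.
have [[A B] /= [nA nB] AB] := hc x t x0 t0 _ e20.
exists (A, B) => // -[x' t'] /= [Ax' Bt']; rewrite in_itv/= => /andP[x'0 _] t'0.
have h1 := AB (x', t') (conj Ax' Bt') x'0 t'0.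
have h2 := AB (x', t) (conj Ax' (nbhs_singleton nB)) x'0 t0.
have -> : h (x', t') - h (x', t) = (h (x', t') - h (x, t)) - (h (x', t) - h (x, t)).
  by rewrite opprB addrA subrK.
apply: le_trans (l1normB _ _) _; rewrite /= in h1 h2; lra.
Qed.

Lemma joint_cont_bounded (h : R * R -> 'M[R[i]]_(p, q)) (X t : R) : joint_cont h ->
  0 <= X -> 0 <= t ->
  exists B, forall x, 0 <= x <= X -> l1norm (h (x, t)) <= B.
Proof.
move=> hc X0 t0.
have [|B _ BE] := @bounded_of_cont R p q (fun x => h (x, t)) X X0; last by exists B.
move=> s /andP[s0 _] e e0; rewrite near_withinE.
have [[A B] /= [nA nB] AB] := hc s t s0 t0 _ e0.
apply: filterS nA => x Ax /=; rewrite in_itv/= => /andP[x0 _].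
exact: (AB (x, t) (conj Ax (nbhs_singleton nB)) x0 t0).
Qed.

(** Subtracting the linear function [s * g' (x, t)] leaves a function of [s] with derivative
    [g' (x, s) - g' (x, t)]. This is small uniformly in [x], and the mean value inequality applies
    on either side of [t]. *)
Lemma uniform_quotient g (g' : R * R -> 'M[R[i]]_(p, q)) (X t e : R) :
  joint_cont g' ->
  (forall x s, 0 <= x -> 0 <= s -> diff_at halfline (g x) s (g' (x, s))) ->
  0 <= t -> 0 < e ->
  \forall t' \near within halfline (nbhs t), forall x, 0 <= x <= X ->
    l1norm (g x t' - g x t - (t' - t)%:C *: g' (x, t)) <= e * `|t' - t|.
Proof.
move=> g'c gd t0 e0; have := joint_cont_uniform X g'c t0 e0.
rewrite !near_withinE => /nbhs_ballP[d /= d0 H].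
apply/nbhs_ballP; exists d => // t' td t'0 x xX; have [x0 _] := andP xX.
pose f s := g x s + - (s%:C *: g' (x, t)).
have fd (D : set R) s : D `<=` halfline -> 0 <= s -> diff_at D f s (g' (x, s) - g' (x, t)).
  move=> DH s0; apply: diff_at_sub DH _; apply: diff_atD; first exact: gd.
  apply: diff_atN => r r0; near=> y.
  by rewrite -scalerBl -rmorphB subrr l1norm0 mulr_ge0// ltW.
have -> : g x t' - g x t - (t' - t)%:C *: g' (x, t) = f t' - f t.
  by apply/matrixP => i j; rewrite !mxE rmorphB; ring.
have [tt'|/ltW t't] := lerP t t'.
  apply: (mean_value_linear (f' := fun s => g' (x, s) - g' (x, t)) tt') => s
    /andP[ts st'].
    apply: fd; last exact: le_trans ts.
    by move=> y /=; rewrite in_itv/= => /andP[h _]; apply: le_trans h.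
  apply: H => //=; last exact: le_trans ts.
  move: td; rewrite /ball/= !ler0_norm ?subr_le0//; lra.
rewrite -opprB l1normN.
apply: (mean_value_linear (f' := fun s => g' (x, s) - g' (x, t)) t't) => s
  /andP[ts st'].
  apply: fd; last exact: le_trans ts.
  by move=> y /=; rewrite in_itv/= => /andP[h _]; apply: le_trans h.
apply: H => //=; last exact: le_trans ts.
move: td; rewrite /ball/= !ger0_norm ?subr_ge0//; lra.
Unshelve. all: by end_near. Qed.

End Quarter.
End Bridge.

(** * Regularity of the potential and its derivatives *)

Section Regularity.
Context {R : realType} {m : nat}.
Local Notation halfline := [set s : R | 0 <= s].
Context (u : R -> R -> 'M[R[i]]_m).

Lemma diff_at_dl (f : R -> 'M[R[i]]_(m + m)) D x l :
  diff_at D f x l -> diff_at D (fun y => dlsubmx (f y)) x (dlsubmx l).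
Proof. by move=> h; apply: diff_at_lsub; exact: diff_at_dsub. Qed.

Lemma diff_at_ul (f : R -> 'M[R[i]]_(m + m)) D x l :
  diff_at D f x l -> diff_at D (fun y => ulsubmx (f y)) x (ulsubmx l).
Proof. by move=> h; apply: diff_at_lsub; exact: diff_at_usub. Qed.

Context (G_C1 : quarter_C1 (fun x t => Gmx (u x t) 0)).
Context (F_C1 :
  quarter_C1 (fun x t => Fmx (u x t) (dx u x t) (dx (dx u) x t) 0)).

Lemma scalar_mx0 : (0 : R[i])%:M = 0 :> 'M[R[i]]_m.
Proof. by apply/matrixP => i j; rewrite !mxE mul0rn. Qed.

(** The differentiability hypotheses concern whole matrices. At [z = 0] their blocks contain [u],
    u_x and u_xx - 2 u^2, and the regularity of each derivative of [u] is read off from the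
    corresponding block. *)
Lemma dl_Gmx (v : 'M[R[i]]_m) : dlsubmx (Gmx v 0) = v.
Proof. by rewrite /Gmx block_mxKdl scalar_mx0 subr0. Qed.

Lemma diff_u_x x t : 0 <= x -> 0 <= t ->
  diff_at halfline (u ^~ t) x (dx u x t).
Proof.
move=> x0 t0; have [/half_derivableP /diff_at_dl h _] := (let: And3 h1 _ _ := G_C1 in h1 x t x0 t0).
apply: (half_derivable_diff x0); apply: diff_at_ext h => // y y0.
exact: dl_Gmx.
Qed.

Lemma diff_u_t_G x t : 0 <= x -> 0 <= t -> diff_at halfline (u x) t
  (dlsubmx (dt (fun x t => Gmx (u x t) 0) x t)).
Proof.
move=> x0 t0; have [_ /half_derivableP /diff_at_dl h] := (let: And3 h1 _ _ := G_C1 in h1 x t x0 t0).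
by apply: diff_at_ext h => // y y0; exact: dl_Gmx.
Qed.

Lemma diff_u_t x t : 0 <= x -> 0 <= t -> diff_at halfline (u x) t (dt u x t).
Proof. by move=> x0 t0; apply: (half_derivable_diff t0); exact: diff_u_t_G. Qed.

Lemma joint_cont_dt : joint_cont (fun a => dt u a.1 a.2).
Proof.
move=> x t x0 t0 e e0.
have /within_quarter_joint H := (let: And3 _ _ h := G_C1 in h).
apply: filterS (H x t x0 t0 e e0) => -[x' t'] /= h x'0 t'0.
have dtE r s : 0 <= r -> 0 <= s ->
    dt u r s = dlsubmx (dt (fun x t => Gmx (u x t) 0) r s).
  by move=> r0 s0; apply: (half_deriveE s0); exact: diff_u_t_G.
rewrite !dtE//; have := h x'0 t'0; apply: le_trans.
have -> (A B : 'M[R[i]]_(m + m)) : dlsubmx A - dlsubmx B = dlsubmx (A - B).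
  by apply/matrixP => i j; rewrite !mxE.
by apply: le_trans (l1norm_lsub _) _; exact: l1norm_dsub.
Qed.

Lemma ul_Fmx (a b c : 'M[R[i]]_m) : ulsubmx (Fmx a b c 0) = b.
Proof. by rewrite /Fmx block_mxKul. Qed.

Lemma dl_Fmx (a b c : 'M[R[i]]_m) : dlsubmx (Fmx a b c 0) = c - 2 *: (a *m a).
Proof. by rewrite /Fmx block_mxKdl mulr0 scalar_mx0 addr0 subr0. Qed.

Lemma diff_ux_x x t : 0 <= x -> 0 <= t ->
  diff_at halfline (dx u ^~ t) x (dx (dx u) x t).
Proof.
move=> x0 t0; have [/half_derivableP /diff_at_ul h _] := (let: And3 h1 _ _ := F_C1 in h1 x t x0 t0).
apply: (half_derivable_diff x0); apply: diff_at_ext h => // y y0.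
exact: ul_Fmx.
Qed.

Lemma cont_ux_t x t : 0 <= x -> 0 <= t -> cont_at halfline (dx u x) t.
Proof.
move=> x0 t0; have [_ /half_derivableP /diff_at_ul h] := (let: And3 h1 _ _ := F_C1 in h1 x t x0 t0).
apply: diff_at_cont; apply: diff_at_ext h => // y y0.
exact: ul_Fmx.
Qed.

Lemma diff_uxx_x x t : 0 <= x -> 0 <= t ->
  diff_at halfline (dx (dx u) ^~ t) x (dx (dx (dx u)) x t).
Proof.
move=> x0 t0; have [/half_derivableP /diff_at_dl h _] := (let: And3 h1 _ _ := F_C1 in h1 x t x0 t0).
have hu := diff_u_x x0 t0.
apply: (half_derivable_diff x0).
apply: diff_at_ext (diff_atD h (diff_atZ 2 (diff_atM hu hu))) => // y y0.
by rewrite dl_Fmx subrK.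
Qed.

End Regularity.

(** * The zero-curvature form of the matrix KdV equation *)

Section ZeroCurvature.
Context {R : realType} {m : nat}.
Local Notation halfline := [set s : R | 0 <= s].
Implicit Types (v : 'M[R[i]]_m) (z : R[i]).

(** Only the lower left block uses the equation; there the terms in [z] cancel. The other three
    blocks are identities, since [z] is scalar and commutes with [v]. *)
Lemma zero_curvature v vx vxx vxxx vt z :
  vt + 3 *: (v *m vx + vx *m v) - vxxx = 0 ->
  block_mx 0 0 vt 0 + Gmx v z *m Fmx v vx vxx z =
  block_mx vxx (- (2 *: vx))
    (vxxx - 2 *: (vx *m (v - z%:M) + (v + (2 * z)%:M) *m vx)) (- vxx)
  + Fmx v vx vxx z *m Gmx v z.
Proof.
move=> kdv; rewrite /Gmx /Fmx !mulmx_block !add_block_mx.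
rewrite !mul0mx !mul1mx !mulmx0 !mulmx1 !add0r !addr0.
rewrite !mulNmx !mulmxN -!scalemxAl -!scalemxAr.
rewrite !(mulmxBl, mulmxBr, mulmxDl, mulmxDr) !mul_scalar_mx !mul_mx_scalar.
have vtE : vt = vxxx - 3 *: (v *m vx + vx *m v).
  by move/eqP: kdv; rewrite subr_eq0 => /eqP <-; rewrite addrK.
rewrite {}vtE; move: (v *m vx) (vx *m v) (v *m v) => a b c.
congr block_mx; apply/matrixP => i j; rewrite !mxE; ring.
Qed.

End ZeroCurvature.

(** * Adjoints, inner products and the flux *)

Section Adjoint.
Context {R : realType}.

Lemma adjointM p q r (A : 'M[R[i]]_(p, q)) (B : 'M[R[i]]_(q, r)) :
  (A *m B)^t* = B^t* *m A^t*.
Proof. by rewrite trmx_mul map_mxM. Qed.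

Lemma adjointD p q (A B : 'M[R[i]]_(p, q)) : (A + B)^t* = A^t* + B^t*.
Proof. by apply/matrixP => i j; rewrite !mxE rmorphD. Qed.

Lemma adjointB p q (A B : 'M[R[i]]_(p, q)) : (A - B)^t* = A^t* - B^t*.
Proof. by apply/matrixP => i j; rewrite !mxE rmorphB. Qed.

Lemma adjointN p q (A : 'M[R[i]]_(p, q)) : (- A)^t* = - A^t*.
Proof. by apply/matrixP => i j; rewrite !mxE rmorphN. Qed.

Lemma adjointZ p q (a : R[i]) (A : 'M[R[i]]_(p, q)) : (a *: A)^t* = a^* *: A^t*.
Proof. by apply/matrixP => i j; rewrite !mxE rmorphM. Qed.

Lemma adjointK p q (A : 'M[R[i]]_(p, q)) : (A^t*)^t* = A.
Proof. by apply/matrixP => i j; rewrite !mxE conjCK. Qed.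

Lemma adjoint0 p q : (0 : 'M[R[i]]_(p, q))^t* = 0.
Proof. by apply/matrixP => i j; rewrite !mxE rmorph0. Qed.

Lemma adjoint_scalar n (a : R[i]) : (a%:M : 'M[R[i]]_n)^t* = (a^*)%:M.
Proof. by apply/matrixP => i j; rewrite !mxE eq_sym rmorphMn. Qed.

Lemma adjoint1 n : (1%:M : 'M[R[i]]_n)^t* = 1%:M.
Proof. by rewrite adjoint_scalar rmorph1. Qed.

Lemma adjoint_block p q r s (A : 'M[R[i]]_(p, r)) (B : 'M[R[i]]_(p, s))
    (C : 'M[R[i]]_(q, r)) (D : 'M[R[i]]_(q, s)) :
  (block_mx A B C D)^t* = block_mx (A^t*) (C^t*) (B^t*) (D^t*).
Proof. by rewrite tr_block_mx map_block_mx. Qed.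

Lemma adjoint_col p q r (A : 'M[R[i]]_(p, r)) (B : 'M[R[i]]_(q, r)) :
  (col_mx A B)^t* = row_mx (A^t*) (B^t*).
Proof. by rewrite tr_col_mx map_row_mx. Qed.

Lemma conjC_real (a : R) : (a%:C)^* = a%:C.
Proof. exact: conjc_real. Qed.

End Adjoint.

Section Inner.
Context {R : realType} {n : nat}.
Implicit Types a b v : 'cV[R[i]]_n.

Definition inner a b : R[i] := (a^t* *m b) 0 0.

Lemma innerJ a b : (inner a b)^* = inner b a.
Proof.
rewrite /inner !mxE rmorph_sum; apply: eq_bigr => i _.
by rewrite !mxE rmorphM /= conjCK mulrC.
Qed.

Lemma innerDl a b v : inner (a + b) v = inner a v + inner b v.
Proof. by rewrite /inner adjointD mulmxDl mxE. Qed.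

Lemma innerDr a b v : inner v (a + b) = inner v a + inner v b.
Proof. by rewrite /inner mulmxDr mxE. Qed.

Lemma innerZr (c : R[i]) a b : inner a (c *: b) = c * inner a b.
Proof. by rewrite /inner -scalemxAr mxE. Qed.

Lemma innerZl (c : R[i]) a b : inner (c *: a) b = c^* * inner a b.
Proof. by rewrite /inner adjointZ -scalemxAl mxE. Qed.

Lemma innerNl a b : inner (- a) b = - inner a b.
Proof. by rewrite /inner adjointN mulNmx mxE. Qed.

Lemma innerNr a b : inner a (- b) = - inner a b.
Proof. by rewrite /inner mulmxN mxE. Qed.

End Inner.

Lemma inner_mulmx {R : realType} p q (A : 'M[R[i]]_(p, q)) (x : 'cV[R[i]]_p)
    (b : 'cV[R[i]]_q) : inner x (A *m b) = inner (A^t* *m x) b.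
Proof. by rewrite /inner adjointM adjointK mulmxA. Qed.

Section NormSq.
Context {R : realType} {n : nat}.
Implicit Types a b v : 'cV[R[i]]_n.

Definition normsq a : R := complex.Re (inner a a).

Lemma innerxx_sum a :
  inner a a = (\sum_i (complex.Re (a i 0) ^+ 2 + complex.Im (a i 0) ^+ 2))%:C.
Proof.
rewrite /inner !mxE rmorph_sum /=; apply: eq_bigr => i _.
by rewrite !mxE mulrC -normCK add_Re2_Im2.
Qed.

Lemma innerxx a : inner a a = (normsq a)%:C.
Proof. by rewrite /normsq innerxx_sum. Qed.

Lemma normsqE a :
  normsq a = \sum_i (complex.Re (a i 0) ^+ 2 + complex.Im (a i 0) ^+ 2).
Proof. by rewrite /normsq innerxx_sum. Qed.

Lemma normsq_ge0 a : 0 <= normsq a.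
Proof. by rewrite normsqE sumr_ge0// => i _; rewrite addr_ge0 ?sqr_ge0. Qed.

Lemma normsq_eq0 a : normsq a <= 0 -> a = 0.
Proof.
move=> a0; apply/matrixP => i j; rewrite ord1 mxE.
have hi : complex.Re (a i 0) ^+ 2 + complex.Im (a i 0) ^+ 2 <= 0.
  apply: le_trans a0; rewrite normsqE (bigD1 i)//= lerDl sumr_ge0// => k _.
  by rewrite addr_ge0 ?sqr_ge0.
case: (a i 0) hi => x y /= hi.
have x0 := sqr_ge0 x; have y0 := sqr_ge0 y.
have /eqP : x ^+ 2 = 0 by lra.
have /eqP : y ^+ 2 = 0 by lra.
by rewrite !sqrf_eq0 => /eqP -> /eqP ->.
Qed.

Lemma normsq0 : normsq 0 = 0.
Proof. by rewrite normsqE big1// => i _; rewrite mxE /= expr0n addr0. Qed.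

Lemma normsqZ (c : R[i]) a :
  normsq (c *: a) = (complex.Re c ^+ 2 + complex.Im c ^+ 2) * normsq a.
Proof.
apply: (@complexI R); rewrite -innerxx innerZl innerZr innerxx mulrA.
by rewrite mulrC [c^* * c]mulrC -normCK -add_Re2_Im2 mulrC -rmorphM.
Qed.

Lemma cauchy_schwarz a b :
  complex.Re (inner a b) ^+ 2 + complex.Im (inner a b) ^+ 2
  <= normsq a * normsq b.
Proof.
have [a0|a0] := lerP (normsq a) 0.
  by rewrite (normsq_eq0 a0) /inner adjoint0 mul0mx mxE /= normsq0 mul0r expr0n addr0.
pose c := inner a b; pose w := (normsq a)%:C *: b - c *: a.
have : 0 <= normsq w by exact: normsq_ge0.
have -> : normsq w = normsq a * (normsq a * normsq b
    - (complex.Re c ^+ 2 + complex.Im c ^+ 2)).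
  apply: (@complexI R); rewrite -innerxx /w innerDl !innerDr !innerNl !innerNr.
  rewrite !innerZl !innerZr -/c -[inner b a]innerJ -/c !innerxx conjC_real.
  rewrite rmorphM rmorphB rmorphM /= add_Re2_Im2 normCK.
  ring.
by rewrite pmulr_rge0// subr_ge0.
Qed.

End NormSq.

Section Flux.
Context {R : realType} {m : nat}.
Implicit Types (y : 'cV[R[i]]_(m + m)).

Definition flux y : R := complex.Im (inner (usubmx y) (dsubmx y)).

(** The standard symplectic matrix. ['i *: jmx] is Hermitian, and its quadratic form is twice the
    flux. *)
Definition jmx : 'M[R[i]]_(m + m) := block_mx 0 (- 1%:M) 1%:M 0.

Lemma jmx_mul y : jmx *m y = col_mx (- dsubmx y) (usubmx y).
Proof.
rewrite -{1}(vsubmxK y) /jmx mul_block_col !mul0mx mulNmx !mul1mx.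
by rewrite add0r addr0.
Qed.

Lemma jmx_sq : jmx *m jmx = - 1%:M.
Proof.
rewrite /jmx mulmx_block !mul0mx !mulmx0 !mulmxN !mulmx1 ?add0r ?addr0.
by rewrite [in RHS]scalar_mx_block opp_block_mx oppr0.
Qed.

Lemma adj_jmx : jmx^t* = - jmx.
Proof. by rewrite /jmx adjoint_block !adjoint0 adjointN !adjoint1 opp_block_mx !oppr0 opprK. Qed.

Lemma inner_flux y : 'i * inner y (jmx *m y) = (2 * flux y)%:C.
Proof.
rewrite jmx_mul /flux -{1}(vsubmxK y); move: (usubmx y) (dsubmx y) => a b.
rewrite {1}/inner adjoint_col mul_row_col mxE mulmxN [(- (a^t* *m b)) 0 0]mxE.
rewrite -/(inner a b) -/(inner b a) -[inner b a]innerJ -complexiE.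
case: (inner a b) => x w; apply/eqP; rewrite eq_complex /=.
by apply/andP; split; apply/eqP; ring.
Qed.

End Flux.

Section FluxEvolution.
Context {R : realType} {m : nat}.
Local Notation halfline := [set s : R | 0 <= s].
Implicit Types (y : R -> 'cV[R[i]]_(m + m)) (z : R[i]).

Lemma real_functional_Im :
  real_functional (fun A : 'M[R[i]]_1 => complex.Im (A 0 0)).
Proof.
split=> [A B|a A|]; first by rewrite !mxE cImD cImN.
  by rewrite !mxE cImM /= mul0r addr0.
exists 1 => A; rewrite mul1r; apply: le_trans (l1norm_entry A 0 0).
by rewrite lerDr.
Qed.

Definition flux_mx (y : 'cV[R[i]]_(m + m)) : 'M[R[i]]_1 :=
  (usubmx y)^t* *m dsubmx y.

Definition flux_form (l y : 'cV[R[i]]_(m + m)) : 'M[R[i]]_1 :=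
  (usubmx l)^t* *m dsubmx y + (usubmx y)^t* *m dsubmx l.

Lemma Im_flux_form (l y : 'cV[R[i]]_(m + m)) : complex.Im (flux_form l y 0 0) =
  complex.Im (inner (usubmx l) (dsubmx y) + inner (usubmx y) (dsubmx l)).
Proof. by rewrite /flux_form mxE. Qed.

Lemma diff_flux_mx D y x l : diff_at D y x l ->
  diff_at D (fun s => flux_mx (y s)) x (flux_form l (y x)).
Proof.
move=> yl; apply: diff_atM; last exact: diff_at_dsub.
by apply: diff_at_adj; exact: diff_at_usub.
Qed.

Lemma Im_inner_herm n (A : 'M[R[i]]_n) (a : 'cV[R[i]]_n) :
  A = A^t* -> complex.Im (inner a (A *m a)) = 0.
Proof.
move=> AE; have : inner a (A *m a) = (inner a (A *m a))^*.
  by rewrite innerJ inner_mulmx -AE.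
case: (inner a _) => x w [] h.
by apply/eqP; rewrite -[_ == _]/(w == 0); apply/eqP; lra.
Qed.

Lemma Gmx_mul (v : 'M[R[i]]_m) z (y : 'cV[R[i]]_(m + m)) :
  Gmx v z *m y = col_mx (dsubmx y) ((v - z%:M) *m usubmx y).
Proof.
by rewrite -{1}(vsubmxK y) /Gmx mul_block_col !mul0mx mul1mx add0r addr0.
Qed.

(** Both |y2|^2 and the form of the Hermitian [v] at y1 are real, so only the spectral parameter
    contributes to the imaginary part. *)
Lemma Im_flux_G (v : 'M[R[i]]_m) z (y : 'cV[R[i]]_(m + m)) : v = v^t* ->
  complex.Im (flux_form (Gmx v z *m y) y 0 0) = - (complex.Im z * normsq (usubmx y)).
Proof.
move=> vE; rewrite Im_flux_form Gmx_mul col_mxKu col_mxKd cImD innerxx /= add0r.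
rewrite mulmxBl mul_scalar_mx innerDr innerNr innerZr innerxx cImD.
by rewrite Im_inner_herm// add0r cImN cImM /= mulr0 add0r.
Qed.

End FluxEvolution.

(** * Symplectic identity and monotonicity of the flux in x *)

Section Fundamental.
Context {R : realType} {m : nat}.
Local Notation halfline := [set s : R | 0 <= s].
Context (v : R -> 'M[R[i]]_m).
Context (v_herm : forall x, 0 <= x -> v x = (v x)^t*).
Implicit Types (Y : R -> 'M[R[i]]_(m + m)) (z : R[i]).

Lemma fundamental_diff z Y x : fundamental_solution v z Y -> 0 <= x ->
  diff_at halfline Y x (Gmx (v x) z *m Y x).
Proof. by move=> [_ H] x0; have [/half_derivableP + <-] := H x x0. Qed.

Lemma adj_Gmx x z : 0 <= x -> (Gmx (v x) (z^*))^t* *m jmx = - (jmx *m Gmx (v x) z).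
Proof.
move=> x0; rewrite /Gmx /jmx adjoint_block !adjoint0 adjoint1 adjointB adjoint_scalar conjCK -v_herm//.
by rewrite !(mulmx_block, mul0mx, mulmx0, mul1mx, mulmx1, mulNmx, mulmxN, add0r,
  addr0, opp_block_mx, oppr0, opprK).
Qed.

(** A Lagrange identity: by [adj_Gmx] the two terms of the derivative cancel, so the product keeps
    its value at 0. It exhibits an inverse of the fundamental matrix. *)
Lemma symplectic z Y Y' x : fundamental_solution v (z^*) Y ->
  fundamental_solution v z Y' -> 0 <= x ->
  (Y x)^t* *m jmx *m Y' x = jmx.
Proof.
move=> fY fY' x0.
have Y0 : (Y 0)^t* *m jmx *m Y' 0 = jmx.
  by rewrite (fY.1) (fY'.1) adjoint1 mul1mx mulmx1.
rewrite -[RHS]Y0.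
apply: (@constant_of_diff0 R _ _ (fun s => (Y s)^t* *m jmx *m Y' s) 0 x x0) => s /andP[s0 _].
have dY := diff_at_sub (@itv_halfline R x) (fundamental_diff fY s0).
have dY' := diff_at_sub (@itv_halfline R x) (fundamental_diff fY' s0).
have := diff_atM (diff_atM (diff_at_adj dY) (diff_at_cst _ jmx s)) dY'.
set l := (X in diff_at _ _ _ X -> _).
suff -> : l = 0 by exact: id.
rewrite /l mulmx0 addr0 adjointM -[(Y s)^t* *m _ *m jmx]mulmxA adj_Gmx//.
by rewrite mulmxN mulNmx -!mulmxA addNr.
Qed.

Lemma flux_nonincreasing z (y : R -> 'cV[R[i]]_(m + m)) a b : 0 <= complex.Im z ->
  0 <= a -> a <= b ->
  (forall x, 0 <= x -> diff_at halfline y x (Gmx (v x) z *m y x)) ->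
  flux (y b) <= flux (y a).
Proof.
move=> z0 a0 ab yd; rewrite -subr_le0.
have sub : `[a, b] `<=` halfline.
  by move=> s /=; rewrite in_itv/= => /andP[h _]; exact: le_trans h.
have := @mean_value_functional R _ _ _ (fun s => flux_mx (y s)) _ (fun=> 0) (fun=> 0)
  a b ab (real_functional_Im) _ _ _.
rewrite subrr; apply => [s /andP[as_ _]|s /andP[as_ _]].
  apply: diff_flux_mx; apply: diff_at_sub sub _; apply: yd; exact: le_trans as_.
rewrite Im_flux_G; last by apply: v_herm; exact: le_trans as_.
by rewrite oppr_le0 mulr_ge0 ?normsq_ge0.
Qed.

(** If y1(0) were nonzero, the flux would decrease at 0 at the positive rate Im z |y1(0)|^2. It
    would be negative at a small [s <= l] and, being nonincreasing, still negative at [l]. *)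
Lemma flux_strict z (y : R -> 'cV[R[i]]_(m + m)) l : 0 < complex.Im z -> 0 < l ->
  (forall x, 0 <= x -> diff_at halfline y x (Gmx (v x) z *m y x)) ->
  flux (y 0) <= 0 -> 0 <= flux (y l) -> usubmx (y 0) = 0.
Proof.
move=> z0 l0 yd y0 yl; apply: normsq_eq0; rewrite leNgt; apply/negP => n0.
pose c := complex.Im z * normsq (usubmx (y 0)).
have c0 : 0 < c by rewrite mulr_gt0.
have := diff_flux_mx (yd 0 (lexx 0)); move=> /(_ (c / 2) (divr_gt0 c0 (ltr0n _ 2))).
rewrite near_withinE => /nbhs_ballP[d /= d0 H].
pose s := Num.min (d / 2) l.
have s0 : 0 < s by rewrite lt_min l0 divr_gt0.
have sd : s < d by rewrite gt_min ltr_pdivrMr// ltr_pMr// ltrDl ltr01.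
have sl : s <= l by rewrite ge_min lexx orbT.
have := H s; rewrite /ball /= sub0r normrN gtr0_norm// => /(_ sd (ltW s0)).
set W := (X in _ *: X); rewrite subr0 (gtr0_norm s0) => h.
have hW : complex.Im (W 0 0) = - c by rewrite Im_flux_G// -v_herm.
have h2 : `|flux (y s) - flux (y 0) + s * c| <= c / 2 * s.
  apply: le_trans h.
  apply: le_trans (l1norm_entry (flux_mx (y s) - flux_mx (y 0) - s%:C *: W) 0 0).
  have -> : flux (y s) - flux (y 0) + s * c =
      complex.Im ((flux_mx (y s) - flux_mx (y 0) - s%:C *: W) 0 0).
    have mE (A B C : 'M[R[i]]_1) : (A - B - s%:C *: C) 0 0 =
        A 0 0 - B 0 0 - s%:C * C 0 0 by rewrite !mxE.
    by rewrite mE !cImD !cImN cImM hW /= mul0r addr0 mulrN opprK.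
  by rewrite /l1c lerDr.
have h3 := flux_nonincreasing (ltW z0) (ltW s0) sl yd.
have sc : 0 < s * c by rewrite mulr_gt0.
move: h2; rewrite ler_norml => /andP[_ h2].
lra.
Qed.

End Fundamental.

(** * Weyl functions and solutions of nonnegative flux *)

Section NormalizingMatrix.
Context {R : realType} {m : nat}.

Let s : R[i] := (sqrtC 2)^-1.

Lemma conj_invsqrt2 : s^* = s.
Proof. by rewrite geC0_conj// invr_ge0 sqrtC_ge0. Qed.

Lemma invsqrt2_sq : s * s = 2^-1.
Proof. by rewrite /s -invfM -expr2 sqrtCK. Qed.

Lemma invsqrt2_neq0 : s != 0.
Proof. by rewrite invr_neq0// sqrtC_eq0 pnatr_eq0. Qed.

Definition smx : 'M[R[i]]_(m + m) := block_mx 0 1%:M 1%:M 0.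

Lemma TmxE : Tmx = s *: block_mx 'i%:M 1%:M 'i%:M (-1)%:M :> 'M[R[i]]_(m + m).
Proof.
rewrite /Tmx; congr (_ *: block_mx _ _ _ _).
by apply/matrixP => i j; rewrite !mxE mulNrn.
Qed.

Lemma adj_Tmx : (Tmx : 'M[R[i]]_(m + m))^t* =
  s *: block_mx (- 'i)%:M (- 'i)%:M 1%:M (-1)%:M.
Proof.
by rewrite TmxE adjointZ conj_invsqrt2 adjoint_block !adjoint_scalar rmorph1 rmorphN1 conjCi.
Qed.

Let i2 : 'i * 'i = -1 :> R[i].
Proof. by rewrite -expr2 sqrCi. Qed.

Let half2 : 2^-1 * 2 = 1 :> R[i].
Proof. by rewrite mulVf// pnatr_eq0. Qed.

Lemma Tmx_unitary : Tmx *m Tmx^t* = 1%:M :> 'M[R[i]]_(m + m).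
Proof.
rewrite adj_Tmx TmxE -scalemxAl -scalemxAr scalerA invsqrt2_sq.
rewrite mulmx_block -!scalar_mxM -!raddfD /= scale_block_mx !scale_scalar_mx.
rewrite [in RHS]scalar_mx_block -scalar_mx0.
by congr (block_mx _%:M _%:M _%:M _%:M); ring: i2 half2.
Qed.

(** [smx] is the matrix of the form in the admissibility condition. Conjugation by [Tmx] turns that
    form into the flux form, so nonnegativity of the one becomes nonnegativity of the other. *)
Lemma Tmx_form : Tmx *m smx *m Tmx^t* = 'i *: jmx :> 'M[R[i]]_(m + m).
Proof.
have N1 : - 1%:M = (-1)%:M :> 'M[R[i]]_m.
  by apply/matrixP => i j; rewrite !mxE mulNrn.
rewrite adj_Tmx TmxE -!scalemxAl -scalemxAr scalerA invsqrt2_sq /smx /jmx.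
rewrite N1 -scalar_mx0 !mulmx_block -!scalar_mxM -!raddfD /= -!scalar_mxM -!raddfD /=.
rewrite !scale_block_mx !scale_scalar_mx.
by congr (block_mx _%:M _%:M _%:M _%:M); field.
Qed.

End NormalizingMatrix.

Section WeylVector.
Context {R : realType} {m : nat}.
Context (v : R -> 'M[R[i]]_m).
Context (v_herm : forall x, 0 <= x -> v x = (v x)^t*).
Context (Psi : R[i] -> R -> 'M[R[i]]_(m + m)).
Context (Psi_sol : forall z, fundamental_solution v z (Psi z)).
Implicit Types (z : R[i]) (l : R).

Let s : R[i] := (sqrtC 2)^-1.

Lemma fundamental_unit z x : 0 <= x -> Psi z x \in unitmx.
Proof.
move=> x0; have h := symplectic v_herm (Psi_sol (z^*)) (Psi_sol z) x0.
have : (- jmx *m (Psi (z^*) x)^t* *m jmx) *m Psi z x = 1%:M.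
  by rewrite -!mulmxA [_^t* *m _]mulmxA h mulNmx jmx_sq opprK.
by case/mulmx1_unit.
Qed.

(** The point 0 is its own conjugate, so [symplectic] relates [Psi 0 x] to itself; turning the
    resulting left inverse into a right inverse moves the adjoint to the other side. *)
Lemma symplectic_adj x : 0 <= x -> Psi 0 x *m jmx *m (Psi 0 x)^t* = jmx.
Proof.
move=> x0; have := symplectic v_herm (Psi_sol (0^*)) (Psi_sol 0) x0.
rewrite rmorph0 => h.
have : (- jmx *m (Psi 0 x)^t* *m jmx) *m Psi 0 x = 1%:M.
  by rewrite -!mulmxA [_^t* *m _]mulmxA h mulNmx jmx_sq opprK.
move=> /mulmx1C; rewrite mulNmx mulNmx mulmxN => /(congr1 (mulmxr jmx)) /=.
rewrite mulNmx -!mulmxA jmx_sq mulmxN mulmx1 !mulmxN opprK mul1mx !mulmxA.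
by [].
Qed.

Lemma normalizer_unit l : 0 <= l -> Psi 0 l *m Tmx \in unitmx.
Proof.
by move=> l0; rewrite unitmx_mul fundamental_unit//; case: (mulmx1_unit (@Tmx_unitary R m)).
Qed.

Lemma normalizer_adj l : 0 <= l ->
  (invmx (Psi 0 l *m Tmx))^t* *m (Psi 0 l *m Tmx)^t* = 1%:M.
Proof. by move=> l0; rewrite -adjointM mulmxV ?normalizer_unit// adjoint1. Qed.

(* By [Amx_transport], [Amx] maps the pair read off from [transport l z *m h]
   to a vector that depends neither on [l] nor on [z]. *)
Definition transport l z : 'M[R[i]]_(m + m) :=
  (Psi 0 l *m Tmx)^t* *m jmx *m Psi z l.

Lemma transport_unit l z : 0 <= l -> transport l z \in unitmx.
Proof.
move=> l0; rewrite /transport !unitmx_mul fundamental_unit// andbT.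
have ju : (jmx : 'M[R[i]]_(m + m)) \in unitmx.
  have : - jmx *m jmx = 1%:M :> 'M[R[i]]_(m + m) by rewrite mulNmx jmx_sq opprK.
  by case/mulmx1_unit.
rewrite ju andbT.
by case: (mulmx1_unit (normalizer_adj l0)).
Qed.

Lemma Amx_transport l z : 0 <= l ->
  Amx Psi l z *m transport l z = Tmx^t* *m jmx.
Proof.
move=> l0; rewrite /Amx /normalized_solution /transport.
move: (Psi 0 l *m Tmx) (normalizer_adj l0) => W hW.
rewrite !adjointM -!mulmxA [X in _ *m (_ *m X)]mulmxA hW mul1mx.
by rewrite [X in _ *m X]mulmxA (symplectic v_herm (Psi_sol (z^*)) (Psi_sol z) l0).
Qed.

(** For boundary data h = (h1, h2), the two components show that the Moebius transform sends h1 + h2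
    to h2 - h1. For h2 = i k h1 its value is (i k - 1) / (i k + 1), the Weyl function of the zero
    potential. *)
Lemma adj_Tmx_jmx (h : 'cV[R[i]]_(m + m)) : Tmx^t* *m jmx *m h =
  s *: col_mx ('i *: (dsubmx h - usubmx h)) (- (usubmx h + dsubmx h)).
Proof.
rewrite -mulmxA jmx_mul adj_Tmx -scalemxAl mul_block_col !mul_scalar_mx.
by congr (_ *: col_mx _ _); apply/matrixP => i j; rewrite !mxE; ring.
Qed.

Lemma normalizer_form l : 0 <= l ->
  (Psi 0 l *m Tmx) *m smx *m (Psi 0 l *m Tmx)^t* = 'i *: jmx.
Proof.
move=> l0; rewrite adjointM -mulmxA -mulmxA [smx *m _]mulmxA [Tmx *m _]mulmxA.
by rewrite [Tmx *m _]mulmxA Tmx_form -scalemxAl -scalemxAr mulmxA symplectic_adj.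
Qed.

Lemma inner_smx (e : 'cV[R[i]]_(m + m)) : inner e (smx *m e) =
  inner (usubmx e) (dsubmx e) + inner (dsubmx e) (usubmx e).
Proof.
rewrite -{1 2}(vsubmxK e) /smx mul_block_col !mul0mx !mul1mx add0r addr0.
by rewrite {1}/inner adjoint_col mul_row_col mxE.
Qed.

(** The pair read off from [transport l z *m h] satisfies the sign condition of admissibility
    exactly when the solution has nonnegative flux at [l]. The normalizing factor disappears because
    it carries [smx] to ['i *: jmx]. *)
Lemma transport_flux l z (h : 'cV[R[i]]_(m + m)) : 0 <= l ->
  complex.Re (inner (usubmx (transport l z *m h)) (dsubmx (transport l z *m h)))
  = flux (Psi z l *m h).
Proof.
move=> l0.
have -> : transport l z *m h = (Psi 0 l *m Tmx)^t* *m (jmx *m (Psi z l *m h)).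
  by rewrite /transport !mulmxA.
move: (Psi z l *m h) (Psi 0 l *m Tmx) (normalizer_form l0) => y N hN.
have : inner (N^t* *m (jmx *m y)) (smx *m (N^t* *m (jmx *m y))) = (2 * flux y)%:C.
  rewrite -inner_mulmx mulmxA mulmxA hN -scalemxAl innerZr mulmxA jmx_sq mulNmx mul1mx.
  by rewrite innerNr -innerNl -mulNmx -adj_jmx -inner_mulmx inner_flux.
rewrite inner_smx -[X in _ + X]innerJ; move: (inner _ _) => [a b] /= [] h1 _.
lra.
Qed.

End WeylVector.

Section ContractionPair.
Context {R : realType} {m : nat}.
Implicit Types (a b w : 'cV[R[i]]_m) (P Q : 'M[R[i]]_m).

(* The pair [P = (1 + K) / 2], [Q = (1 - K) / 2] is admissible when [K] is a
   contraction, and [P a = p], [Q a = q] when [K] maps [a = p + q] to [p - q]. *)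
Definition contraction_mx a b : 'M[R[i]]_m :=
  ((normsq a)^-1)%:C *: (b *m a^t*).

Lemma contraction_mul a b w :
  contraction_mx a b *m w = (((normsq a)^-1)%:C * inner a w) *: b.
Proof.
rewrite /contraction_mx -scalemxAl -mulmxA [a^t* *m w]mx11_scalar mul_mx_scalar.
by rewrite scalerA.
Qed.

Lemma contraction_alpha a b : normsq b <= normsq a -> contraction_mx a b *m a = b.
Proof.
move=> ba; rewrite contraction_mul innerxx.
have [a0|a0] := lerP (normsq a) 0.
  by rewrite (@normsq_eq0 _ _ b) ?scaler0//; apply: le_trans ba a0.
by rewrite -rmorphM mulVf ?gt_eqF// scale1r.
Qed.

Lemma contraction_le a b w : normsq b <= normsq a ->
  normsq (contraction_mx a b *m w) <= normsq w.
Proof.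
move=> ba; have na := normsq_ge0 a; have nw := normsq_ge0 w.
rewrite contraction_mul normsqZ cReM cImM /= !mul0r subr0 addr0.
have [a0|a0] := lerP (normsq a) 0.
  by rewrite (@normsq_eq0 _ _ b) ?normsq0 ?mulr0//; apply: le_trans ba a0.
rewrite !exprMn -mulrDr.
apply: (@le_trans _ _ ((normsq a)^-1 ^+ 2 * (normsq a * normsq w) * normsq a)).
  apply: ler_pM => //; [|exact: normsq_ge0|].
    by apply: mulr_ge0; [exact: sqr_ge0|apply: addr_ge0; exact: sqr_ge0].
  by apply: ler_wpM2l; [exact: sqr_ge0|exact: cauchy_schwarz].
by rewrite le_eqVlt; apply/orP; left; apply/eqP; field; rewrite gt_eqF.
Qed.

Lemma meromorphic_cst P z : meromorphic_at (fun=> P) z.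
Proof.
exists 0%N, (fun=> P); first by near=> w; exact: derivable_cst.
by near=> w; rewrite expr0 invr1 scale1r.
Unshelve. all: by end_near. Qed.

Lemma holomorphic_cst P z : holomorphic_at (fun=> P) z.
Proof. by near=> w; exact: derivable_cst. Unshelve. all: by end_near. Qed.

Lemma quadratic_form (A B C D : 'M[R[i]]_m) w :
  (w^t* *m (A^t* *m B + C^t* *m D) *m w) 0 0 =
  inner (A *m w) (B *m w) + inner (C *m w) (D *m w).
Proof. by rewrite mulmxDr mulmxDl mxE /inner !adjointM !mulmxA. Qed.

(** With P + Q = 1 and K = P - Q, no nonzero vector is killed by both P and Q, and the second form
    is half of |w|^2 - |K w|^2. Constancy in [z] settles meromorphy. *)
Lemma admissible_cst P Q : (forall w, P *m w + Q *m w = w) ->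
  (forall w, normsq (P *m w - Q *m w) <= normsq w) ->
  admissible_pair (fun=> P) (fun=> Q).
Proof.
move=> PQ Kle z _.
split; [exact: meromorphic_cst|exact: meromorphic_cst|move=> _ _; split] => w.
  move=> w0; rewrite quadratic_form !innerxx.
  have -> : (normsq (P *m w))%:C + (normsq (Q *m w))%:C =
      (normsq (P *m w) + normsq (Q *m w))%:C by rewrite [RHS]rmorphD.
  rewrite ltcR ltNge; apply/negP => n0.
  have np := normsq_ge0 (P *m w); have nq := normsq_ge0 (Q *m w).
  have Pw : P *m w = 0 by apply: normsq_eq0; apply: le_trans n0; rewrite lerDl.
  have Qw : Q *m w = 0 by apply: normsq_eq0; apply: le_trans n0; rewrite lerDr.
  by move/eqP: w0; rewrite -(PQ w) Pw Qw addr0.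
rewrite quadratic_form.
have -> : inner (P *m w) (Q *m w) + inner (Q *m w) (P *m w) =
    ((normsq w - normsq (P *m w - Q *m w)) / 2)%:C.
  have wE : (normsq w)%:C = inner (P *m w + Q *m w) (P *m w + Q *m w).
    by rewrite PQ innerxx.
  rewrite rmorphM fmorphV rmorphB /= wE -innerxx.
  move: (P *m w) (Q *m w) => x y.
  rewrite !innerDl !innerDr !innerNl !innerNr rmorph_nat.
  by field.
by rewrite lecR divr_ge0// subr_ge0.
Qed.

Lemma half_sum (K : 'M[R[i]]_m) :
  2^-1 *: (1%:M + K) + 2^-1 *: (1%:M - K) = 1%:M.
Proof. by apply/matrixP => i j; rewrite !mxE; field. Qed.

Lemma half_diff (K : 'M[R[i]]_m) :
  2^-1 *: (1%:M + K) - 2^-1 *: (1%:M - K) = K.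
Proof. by apply/matrixP => i j; rewrite !mxE; field. Qed.

Lemma admissible_contraction (K : 'M[R[i]]_m) :
  (forall w, normsq (K *m w) <= normsq w) ->
  admissible_pair (fun=> 2^-1 *: (1%:M + K)) (fun=> 2^-1 *: (1%:M - K)).
Proof.
move=> Kle; apply: admissible_cst => w.
  by rewrite -mulmxDl half_sum mul1mx.
by rewrite -mulmxBl half_diff.
Qed.

End ContractionPair.

Section WeylVector.
Context {R : realType} {m : nat}.
Context (v : R -> 'M[R[i]]_m).
Context (v_herm : forall x, 0 <= x -> v x = (v x)^t*).
Context (Psi : R[i] -> R -> 'M[R[i]]_(m + m)).
Context (Psi_sol : forall z, fundamental_solution v z (Psi z)).
Implicit Types (z : R[i]) (l : R).

Lemma solution_diff z (h : 'cV[R[i]]_(m + m)) x : 0 <= x ->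
  diff_at [set s : R | 0 <= s] (fun x => Psi z x *m h) x
    (Gmx (v x) z *m (Psi z x *m h)).
Proof.
move=> x0; have := diff_atM (fundamental_diff (Psi_sol z) x0) (diff_at_cst _ h x).
by rewrite mulmx0 addr0 mulmxA.
Qed.

Lemma unitmx_of_injective n (V : 'M[R[i]]_n) :
  (forall w : 'cV_n, V *m w = 0 -> w = 0) -> V \in unitmx.
Proof.
move=> Vinj; rewrite -row_full_unit -cokermx_eq0; apply/eqP/matrixP => i j.
have : col j (cokermx V) = 0 by apply: Vinj; rewrite colE mulmxA mulmx_coker mul0mx.
by move/matrixP/(_ i 0); rewrite !mxE.
Qed.

Lemma fraction_mul n (U V : 'M[R[i]]_n) (al sm d : 'cV[R[i]]_n) (r : R[i]) :
  r != 0 -> V \in unitmx -> U *m al = r *: ('i *: d) -> V *m al = r *: - sm ->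
  'i *: (U *m invmx V) *m sm = d.
Proof.
move=> r0 Vu Ua Va; have i2 : 'i * 'i = -1 :> R[i] by rewrite -expr2 sqrCi.
have smE : sm = - r^-1 *: (V *m al).
  by rewrite Va scalerA mulNr mulVf// scaleN1r opprK.
rewrite smE -scalemxAr -scalemxAl -mulmxA mulKmx// Ua !scalerA.
rewrite (_ : _ * r * 'i = 1) ?scale1r//.
by rewrite -[LHS]mulrA; field: i2.
Qed.

(** A kernel vector [w] yields initial data with h2 = - h1, whose flux at 0 vanishes because the
    inner product of h1 and h2 is real. Admissibility makes the flux at [l] nonnegative, so
    [flux_strict] forces h1 = 0, and then P w = Q w = 0. *)
Lemma denominator_unit (K : 'M[R[i]]_m) l z : 0 < complex.Im z -> 0 < l ->
  (forall w : 'cV_m, normsq (K *m w) <= normsq w) ->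
  dlsubmx (Amx Psi l z) *m (2^-1 *: (1%:M + K)) +
  drsubmx (Amx Psi l z) *m (2^-1 *: (1%:M - K)) \in unitmx.
Proof.
move=> z0 l0 Kle; have l0' := ltW l0.
set P := 2^-1 *: (1%:M + K); set Q := 2^-1 *: (1%:M - K).
have s0 : (sqrtC 2)^-1 != 0 :> R[i] by exact: invsqrt2_neq0.
apply: unitmx_of_injective => w Vw.
pose e := col_mx (P *m w) (Q *m w).
pose h := invmx (transport Psi l z) *m e.
have Tu : transport Psi l z \in unitmx.
  exact: (@transport_unit _ _ v v_herm Psi Psi_sol l z l0').
have he : transport Psi l z *m h = e.
  by rewrite /h mulmxA mulmxV ?mul1mx//.
have Ae : Amx Psi l z *m e = (sqrtC 2)^-1 *: 
    col_mx ('i *: (dsubmx h - usubmx h)) (- (usubmx h + dsubmx h)).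
  by rewrite -he mulmxA (Amx_transport v_herm Psi_sol z l0') adj_Tmx_jmx.
have sum0 : usubmx h + dsubmx h = 0.
  have := congr1 dsubmx Ae; rewrite linearZ /= col_mxKd.
  rewrite -{1}(submxK (Amx Psi l z)) /e mul_block_col col_mxKd !mulmxA -mulmxDl Vw.
  by move/esym/eqP; rewrite scaler_eq0 (negPf s0) oppr_eq0 => /eqP.
have dE : dsubmx h = - usubmx h by apply/eqP; rewrite -addr_eq0 addrC sum0.
have f0 : flux (Psi z 0 *m h) <= 0.
  by rewrite (Psi_sol z).1 mul1mx /flux dE innerNr innerxx /= oppr0.
have fl : 0 <= flux (Psi z l *m h).
  have zI : 0 < 'Im z by rewrite -complexIm ltcR.
  have [_ _ H] := admissible_contraction Kle zI.
  rewrite -(transport_flux v_herm Psi_sol z h l0') he /e col_mxKu col_mxKd.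
  have [_ H2] := H (holomorphic_cst _ _) (holomorphic_cst _ _).
  have := H2 w; rewrite quadratic_form -/P -/Q -[X in _ + X]innerJ.
  case: (inner _ _) => a b; rewrite lecE /= => /andP[_]; lra.
have := @flux_strict R m v v_herm z (fun x => Psi z x *m h) l z0 l0
  (solution_diff z h) f0 fl.
rewrite (Psi_sol z).1 mul1mx => u0.
have e0 : e = 0 by rewrite -he -(vsubmxK h) dE u0 oppr0 col_mx0 mulmx0.
have Pw : P *m w = 0 by rewrite -[LHS](col_mxKu _ (Q *m w)) -/e e0 linear0.
have Qw : Q *m w = 0 by rewrite -[LHS](col_mxKd (P *m w)) -/e e0 linear0.
rewrite -[w]mul1mx (_ : 1%:M = P + Q); last first.
  by apply/matrixP => i j; rewrite !mxE; field.
by rewrite mulmxDl Pw Qw addr0.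
Qed.

(** With (p, q) read off at [l], nonnegative flux means that the real part of the inner product of p
    and q is nonnegative, that is |p - q| <= |p + q|. A contraction then maps p + q to p - q, and
    its admissible pair reproduces (p, q). The Moebius transform therefore sends h1 + h2 to h2 - h1
    for every [l > 0], and its limit does so too. *)
Lemma weyl_vector (M : R[i] -> 'M[R[i]]_m) z (h : 'cV[R[i]]_(m + m)) :
  (forall P Q : R -> R[i] -> 'M[R[i]]_m,
      (forall l, 0 < l -> admissible_pair (P l) (Q l)) ->
      forall z, 0 < 'Im z ->
        (\forall l \near +oo, holomorphic_at (P l) z /\ holomorphic_at (Q l) z) ->
        moebius (Amx Psi l z) (P l z) (Q l z) @[l --> +oo] --> M z) ->
  0 < complex.Im z -> (forall l, 0 < l -> 0 <= flux (Psi z l *m h)) ->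
  dsubmx h - usubmx h = M z *m (usubmx h + dsubmx h).
Proof.
move=> Mlim z0 hflux.
have s0 : (sqrtC 2)^-1 != 0 :> R[i] by exact: invsqrt2_neq0.
pose e l := transport Psi l z *m h.
pose p l := usubmx (e l); pose q l := dsubmx (e l).
pose al l := p l + q l; pose be l := p l - q l.
pose K l := if 0 < l then contraction_mx (al l) (be l) else 0.
have leab l : 0 < l -> normsq (be l) <= normsq (al l).
  move=> l0; have := hflux l l0; rewrite -(transport_flux v_herm Psi_sol z h (ltW l0)).
  rewrite -/(e l) -/(p l) -/(q l) /normsq /al /be.
  rewrite !innerDl !innerDr !innerNl !innerNr -[inner (q l) (p l)]innerJ.
  by rewrite !cReD !cReN cReJ; clear; lra.
have Kle l w : normsq (K l *m w) <= normsq w.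
  rewrite /K; case: ifP => [/leab|_]; first exact: contraction_le.
  by rewrite mul0mx normsq0 normsq_ge0.
pose P l (_ : R[i]) := 2^-1 *: (1%:M + K l).
pose Q l (_ : R[i]) := 2^-1 *: (1%:M - K l).
have zI : 0 < 'Im z by rewrite -complexIm ltcR.
have lim := Mlim P Q (fun l _ => admissible_contraction (Kle l)) z zI _.
have {}lim : moebius (Amx Psi l z) (P l z) (Q l z) @[l --> +oo] --> M z.
  by apply: lim; near=> l; split; exact: holomorphic_cst.
set d := dsubmx h - usubmx h; set sm := usubmx h + dsubmx h.
have key l : 0 < l -> moebius (Amx Psi l z) (P l z) (Q l z) *m sm = d.
  move=> l0; have l0' := ltW l0.
  have Ka : K l *m al l = be l by rewrite /K l0 contraction_alpha// leab.
  have Pa : P l z *m al l = p l.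
    rewrite /P -scalemxAl mulmxDl mul1mx Ka /al /be.
    by apply/matrixP => i j; rewrite !mxE; field.
  have Qa : Q l z *m al l = q l.
    rewrite /Q -scalemxAl mulmxBl mul1mx Ka /al /be.
    by apply/matrixP => i j; rewrite !mxE; field.
  have Ae : Amx Psi l z *m e l = (sqrtC 2)^-1 *: col_mx ('i *: d) (- sm).
    by rewrite /e mulmxA (Amx_transport v_herm Psi_sol z l0') adj_Tmx_jmx.
  have Vu := denominator_unit z0 l0 (Kle l).
  have [Ua Va] : (ulsubmx (Amx Psi l z) *m P l z + ursubmx (Amx Psi l z) *m Q l z) *m al l
        = (sqrtC 2)^-1 *: ('i *: d) /\
      (dlsubmx (Amx Psi l z) *m P l z + drsubmx (Amx Psi l z) *m Q l z) *m al l
        = (sqrtC 2)^-1 *: - sm.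
    move: Ae; rewrite -(vsubmxK (e l)) -/(p l) -/(q l) -Pa -Qa.
    rewrite -{1}(submxK (Amx Psi l z)) mul_block_col scale_col_mx => /eq_col_mx[h1 h2].
    by rewrite -h1 -h2 !mulmxDl !mulmxA.
  exact: fraction_mul s0 Vu Ua Va.
apply/eqP; rewrite -subr_eq0; apply/eqP; apply: l1norm_eq0.
have sm0 : 0 < l1norm sm + 1 by rewrite ltr_wpDl ?l1norm_ge0.
apply/ler_addgt0Pl => r r0; rewrite addr0.
move/cvg_l1norm: lim => /(_ _ (divr_gt0 r0 sm0)) lim.
have [l [l0 hl]] : exists l : R, 0 < l /\
    l1norm (moebius (Amx Psi l z) (P l z) (Q l z) - M z) <= r / (l1norm sm + 1).
  apply: (@filter_ex _ (pinfty_nbhs R)); near=> l; split; last by near: l.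
  by near: l; exact: nbhs_pinfty_gt.
rewrite -(key l l0) -mulmxBl; apply: le_trans (l1normM _ _) _.
apply: le_trans (ler_wpM2r (l1norm_ge0 _) hl) _.
by rewrite mulrAC ler_pdivrMr// ler_pM2l// lerDl.
Unshelve. all: by end_near. Qed.

End WeylVector.

(** * The explicit solution for the initial potential *)

Section ScalarDifferentiability.
Context {R : realType}.
Implicit Types (c : R -> R[i]) (x : R).

(** Scalar functions are treated as scalar matrices, so that the matrix product rule covers them.
    All sizes and all sets [D] are included because one scalar multiplies blocks of various
    shapes. *)
Definition cdiff_at c x (c' : R[i]) := forall p D,
  diff_at D (fun s => (c s)%:M : 'M[R[i]]_p) x c'%:M.

Lemma cdiff_cst (a : R[i]) x : cdiff_at (fun=> a) x 0.
Proof. by move=> p D; rewrite scalar_mx0; exact: diff_at_cst. Qed.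

Lemma l1norm_scalar p (a : R[i]) : l1norm (a%:M : 'M[R[i]]_p) <= (p * p)%:R * l1c a.
Proof.
apply: l1norm_const => i j; rewrite mxE; case: eqP => _ //=.
by rewrite mulr0n l1c0 l1c_ge0.
Qed.

Lemma cdiff_real (f : R -> R) x l : is_derive x 1 f l ->
  cdiff_at (fun s => (f s)%:C) x l%:C.
Proof.
move=> fl p D; apply: (@diff_at_le _ _ _ _ _ _ _ (p * p)%:R) => e e0.
apply: cvg_within; apply: filterS (is_derive_near fl e0) => y h.
have -> : (f y)%:C%:M - (f x)%:C%:M - (y - x)%:C *: (l%:C%:M : 'M[R[i]]_p) =
    (f y - f x - (y - x) * l)%:C%:M.
  apply/matrixP => i j; rewrite !mxE; case: eqP => _; rewrite /= ?mulr0n ?mulr1n.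
    by apply/eqP; rewrite eq_complex /=; apply/andP; split; apply/eqP; ring.
  by rewrite mulr0 !subr0.
apply: le_trans (l1norm_scalar _ _) _; rewrite -mulrA ler_wpM2l//.
by rewrite /l1c /= normr0 addr0.
Qed.

Lemma cdiffD c d x (c' d' : R[i]) : cdiff_at c x c' -> cdiff_at d x d' ->
  cdiff_at (fun s => c s + d s) x (c' + d').
Proof.
move=> hc hd p D; rewrite raddfD.
rewrite (_ : (fun s => _) = (fun s => (c s)%:M + (d s)%:M)).
  exact: diff_atD.
by apply/funext => s; rewrite raddfD.
Qed.

Lemma cdiffM c d x (c' d' : R[i]) : cdiff_at c x c' -> cdiff_at d x d' ->
  cdiff_at (fun s => c s * d s) x (c' * d x + c x * d').
Proof.
move=> hc hd p D; rewrite raddfD /= !scalar_mxM.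
rewrite (_ : (fun s => _) = (fun s => (c s)%:M *m (d s)%:M)).
  exact: diff_atM.
by apply/funext => s; rewrite scalar_mxM.
Qed.

Lemma diff_atZ_scalar p q D c (c' : R[i]) (f : R -> 'M[R[i]]_(p, q)) x l :
  cdiff_at c x c' -> diff_at D f x l ->
  diff_at D (fun s => c s *: f s) x (c' *: f x + c x *: l).
Proof.
move=> hc hf; rewrite -!mul_scalar_mx.
rewrite (_ : (fun s => _) = (fun s => (c s)%:M *m f s)).
  exact: diff_atM (hc p D) hf.
by apply/funext => s; rewrite mul_scalar_mx.
Qed.

Lemma cdiff_id x : cdiff_at (fun s => s%:C) x 1.
Proof. by apply: cdiff_real; exact: is_derive_id. Qed.

Lemma cdiff_eq c x (c' d' : R[i]) : cdiff_at c x c' -> c' = d' -> cdiff_at c x d'.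
Proof. by move=> h <-. Qed.

(** The exponential of i k s, split into real and imaginary parts. *)
Definition cexp (k : R[i]) (s : R) : R[i] :=
  Complex (expR (- complex.Im k * s) * cos (complex.Re k * s))
          (expR (- complex.Im k * s) * sin (complex.Re k * s)).

Lemma cexp0 k : cexp k 0 = 1.
Proof. by rewrite /cexp !mulr0 expR0 cos0 sin0 mulr1 mulr0. Qed.

Lemma cdiff_cexp k x : cdiff_at (cexp k) x ('i * k * cexp k x).
Proof.
case: k => a b; rewrite /cexp /=.
have lin (r : R) : is_derive x 1 (fun s : R => r * s) r.
  by apply: is_derive_eq; rewrite ?scaler0 ?add0r ?addr0 /GRing.scale /= ?mulr1.
have dE := is_derive_expRM (- b) x.
have dcos : is_derive x 1 (fun s : R => cos (a * s)) (- (a * sin (a * x))).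
  have := @is_derive1_comp _ cos (fun s : R => a * s) x _ _ (is_derive_cos _) (lin a).
  by rewrite mulrC mulrN.
have dsin : is_derive x 1 (fun s : R => sin (a * s)) (a * cos (a * x)).
  have := @is_derive1_comp _ sin (fun s : R => a * s) x _ _ (is_derive_sin _) (lin a).
  by rewrite mulrC.
have dR := is_deriveM dE dcos; have dI := is_deriveM dE dsin.
have := cdiffD (cdiff_real dR) (cdiffM (cdiff_cst 'i x) (cdiff_real dI)).
rewrite (_ : (fun s => _) = cexp (Complex a b)); last first.
  apply/funext => s; rewrite -complexiE; apply/eqP; rewrite eq_complex /= !mulrfctE.
  by apply/andP; split; apply/eqP; ring.
move/cdiff_eq; apply; rewrite -complexiE; apply/eqP; rewrite eq_complex /= /GRing.scale /= ?mulrfctE.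
by apply/andP; split; apply/eqP; ring.
Qed.

End ScalarDifferentiability.

Section InitialProfile.
Context {R : realType} {m n : nat}.
Context (theta : 'M[R[i]]_(n, m)).
Local Notation halfline := [set s : R | 0 <= s].

Let c := theta *m theta^t*.
Let N (x : R) : 'M[R[i]]_n := 1%:M + (x ^+ 3 / 3)%:C *: c.

(** The initial potential is -2 times the derivative of x^2 S. This is the double commutation of the
    zero potential at energy 0 with the solution x: the x^3 / 3 in [N] is the integral of x^2, and
    in the scalar case x^2 S is the logarithmic derivative of 1 + c x^3 / 3. *)
Definition profile_mx (x : R) : 'M[R[i]]_m :=
  theta^t* *m invmx (N x) *m theta.

Local Notation S := profile_mx.

Lemma initial_profileE x : initial_profile theta x =
  (2 * x ^+ 4)%:C *: (S x *m S x) - (4 * x)%:C *: S x.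
Proof. by rewrite /initial_profile /S /N /c !mulmxA. Qed.

Lemma adj_N x : (N x)^t* = N x.
Proof. by rewrite /N /c adjointD adjoint1 adjointZ conjC_real adjointM adjointK. Qed.

Lemma inner_N x (w : 'cV[R[i]]_n) :
  inner w (N x *m w) = (normsq w + x ^+ 3 / 3 * normsq (theta^t* *m w))%:C.
Proof.
rewrite /N mulmxDl mul1mx innerDr innerxx -scalemxAl innerZr /c -mulmxA.
by rewrite inner_mulmx innerxx -rmorphM -rmorphD.
Qed.

Lemma N_unit x : 0 <= x -> N x \in unitmx.
Proof.
move=> x0; apply: unitmx_of_injective => w Nw.
have := inner_N x w; rewrite Nw /inner mulmx0 mxE => /complexI h.
apply: normsq_eq0.
have : 0 <= x ^+ 3 / 3 * normsq (theta^t* *m w).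
  by rewrite mulr_ge0 ?normsq_ge0// divr_ge0// exprn_ge0.
by move: h; clear; lra.
Qed.

Lemma profile_herm x : 0 <= x -> (S x)^t* = S x.
Proof.
move=> x0; rewrite /S !adjointM adjointK mulmxA; congr (_ *m _ *m _).
have : (invmx (N x))^t* *m N x = 1%:M.
  by rewrite -{2}(adj_N x) -adjointM mulmxV ?N_unit// adjoint1.
move=> /(congr1 (mulmxr (invmx (N x)))) /=.
by rewrite mulmxK ?N_unit// mul1mx.
Qed.

Lemma profile_ge0 x (w : 'cV[R[i]]_m) : 0 <= x ->
  0 <= complex.Re (inner w (S x *m w)).
Proof.
move=> x0; pose h := invmx (N x) *m (theta *m w).
have Nh : N x *m h = theta *m w by rewrite /h mulKVmx ?N_unit.
rewrite /profile_mx -!mulmxA inner_mulmx adjointK -/h -Nh.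
rewrite -[N x]adj_N -inner_mulmx inner_N /= addr_ge0 ?normsq_ge0//.
by rewrite mulr_ge0 ?normsq_ge0// divr_ge0// exprn_ge0.
Qed.

Lemma profile0 : S 0 = theta^t* *m theta.
Proof. by rewrite /S /N expr0n mul0r scale0r addr0 invmx1 mulmx1. Qed.

Lemma diff_profile x : 0 <= x ->
  diff_at halfline S x (- (x ^+ 2)%:C *: (S x *m S x)).
Proof.
move=> x0.
have d3 : is_derive x 1 (fun s : R => s ^+ 3 / 3) (x ^+ 2).
  by apply: is_derive_eq; rewrite /GRing.scale /=; field.
have dN : diff_at halfline N x ((x ^+ 2)%:C *: c).
  rewrite -[X in diff_at _ _ _ X]add0r; apply: diff_atD; first exact: diff_at_cst.
  have := diff_atZ_scalar (cdiff_real d3) (diff_at_cst halfline c x).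
  by rewrite scaler0 addr0.
have di := diff_at_invmx (D := halfline) x0 (fun y => @N_unit y) dN.
have := diff_atM (diff_atM (diff_at_cst halfline (theta^t*) x) di) (diff_at_cst _ theta x).
rewrite mul0mx add0r mulmx0 addr0; congr diff_at.
rewrite -scalemxAr -scalemxAl scaleNr mulmxN mulNmx -!scalemxAr -scalemxAl.
by rewrite /S /c !mulmxA.
Qed.

End InitialProfile.

Section InitialSolution.
Context {R : realType} {m : nat}.
Local Notation halfline := [set s : R | 0 <= s].

(* [S] solves [S' = - x^2 S^2] and the potential is [2 x^4 S^2 - 4 x S]; the
   solution is [exp (i k x) (1 - al S) w] with [al = x (1 - i k x) / k^2]. *)
Lemma flux_scalar_identity (A k : R[i]) (x v0 v1 v2 v3 : R) :
  'i * k * x%:C = 1 - A * k ^+ 2 ->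
  complex.Im ('i * k * v0%:C - (A + x%:C ^+ 2) * v1%:C
    + x%:C * A * x%:C ^+ 2 * v2%:C
    - x%:C * A^* * ('i * k * v1%:C - (A + x%:C ^+ 2) * v2%:C
      + x%:C * A * x%:C ^+ 2 * v3%:C)) =
  complex.Re k * v0
    + (complex.Re A ^+ 2 + complex.Im A ^+ 2) * complex.Im (k ^+ 2) * v1.
Proof.
move=> hA.
(* Here [v0] to [v3] stand for the forms of the powers of S at [w]. Regrouping exposes the factor i
   k x that [hA] replaces. Then the coefficients of [v2] and [v3] are real, and that of [v1] is real
   up to |A|^2 k^2. *)
have -> : 'i * k * v0%:C - (A + x%:C ^+ 2) * v1%:C
    + x%:C * A * x%:C ^+ 2 * v2%:C
    - x%:C * A^* * ('i * k * v1%:C - (A + x%:C ^+ 2) * v2%:C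
      + x%:C * A * x%:C ^+ 2 * v3%:C) =
  'i * k * v0%:C - (A + x%:C ^+ 2) * v1%:C
    + x%:C * A * x%:C ^+ 2 * v2%:C
    - A^* * ('i * k * x%:C) * v1%:C
    - x%:C * A^* * (- (A + x%:C ^+ 2) * v2%:C
      + x%:C * A * x%:C ^+ 2 * v3%:C) by ring.
rewrite hA -complexiE; case: A k {hA} => [p q] [a b].
by rewrite !expr2 /=; ring.
Qed.

Section Riccati.
Context (S : R -> 'M[R[i]]_m) (k : R[i]) (w : 'cV[R[i]]_m).
Context (S_herm : forall x, 0 <= x -> (S x)^t* = S x).
Context (S_ge0 : forall x, 0 <= x -> 0 <= complex.Re (inner w (S x *m w))).
Context (S_diff : forall x, 0 <= x ->
  diff_at halfline S x (- (x ^+ 2)%:C *: (S x *m S x))).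
Context (k0 : k != 0).

(** The vectors S^j w are kept abstract, so that the equations below reduce to scalar identities
    between their coefficients. *)
Context (s1 s2 s3 : R -> 'cV[R[i]]_m).
Context (s1E : forall x, S x *m w = s1 x).
Context (s2E : forall x, S x *m s1 x = s2 x).
Context (s3E : forall x, S x *m s2 x = s3 x).

(** [A x * cexp k x] is an antiderivative of [x * cexp k x], the integral that double commutation
    requires. Hence A' = x - i k A, and i k [al] + [al]' simplifies to [ta]. *)
Let A (x : R) : R[i] := (1 - 'i * k * x%:C) / k ^+ 2.
Let al (x : R) : R[i] := x%:C * A x.
Let ta (x : R) : R[i] := A x + x%:C ^+ 2.
Let be (x : R) : R[i] := al x * x%:C ^+ 2.

Definition riccati_solution (x : R) : 'cV[R[i]]_(m + m) := cexp k x *: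
  col_mx (w - al x *: s1 x) (('i * k) *: w - ta x *: s1 x + be x *: s2 x).

Let ds1 x : 0 <= x -> diff_at halfline s1 x (- x%:C ^+ 2 *: s2 x).
Proof.
move=> x0; rewrite (_ : s1 = fun y => S y *m w); last first.
  by apply/funext => y; rewrite s1E.
apply: diff_at_eq (diff_atM (S_diff x0) (diff_at_cst _ w x)) _.
by rewrite mulmx0 addr0 -scalemxAl -mulmxA s1E s2E rmorphXn.
Qed.

Let ds2 x : 0 <= x -> diff_at halfline s2 x (- (2 * x%:C ^+ 2) *: s3 x).
Proof.
move=> x0; rewrite (_ : s2 = fun y => S y *m s1 y); last first.
  by apply/funext => y; rewrite s2E.
apply: diff_at_eq (diff_atM (S_diff x0) (ds1 x0)) _.
rewrite -scalemxAl -mulmxA -scalemxAr s2E s3E rmorphXn /=.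
by rewrite -scalerDl; congr (_ *: _); ring.
Qed.

Let dA x : cdiff_at A x (- ('i * k) / k ^+ 2).
Proof.
have h1 := cdiffM (cdiff_cst ('i * k) x) (cdiff_id x).
have h2 := cdiffD (cdiff_cst 1 x) (cdiffM (cdiff_cst (-1) x) h1).
have := cdiffM h2 (cdiff_cst ((k ^+ 2)^-1) x).
rewrite (_ : (fun s => _) = A); last by apply/funext => s; rewrite mulN1r.
by move/cdiff_eq; apply; ring.
Qed.

Let dal x : cdiff_at al x (A x - x%:C * 'i * k / k ^+ 2).
Proof.
have := cdiffM (cdiff_id x) (dA x).
by move/cdiff_eq; apply; ring.
Qed.

Let dsq (x : R) : cdiff_at (fun s : R => s%:C ^+ 2) x (2 * x%:C).
Proof.
have := @cdiffM R _ _ x _ _ (cdiff_id x) (cdiff_id x).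
by move/cdiff_eq; apply; ring.
Qed.

Let dta x : cdiff_at ta x (- ('i * k) / k ^+ 2 + 2 * x%:C).
Proof. exact: cdiffD (dA x) (dsq x). Qed.

Let dbe x : cdiff_at be x ((A x - x%:C * 'i * k / k ^+ 2) * x%:C ^+ 2
  + al x * (2 * x%:C)).
Proof. exact: cdiffM (dal x) (dsq x). Qed.

Let i2 : 'i * 'i = -1 :> R[i].
Proof. by rewrite -expr2 sqrCi. Qed.

Lemma riccati_solution_diff x : 0 <= x ->
  diff_at halfline riccati_solution x
    (Gmx ((2 * x ^+ 4)%:C *: (S x *m S x) - (4 * x)%:C *: S x) (k ^+ 2)
      *m riccati_solution x).
Proof.
move=> x0.
have d1 := diff_atD (diff_at_cst halfline w x)
  (diff_atN (diff_atZ_scalar (dal x) (ds1 x0))).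
have d2 := diff_atD (diff_atD (diff_at_cst halfline (('i * k) *: w) x)
  (diff_atN (diff_atZ_scalar (dta x) (ds1 x0))))
  (diff_atZ_scalar (dbe x) (ds2 x0)).
apply: diff_at_eq (diff_atZ_scalar (cdiff_cexp k x) (diff_at_col d1 d2)) _.
rewrite Gmx_mul /riccati_solution !scale_col_mx add_col_mx !(col_mxKu, col_mxKd).
rewrite !(mulmxBl, mulmxDl, mul_scalar_mx) -!scalemxAl -!scalemxAr !mulmxBr
  -!scalemxAr -!mulmxA.
rewrite !(s1E, s2E, s3E).
move: (s1 x) (s2 x) (s3 x) (cexp k x) => a b c E.
rewrite /be /ta /al /A; congr col_mx; apply/matrixP => i j; rewrite !mxE.
  by field: i2.
by field: i2.
Qed.

Lemma riccati_flux_ge0 x : 0 <= x -> 0 < complex.Re k -> 0 < complex.Im k ->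
  0 <= flux (riccati_solution x).
Proof.
move=> x0 ka kb; rewrite /flux /riccati_solution scale_col_mx col_mxKu col_mxKd.
rewrite innerZl innerZr mulrA [_^* * _]mulrC -normCK -add_Re2_Im2 cImM /= mul0r addr0.
apply: mulr_ge0; first by rewrite addr_ge0 ?sqr_ge0.
have Sh := S_herm x0.
have r1 a b : inner (S x *m a) b = inner a (S x *m b) by rewrite inner_mulmx Sh.
have real_form a : inner a (S x *m a) = (complex.Re (inner a (S x *m a)))%:C.
  by move: (Im_inner_herm a (esym Sh)); case: (inner _ _) => r i /= ->.
have V1 := real_form w; have V3 := real_form (s1 x).
rewrite s1E in V1; rewrite s2E in V3.
have V2 : inner w (s2 x) = (normsq (s1 x))%:C by rewrite -s2E -r1 s1E innerxx.
have V1' : inner (s1 x) w = (complex.Re (inner w (s1 x)))%:C.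
  by rewrite -{1}s1E r1 s1E.
have V2' := innerxx (s1 x).
have hA : 'i * k * x%:C = 1 - A x * k ^+ 2.
  by rewrite /A divfK ?expf_neq0// subKr.
have -> : inner (w - al x *: s1 x)
    (('i * k) *: w - ta x *: s1 x + be x *: s2 x) =
  'i * k * (normsq w)%:C - (A x + x%:C ^+ 2) * (complex.Re (inner w (s1 x)))%:C
    + x%:C * A x * x%:C ^+ 2 * (normsq (s1 x))%:C
    - x%:C * (A x)^* * ('i * k * (complex.Re (inner w (s1 x)))%:C
      - (A x + x%:C ^+ 2) * (normsq (s1 x))%:C
      + x%:C * A x * x%:C ^+ 2 * (complex.Re (inner (s1 x) (s2 x)))%:C).
  rewrite innerDl innerNl innerZl !innerDr !innerNr !innerZr V1 V1' V2 V2' V3.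
  have -> : (al x)^* = x%:C * (A x)^*.
    by rewrite /al rmorphM; congr (_ * _); exact: conjC_real.
  by rewrite (innerxx w) /be /ta /al; ring.
rewrite flux_scalar_identity// addr_ge0//.
  by rewrite mulr_ge0 ?normsq_ge0// ltW.
apply: mulr_ge0; last by have := S_ge0 x0; rewrite s1E.
apply: mulr_ge0; first by rewrite addr_ge0 ?sqr_ge0.
by rewrite expr2 cImM; rewrite addr_ge0// mulr_ge0// ltW.
Qed.

Lemma riccati_solution0 :
  riccati_solution 0 = col_mx w (('i * k) *: w - k ^- 2 *: s1 0).
Proof.
have c0 : (0 : R)%:C = 0 by [].
have al0 : al 0 = 0 by rewrite /al c0 mul0r.
have ta0 : ta 0 = k ^- 2 by rewrite /ta /A c0 mulr0 subr0 mul1r expr0n addr0.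
rewrite /riccati_solution cexp0 scale1r /be al0 ta0 mul0r !scale0r subr0.
by rewrite addr0.
Qed.

End Riccati.

Lemma initial_solution n (theta : 'M[R[i]]_(n, m)) (k : R[i]) (w : 'cV[R[i]]_m) :
  0 < complex.Re k -> 0 < complex.Im k ->
  exists y : R -> 'cV[R[i]]_(m + m),
    [/\ y 0 = col_mx w (('i * k) *: w - k ^- 2 *: (theta^t* *m theta *m w)),
     forall x, 0 <= x -> diff_at halfline y x
       (Gmx (initial_profile theta x) (k ^+ 2) *m y x) &
     forall x, 0 <= x -> 0 <= flux (y x)].
Proof.
move=> ka kb; have k0 : k != 0 by apply: contraTneq ka => ->; rewrite ltxx.
pose S := profile_mx theta.
pose s1 x := S x *m w; pose s2 x := S x *m s1 x; pose s3 x := S x *m s2 x.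
exists (riccati_solution k w s1 s2); split=> [|x x0|x x0].
- by rewrite riccati_solution0 /s1 /S profile0.
- rewrite initial_profileE.
  exact: (@riccati_solution_diff S k w (@diff_profile _ _ _ theta) k0 s1 s2 s3).
- exact: (@riccati_flux_ge0 S k w (@profile_herm _ _ _ theta)
    (fun x => @profile_ge0 _ _ _ theta x w) k0 s1 s2).
Qed.

End InitialSolution.

(** * Evolution in time of the flux and of the boundary form *)

Section Blocks.
Context {R : realType}.

Lemma diff_at_row (p q r : nat) D (f : R -> 'M[R[i]]_(r, p))
    (g : R -> 'M[R[i]]_(r, q)) x l k :
  diff_at D f x l -> diff_at D g x k ->
  diff_at D (fun y => row_mx (f y) (g y)) x (row_mx l k).
Proof.
move=> fl gk; apply: (@diff_at_le _ _ _ _ _ _ _ 2) => e e0; near=> y.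
rewrite scale_row_mx !opp_row_mx !add_row_mx l1norm_row.
rewrite -mulrA mulr2n mulrDl mul1r lerD//.
  by near: y; exact: fl.
by near: y; exact: gk.
Unshelve. all: by end_near. Qed.

Lemma diff_at_block (p q r s : nat) D (f1 : R -> 'M[R[i]]_(p, r))
    (f2 : R -> 'M[R[i]]_(p, s)) (f3 : R -> 'M[R[i]]_(q, r))
    (f4 : R -> 'M[R[i]]_(q, s)) x l1 l2 l3 l4 :
  diff_at D f1 x l1 -> diff_at D f2 x l2 -> diff_at D f3 x l3 ->
  diff_at D f4 x l4 ->
  diff_at D (fun y => block_mx (f1 y) (f2 y) (f3 y) (f4 y)) x
    (block_mx l1 l2 l3 l4).
Proof. by move=> h1 h2 h3 h4; apply: diff_at_col; apply: diff_at_row. Qed.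

Lemma l1norm_block (p q r s : nat) (A : 'M[R[i]]_(p, r)) (B : 'M[R[i]]_(p, s))
    (C : 'M[R[i]]_(q, r)) (E : 'M[R[i]]_(q, s)) :
  l1norm (block_mx A B C E) = l1norm A + l1norm B + (l1norm C + l1norm E).
Proof. by rewrite /block_mx l1norm_col !l1norm_row. Qed.

Lemma l1norm_sq_le n (a : 'cV[R[i]]_n) :
  l1norm a ^+ 2 <= n%:R ^+ 2 * (2 * normsq a).
Proof.
pose s := Num.sqrt (2 * normsq a).
have n0 : 0 <= 2 * normsq a by rewrite mulr_ge0 ?normsq_ge0.
have h : l1norm a <= n%:R * s.
  rewrite -[n in n%:R]muln1; apply: l1norm_const => i j; rewrite ord1.
  rewrite -[l1c _]ger0_norm ?l1c_ge0// -sqrtr_sqr ler_wsqrtr//.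
  have hi : complex.Re (a i 0) ^+ 2 + complex.Im (a i 0) ^+ 2 <= normsq a.
    rewrite normsqE (bigD1 i)//= lerDl sumr_ge0// => k _.
    by rewrite addr_ge0 ?sqr_ge0.
  apply: le_trans (ler_wpM2l _ hi) => //; rewrite /l1c.
  case: (a i 0) => x y /=; rewrite -[x ^+ 2]real_normK ?num_real//.
  rewrite -[y ^+ 2]real_normK ?num_real//.
  by have := sqr_ge0 (`|x| - `|y|); rewrite sqrrB sqrrD; clear; lra.
rewrite -[2 * normsq a]sqr_sqrtr// -exprMn -/s.
by rewrite ler_pXn2r// nnegrE ?l1norm_ge0// mulr_ge0// sqrtr_ge0.
Qed.

Lemma l1c_inner_le n (a b : 'cV[R[i]]_n) : l1c (inner a b) <= l1norm a * l1norm b.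
Proof.
apply: le_trans (l1norm_entry (a^t* *m b) 0 0) _.
by apply: le_trans (l1normM _ _) _; rewrite l1norm_adj.
Qed.

Lemma Re_inner_mul_le n (A : 'M[R[i]]_n) (a : 'cV[R[i]]_n) :
  complex.Re (inner a (A *m a)) <= l1norm A * (n%:R ^+ 2 * 2) * normsq a.
Proof.
apply: le_trans (ler_norm _) _.
apply: (@le_trans _ _ (l1c (inner a (A *m a)))); first by rewrite lerDl.
apply: le_trans (l1c_inner_le _ _) _.
apply: le_trans (ler_wpM2l (l1norm_ge0 _) (l1normM _ _)) _.
rewrite mulrCA -mulrA ler_wpM2l ?l1norm_ge0// -expr2 -mulrA.
exact: l1norm_sq_le.
Qed.

End Blocks.

Section Evolution.
Context {R : realType} {m : nat}.
Local Notation halfline := [set s : R | 0 <= s].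

Lemma l1norm_bounded (u : R -> R -> 'M[R[i]]_m) :
  [bounded u a.1 a.2 | a in quarter_plane] ->
  exists C, forall x t, 0 <= x -> 0 <= t -> l1norm (u x t) <= C.
Proof.
move=> [M [Mr H]]; have ME : M = (complex.Re M)%:C by rewrite RRe_real.
pose r := complex.Re M.
have M1 : M < (r + 1)%:C by rewrite ME ltcR -/r; lra.
exists ((m * m)%:R * (2 * (r + 2))) => x t x0 t0; apply: l1norm_const => i j.
apply: l1c_le_normc; apply: ltW.
have h : `|u x t| < (r + 2)%:C.
  by apply: le_lt_trans (H _ M1 (x, t) (conj x0 t0)) _; rewrite ltcR; lra.
have : ball (0 : 'M[R[i]]_m) ((r + 2)%:C) (u x t).
  by rewrite mx_norm_ball /ball_ /= sub0r normrN.
move=> [_ /(_ i j)].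
by rewrite mxE -ball_normE /ball_ /= sub0r normrN.
Qed.

Lemma Fmx_mul (v vx vxx : 'M[R[i]]_m) z (y : 'cV[R[i]]_(m + m)) :
  Fmx v vx vxx z *m y = col_mx
    (vx *m usubmx y - (2 *: (v + (2 * z)%:M)) *m dsubmx y)
    ((vxx - 2 *: ((v + (2 * z)%:M) *m (v - z%:M))) *m usubmx y - vx *m dsubmx y).
Proof. by rewrite -{1}(vsubmxK y) /Fmx mul_block_col !mulNmx. Qed.

(** The two occurrences of [vx] cancel because it is Hermitian, while [vxx] and the square of [v]
    contribute real numbers. What remains involves [v] without derivatives, so the bound on [u]
    alone controls it. *)
Lemma Im_flux_F (v vx vxx : 'M[R[i]]_m) z (y : 'cV[R[i]]_(m + m)) :
  v^t* = v -> vx^t* = vx -> vxx^t* = vxx ->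
  complex.Im (flux_form (Fmx v vx vxx z *m y) y 0 0) = 4 * complex.Im z * normsq (dsubmx y)
    + complex.Im z * (8 * complex.Re z * normsq (usubmx y)
        - 2 * complex.Re (inner (usubmx y) (v *m usubmx y))).
Proof.
move=> vh vxh vxxh; rewrite Im_flux_form Fmx_mul col_mxKu col_mxKd.
move: (usubmx y) (dsubmx y) => a b.
have herm (A : 'M[R[i]]_m) c d : A^t* = A -> inner (A *m c) d = inner c (A *m d).
  by move=> AE; rewrite inner_mulmx AE.
have -> : (2 *: (v + (2 * z)%:M)) *m b = 2 *: (v *m b) + (4 * z) *: b.
  rewrite -scalemxAl mulmxDl mul_scalar_mx scalerDr scalerA mulrA -natrM.
  by [].
have -> : (vxx - 2 *: ((v + (2 * z)%:M) *m (v - z%:M))) *m a = vxx *m a -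
    2 *: (v *m (v *m a) + z *: (v *m a) - (2 * z ^+ 2) *: a).
  rewrite mulmxBl -scalemxAl -mulmxA; congr (_ - _ *: _).
  rewrite mulmxBl mul_scalar_mx mulmxDl mulmxBr -scalemxAr mul_scalar_mx.
  by move: (v *m (v *m a)) (v *m a) => c d; apply/matrixP => i j; rewrite !mxE; ring.
rewrite !(innerDl, innerDr, innerNl, innerNr, innerZl, innerZr).
rewrite (herm vx)// [inner a (v *m (v *m a))]inner_mulmx vh !innerxx.
have hv c : inner c (v *m c) = (complex.Re (inner c (v *m c)))%:C.
  by move: (Im_inner_herm c (esym vh)); case: (inner _ _) => x w /= ->.
have hvxx : inner a (vxx *m a) = (complex.Re (inner a (vxx *m a)))%:C.
  by move: (Im_inner_herm a (esym vxxh)); case: (inner _ _) => x w /= ->.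
rewrite (herm v)// (hv b) (hv a) hvxx.
rewrite rmorphM !rmorph_nat /=.
move: (complex.Re _) (complex.Re _) (complex.Re _) (inner a _) (normsq _) (normsq _)
  (normsq _) => p q s [e f] n1 n2 n3.
case: z => za zb; rewrite expr2 /=.
by ring.
Qed.

End Evolution.

Section Slanted.
Context {R : realType}.
Local Notation halfline := [set s : R | 0 <= s].

(** A chain rule without joint differentiability. The expansion in time is uniform in [x], so it may
    be used at the moving point; the derivative in [x] is then needed only at the fixed time
    [t0]. *)
Lemma slanted_diff p q (y Fy : R -> R -> 'M[R[i]]_(p, q)) (Gy : 'M[R[i]]_(p, q))
    (T L C t0 : R) : 0 <= L -> 0 <= C -> 0 <= t0 <= T ->
  (forall X e, 0 <= X -> 0 < e ->
    \forall t \near within `[0, T] (nbhs t0), forall x, 0 <= x <= X ->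
      l1norm (y x t - y x t0 - (t - t0)%:C *: Fy x t0) <= e * `|t - t0|) ->
  cont_at halfline (Fy ^~ t0) (L + C * (T - t0)) ->
  diff_at halfline (y ^~ t0) (L + C * (T - t0)) Gy ->
  diff_at `[0, T] (fun t => y (L + C * (T - t)) t) t0
    (Fy (L + C * (T - t0)) t0 + (- C)%:C *: Gy).
Proof.
move=> L0 C0 t0T Hy Fc Gd; pose x t := L + C * (T - t).
have x_ge0 t : 0 <= t <= T -> 0 <= x t.
  by move=> /andP[_ tT]; rewrite addr_ge0// mulr_ge0// subr_ge0.
have T0 : 0 <= T by case/andP: t0T => h1 h2; exact: le_trans h2.
have x_le t : 0 <= t <= T -> x t <= L + C * T.
  by move=> /andP[t_ge0 _]; rewrite lerD2l ler_wpM2l// lerBlDr lerDl.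
have pull (P : set R) : (\forall s \near within halfline (nbhs (x t0)), P s) ->
    \forall t \near within `[0, T] (nbhs t0), P (x t).
  rewrite !near_withinE => /nbhs_ballP[d /= d0 H].
  have C1 : 0 < C + 1 by rewrite ltr_wpDl.
  apply/nbhs_ballP; exists (d / (C + 1)); first by rewrite /= divr_gt0.
  move=> t; rewrite /ball /= => td; rewrite in_itv/= => tT; apply: H; last exact: x_ge0.
  rewrite /ball /= /x (_ : _ - _ = C * (t - t0)); last by ring.
  rewrite normrM ger0_norm// distrC.
  rewrite ltr_pdivlMr// in td; apply: le_lt_trans td.
  by rewrite mulrC ler_wpM2l// lerDl.
apply: (@diff_at_le _ _ _ _ _ _ _ (2 + C)) => e e0.
have X0 : 0 <= L + C * T by rewrite addr_ge0// mulr_ge0.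
apply/within_itv; apply: filterS3 (Hy _ e X0 e0) (pull _ (Fc e e0)) (pull _ (Gd e e0)).
move=> t h1 h2 h3 tT.
have -> : y (L + C * (T - t)) t - y (L + C * (T - t0)) t0 -
    (t - t0)%:C *: (Fy (L + C * (T - t0)) t0 + (- C)%:C *: Gy) =
  (y (x t) t - y (x t) t0 - (t - t0)%:C *: Fy (x t) t0) +
  ((t - t0)%:C *: (Fy (x t) t0 - Fy (x t0) t0) +
   (y (x t) t0 - y (x t0) t0 - (x t - x t0)%:C *: Gy)).
  have -> : (x t - x t0)%:C = (t - t0)%:C * (- C)%:C.
    by rewrite -rmorphM; congr (_%:C); rewrite /x; ring.
  rewrite -/(x t) -/(x t0); apply/matrixP => i j; rewrite !mxE; ring.
have xx : `|x t - x t0| = C * `|t - t0|.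
  rewrite -[in RHS](ger0_norm C0) -normrM distrC; congr `|_|; rewrite /x; ring.
apply: le_trans (l1normD _ _) _.
apply: le_trans (lerD (h1 (x t) _) (l1normD _ _)) _.
  by rewrite x_ge0// x_le.
rewrite l1normZ; rewrite xx in h3.
have h2' : `|t - t0| * l1norm (Fy (x t) t0 - Fy (x t0) t0) <= `|t - t0| * e.
  by rewrite ler_wpM2l.
apply: le_trans (lerD (lexx _) (lerD h2' h3)) _.
by rewrite le_eqVlt; apply/orP; left; apply/eqP; ring.
Qed.

End Slanted.

Section Uniqueness.
Context {R : realType}.
Local Notation halfline := [set s : R | 0 <= s].

Lemma ode_unique p q (A : R -> 'M[R[i]]_p) (f g : R -> 'M[R[i]]_(p, q)) K : 0 < K ->
  (forall x, 0 <= x -> l1norm (A x) <= K) ->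
  (forall x, 0 <= x -> diff_at halfline f x (A x *m f x)) ->
  (forall x, 0 <= x -> diff_at halfline g x (A x *m g x)) ->
  f 0 = g 0 -> forall x, 0 <= x -> f x = g x.
Proof.
move=> K0 AK fd gd fg0 x x0; apply/eqP; rewrite -subr_eq0; apply/eqP.
apply: l1norm_eq0.
have := @gronwall R p q (fun s => f s - g s) (fun s => A s *m f s - A s *m g s)
  K 0 x x0 K0 (lexx 0) _ _ x _.
rewrite fg0 subrr l1norm0 mul0r addr0 mulr0 mul0r; apply.
- move=> s /andP[s0 _]; apply: diff_at_sub (@itv_halfline R x) _.
  by apply: diff_atD; [exact: fd|apply: diff_atN; exact: gd].
- move=> s /andP[s0 _]; rewrite -mulmxBr addr0; apply: le_trans (l1normM _ _) _.
  by rewrite ler_wpM2r ?l1norm_ge0// AK.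
- by rewrite x0 lexx.
Qed.

End Uniqueness.

Section KdVEvolution.
Context {R : realType} {m : nat}.
Local Notation halfline := [set s : R | 0 <= s].
Context (u : R -> R -> 'M[R[i]]_m) (Cu : R).
Context (u_herm : forall x t, 0 <= x -> 0 <= t -> u x t = (u x t)^t*).
Context (u_kdv : forall x t, 0 <= x -> 0 <= t ->
  dt u x t + 3 *: (u x t *m dx u x t + dx u x t *m u x t)
  - dx (dx (dx u)) x t = 0).
Context (u_bounded : forall x t, 0 <= x -> 0 <= t -> l1norm (u x t) <= Cu).
Context (G_C1 : quarter_C1 (fun x t => Gmx (u x t) 0)).
Context (F_C1 :
  quarter_C1 (fun x t => Fmx (u x t) (dx u x t) (dx (dx u) x t) 0)).
Context (u_bc : forall t, 0 <= t -> u 0 t = 0 /\ dx (dx u) 0 t = 0).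
Context (Psi : R -> R[i] -> R -> 'M[R[i]]_(m + m)).
Context (Psi_sol : forall t, 0 <= t ->
  forall z, fundamental_solution (u ^~ t) z (Psi t z)).

Local Notation G z x t := (Gmx (u x t) z).
Local Notation F z x t := (Fmx (u x t) (dx u x t) (dx (dx u) x t) z).

Lemma dx_herm (g : R -> R -> 'M[R[i]]_m) x t :
  (forall x t, 0 <= x -> 0 <= t -> g x t = (g x t)^t*) ->
  0 <= x -> 0 <= t -> diff_at halfline (g ^~ t) x (dx g x t) ->
  dx g x t = (dx g x t)^t*.
Proof.
move=> gh x0 t0 gd; apply: (half_deriveE x0).
apply: (diff_at_ext (D := halfline) x0 _ (diff_at_adj gd)) => y /= y0.
by rewrite -gh.
Qed.

Lemma ux_herm x t : 0 <= x -> 0 <= t -> dx u x t = (dx u x t)^t*.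
Proof. by move=> x0 t0; apply: dx_herm => //; exact: diff_u_x. Qed.

Lemma uxx_herm x t : 0 <= x -> 0 <= t -> dx (dx u) x t = (dx (dx u) x t)^t*.
Proof.
move=> x0 t0; apply: dx_herm => //; first exact: ux_herm.
exact: (diff_ux_x F_C1).
Qed.

(** At the boundary [t] enters only through u_x(0, t), so continuity of this one function gives a
    continuous coefficient for the time equation. *)
Lemma Fmx_boundary z t : 0 <= t -> F z 0 t =
  block_mx 0 (- (2 *: (2 * z)%:M)) (2 *: ((2 * z)%:M *m z%:M)) 0
  + block_mx (dx u 0 t) 0 0 (- dx u 0 t).
Proof.
move=> t0; have [-> ->] := u_bc t0.
by rewrite /Fmx add_block_mx !add0r !addr0 mulmxN scalerN opprK.
Qed.

Lemma boundary_solution z T (w : 'cV[R[i]]_(m + m)) : 0 <= T ->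
  exists Y : R -> 'cV[R[i]]_(m + m), Y 0 = w /\
    forall t, 0 <= t <= T -> diff_at `[0, T] Y t (F z 0 t *m Y t).
Proof.
move=> T0; apply: linear_ode T0 _ => t /andP[t0 tT] e e0.
have e20 : 0 < e / 2 by rewrite divr_gt0.
have := cont_at_sub (@itv_halfline R T) (cont_ux_t F_C1 (lexx 0) t0) e20.
move=> h; apply/within_itv; apply: filterS h => s h /andP[s0 _].
rewrite !Fmx_boundary// opprD addrACA subrr add0r opp_block_mx add_block_mx.
rewrite !oppr0 !addr0 l1norm_block !l1norm0 addr0 add0r -opprD l1normN.
by move: h; lra.
Qed.

Lemma Gmx_bounded z : exists2 K, 0 < K &
  forall x t, 0 <= x -> 0 <= t -> l1norm (G z x t) <= K.
Proof.
pose c := l1norm (1%:M : 'M[R[i]]_m) + l1norm (z%:M : 'M[R[i]]_m).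
have c0 : 0 <= c by rewrite addr_ge0 ?l1norm_ge0.
exists (c + `|Cu| + 1) => [|x t x0 t0]; first by rewrite ltr_wpDl// addr_ge0.
rewrite /Gmx l1norm_block !l1norm0 add0r addr0.
have := l1normB (u x t) z%:M; have := u_bounded x0 t0; have := ler_norm Cu.
rewrite /c; lra.
Qed.

Lemma Fmx_diff z x t : 0 <= x -> 0 <= t ->
  diff_at halfline (fun x => F z x t) x
    (block_mx (dx (dx u) x t) (- (2 *: dx u x t))
      (dx (dx (dx u)) x t - 2 *: (dx u x t *m (u x t - z%:M) +
         (u x t + (2 * z)%:M) *m dx u x t)) (- dx (dx u) x t)).
Proof.
move=> x0 t0.
have dux := diff_ux_x F_C1 x0 t0; have duxx := diff_uxx_x G_C1 F_C1 x0 t0.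
have du c : diff_at halfline (fun x => u x t + c) x (dx u x t).
  rewrite -[X in diff_at _ _ _ X]addr0.
  by apply: diff_atD; [exact: diff_u_x|exact: diff_at_cst].
apply: diff_at_block.
- exact: dux.
- by apply: diff_atN; apply: diff_atZ; exact: du.
- apply: diff_atD; first exact: duxx.
  by apply: diff_atN; apply: diff_atZ; apply: diff_atM; exact: du.
- exact: diff_atN dux.
Qed.

Lemma evolution z T (Y : R -> 'cV[R[i]]_(m + m)) :
  (forall t, 0 <= t <= T -> diff_at `[0, T] Y t (F z 0 t *m Y t)) ->
  forall X t0 e, 0 <= X -> 0 <= t0 <= T -> 0 < e ->
    \forall t \near within `[0, T] (nbhs t0), forall x, 0 <= x <= X ->
      l1norm (Psi t z x *m Y t - Psi t0 z x *m Y t0 -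
        (t - t0)%:C *: (F z x t0 *m (Psi t0 z x *m Y t0))) <= e * `|t - t0|.
Proof.
move=> Yd; have [K K0 GK] := Gmx_bounded z.
pose GT x t : 'M[R[i]]_(m + m) := block_mx 0 0 (dt u x t) 0.
pose FX x t : 'M[R[i]]_(m + m) := block_mx (dx (dx u) x t) (- (2 *: dx u x t))
  (dx (dx (dx u)) x t - 2 *: (dx u x t *m (u x t - z%:M) +
     (u x t + (2 * z)%:M) *m dx u x t)) (- dx (dx u) x t).
apply: (@flat_connection R _ _ (fun x t => G z x t) (fun x t => F z x t) GT FX
  (fun x t => Psi t z x *m Y t) T K K0) => [x t x0|x t x0|X t0 e X0|X t0 X0|x t x0|x t x0|t].
- by move=> /andP[t0 _]; exact: Fmx_diff.
- by move=> /andP[t0 _]; exact: GK.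
- move=> /andP[t00 _] e0.
  have := uniform_quotient X (joint_cont_dt G_C1)
    (fun x s x0 s0 => diff_u_t G_C1 x0 s0) t00 e0.
  rewrite !near_withinE; apply: filterS => t h /itv_halfline ht x xX.
  apply: le_trans (h ht x xX).
  rewrite /Gmx /GT opp_block_mx add_block_mx scale_block_mx opp_block_mx add_block_mx.
  rewrite !scaler0 !oppr0 !subrr !addr0 l1norm_block !l1norm0 !addr0 !add0r.
  by rewrite opprB addrA subrK.
- move=> /andP[t00 _].
  have [B BE] := joint_cont_bounded (joint_cont_dt G_C1) X0 t00.
  exists B => x xX; rewrite /GT l1norm_block !l1norm0 !add0r addr0.
  exact: BE.
- by move=> /andP[t0 _]; apply: zero_curvature; exact: u_kdv.
- by move=> /andP[t0 _]; exact: (solution_diff (Psi_sol t0)).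
- move=> tT; have -> : (fun t => Psi t z 0 *m Y t) t = Y t.
    by case/andP: tT => t0 _; rewrite (Psi_sol t0 z).1 mul1mx.
  apply: diff_at_ext (Yd t tT); first by rewrite /= in_itv.
  by move=> s /itv_halfline s0; rewrite (Psi_sol s0 z).1 mul1mx.
Qed.

Lemma flux_form_linear (l1 l2 y : 'cV[R[i]]_(m + m)) (a : R) :
  flux_form (l1 + a%:C *: l2) y = flux_form l1 y + a%:C *: flux_form l2 y.
Proof.
rewrite /flux_form.
have -> : usubmx (l1 + a%:C *: l2) = usubmx l1 + a%:C *: usubmx l2.
  by apply/matrixP => i j; rewrite !mxE.
have -> : dsubmx (l1 + a%:C *: l2) = dsubmx l1 + a%:C *: dsubmx l2.
  by apply/matrixP => i j; rewrite !mxE.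
rewrite adjointD adjointZ conjC_real mulmxDl mulmxDr -scalemxAl -scalemxAr scalerDr.
by rewrite addrACA.
Qed.

Lemma Im_entry_add (A B : 'M[R[i]]_1) (a : R) :
  complex.Im ((A + a%:C *: B) 0 0) =
  complex.Im (A 0 0) + a * complex.Im (B 0 0).
Proof.
have -> : (A + a%:C *: B) 0 0 = A 0 0 + a%:C * B 0 0 by rewrite !mxE.
by rewrite cImD cImM /= mul0r addr0.
Qed.

Lemma real_functional_ImN :
  real_functional (fun A : 'M[R[i]]_1 => - complex.Im (A 0 0)).
Proof.
have [h1 h2 [c h3]] := @real_functional_Im R; split=> [A B|a A|].
- by rewrite h1; ring.
- by rewrite h2 mulrN.
- by exists c => A; rewrite normrN.
Qed.

(* The flux is nondecreasing in time along the lines [x + C t = const] as soon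
   as [C] dominates the potential. *)
Lemma flux_propagation z T (Y : R -> 'cV[R[i]]_(m + m)) : 0 <= T ->
  0 < complex.Im z ->
  (forall t, 0 <= t <= T -> diff_at `[0, T] Y t (F z 0 t *m Y t)) ->
  (forall x, 0 <= x -> 0 <= flux (Psi 0 z x *m Y 0)) ->
  forall L, 0 <= L -> 0 <= flux (Psi T z L *m Y T).
Proof.
move=> T0 z0 Yd f0 L L0.
(* Moving left at speed [C] adds C Im z |y1|^2 to the derivative of the flux. The two terms of [C]
   dominate the form of [u], by [Re_inner_mul_le], and the contribution of Re z. The line ends at
   (L, T) and starts at [L + C * T], hence stays in the quarter-plane. *)
pose C := 4 * `|Cu| * m%:R ^+ 2 + 8 * `|complex.Re z|.
have C0 : 0 <= C by rewrite addr_ge0// !mulr_ge0// exprn_ge0.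
pose x t := L + C * (T - t).
pose g t := Psi t z (x t) *m Y t.
have gd t : 0 <= t <= T -> diff_at `[0, T] g t
    (F z (x t) t *m g t + (- C)%:C *: (G z (x t) t *m g t)).
  move=> tT; have [t0 tT'] := andP tT.
  have x0 : 0 <= x t by rewrite addr_ge0// mulr_ge0// subr_ge0.
  have yd := solution_diff (Psi_sol t0) z (Y t) x0.
  apply: (@slanted_diff R _ _ (fun x t => Psi t z x *m Y t)
    (fun x t => F z x t *m (Psi t z x *m Y t)) _ T L C t L0 C0 tT).
  - by move=> X e X0 e0; exact: evolution.
  - exact: diff_at_cont (diff_atM (Fmx_diff z x0 t0) yd).
  - exact: yd.
have h : - flux (g T) - - flux (g 0) <= 0 - 0.
  apply: (@mean_value_functional R _ _ _ (fun t => flux_mx (g t)) _ (fun=> 0)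
    (fun=> 0) 0 T T0 real_functional_ImN (fun t tT => diff_flux_mx (gd t tT))
    (fun s => is_derive_cst _ _ _)) => t /andP[t0 tT].
  have x0 : 0 <= x t by rewrite addr_ge0// mulr_ge0// subr_ge0.
  have uh := u_herm x0 t0.
  rewrite flux_form_linear.
  rewrite Im_entry_add.
  rewrite (Im_flux_F _ _ (esym uh) (esym (ux_herm x0 t0)) (esym (uxx_herm x0 t0))).
  rewrite (Im_flux_G _ _ uh).
  move: (usubmx (g t)) (dsubmx (g t)) => a b.
  have h1 := Re_inner_mul_le (u (x t) t) a.
  have na := normsq_ge0 a; have nb := normsq_ge0 b.
  have h2 : l1norm (u (x t) t) * (m%:R ^+ 2 * 2) * normsq a <=
      `|Cu| * (m%:R ^+ 2 * 2) * normsq a.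
    rewrite ler_wpM2r// ler_wpM2r ?mulr_ge0 ?exprn_ge0//.
    exact: le_trans (u_bounded x0 t0) (ler_norm _).
  have h3 : - (`|complex.Re z| * normsq a) <= complex.Re z * normsq a.
    by rewrite -mulNr ler_wpM2r// lerNl -normrN ler_norm.
  have h4 : 0 <= complex.Im z * (8 * complex.Re z * normsq a
      - 2 * complex.Re (inner a (u (x t) t *m a)) + C * normsq a).
    rewrite mulr_ge0 ?(ltW z0)// /C.
    move: h1 h2 h3; rewrite -/(normsq a).
    move: (complex.Re (inner a _)) (l1norm _ * _ * _) => v w h1 h2 h3.
    lra.
  have h5 : 0 <= complex.Im z * normsq b by rewrite mulr_ge0// ltW.
  rewrite oppr_le0; lra.
have x_T : x T = L by rewrite /x subrr mulr0 addr0.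
have x_0 : x 0 = L + C * T by rewrite /x subr0.
have g_T : g T = Psi T z L *m Y T by rewrite /g x_T.
have g_0 : g 0 = Psi 0 z (L + C * T) *m Y 0 by rewrite /g x_0.
rewrite -g_T; apply: (@le_trans _ _ (flux (g 0))).
  by rewrite g_0; apply: f0; rewrite addr_ge0// mulr_ge0.
by move: h; rewrite opprK addrC subrr subr_le0.
Qed.

(** The inner product of y1 and y2 has derivative 4 k^4 |y1|^2 minus 4 conj(k)^2 |y2|^2, the terms
    in u_x cancelling. The factor conj(k) turns the coefficients into 4 |k|^2 k^3 and - 4 conj(k)^3,
    whose imaginary parts are both nonnegative multiples of Im (k^3). *)
Lemma boundary_form_nonincreasing k T (Y : R -> 'cV[R[i]]_(m + m)) : 0 <= T ->
  complex.Im (k ^+ 3) <= 0 ->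
  (forall t, 0 <= t <= T -> diff_at `[0, T] Y t (F (k ^+ 2) 0 t *m Y t)) ->
  complex.Im (k^* * inner (usubmx (Y T)) (dsubmx (Y T))) <=
  complex.Im (k^* * inner (usubmx (Y 0)) (dsubmx (Y 0))).
Proof.
move=> T0 k3 Yd.
have Lr : real_functional (fun A : 'M[R[i]]_1 => complex.Im (k^* * A 0 0)).
  split=> [A B|a A|].
  - have -> : (A - B) 0 0 = A 0 0 - B 0 0 by rewrite !mxE.
    by rewrite mulrBr cImD cImN.
  - have -> : (a%:C *: A) 0 0 = a%:C * A 0 0 by rewrite mxE.
    by rewrite mulrCA cImM /= mul0r addr0.
  exists (l1c k) => A.
  apply: (@le_trans _ _ (l1c (k^* * A 0 0))); first by rewrite lerDr.
  apply: le_trans (l1cM _ _) _; rewrite l1cJ ler_wpM2l ?l1c_ge0//.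
  exact: l1norm_entry.
rewrite -subr_le0.
have h : complex.Im (k^* * inner (usubmx (Y T)) (dsubmx (Y T))) -
  complex.Im (k^* * inner (usubmx (Y 0)) (dsubmx (Y 0))) <= 0 - 0.
  apply: (@mean_value_functional R _ _ _ (fun t => flux_mx (Y t)) _ (fun=> 0)
    (fun=> 0) 0 T T0 Lr (fun t tT => diff_flux_mx (Yd t tT))
    (fun s => is_derive_cst _ _ _)) => t /andP[t0 tT].
  have bh := ux_herm (lexx 0) t0; have [u0 uxx0] := u_bc t0.
  have -> : flux_form (F (k ^+ 2) 0 t *m Y t) (Y t) 0 0 =
    4 * k ^+ 4 * (normsq (usubmx (Y t)))%:C
    - 4 * (k^*) ^+ 2 * (normsq (dsubmx (Y t)))%:C.
    rewrite u0 uxx0; move: (dx u 0 t) bh (Y t) => b bh y.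
    rewrite /flux_form Fmx_mul col_mxKu col_mxKd.
    move: (usubmx y) (dsubmx y) => a c; rewrite mxE.
    rewrite -/(inner (b *m a - _) c) -/(inner a (_ *m a - b *m c)).
    rewrite !add0r mulmxN scalerN opprK -scalar_mxM !scale_scalar_mx !mul_scalar_mx.
    rewrite !innerDl !innerDr !innerNl !innerNr !innerZl !innerZr !innerxx.
    have -> : (2 * (2 * k ^+ 2))^* = 4 * (k^*) ^+ 2.
      by rewrite !expr2 !rmorphM !rmorph_nat /=; ring.
    rewrite [inner a (b *m c)]inner_mulmx -bh; ring.
  move: (normsq (usubmx (Y t))) (normsq_ge0 (usubmx (Y t))) => n1 n1_ge0.
  move: (normsq (dsubmx (Y t))) (normsq_ge0 (dsubmx (Y t))) => n2 n2_ge0.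
  have -> : complex.Im (k^* * (4 * k ^+ 4 * n1%:C - 4 * (k^*) ^+ 2 * n2%:C)) =
    4 * complex.Im (k ^+ 3) * ((complex.Re k ^+ 2 + complex.Im k ^+ 2) * n1 + n2).
    by case: (k) => p q; rewrite !exprS !expr0 /=; ring.
  rewrite mulr_le0_ge0//; first by rewrite mulr_ge0_le0.
  by rewrite addr_ge0// mulr_ge0// addr_ge0// sqr_ge0.
by rewrite subr0 in h.
Qed.

End KdVEvolution.

(** * The sign contradiction at the boundary *)

Section Endgame.
Context {R : realType} {m : nat}.

(** The residual [c - ('i * k) *: a] vanishes when [M] equals the limit value, and is otherwise of
    size [e] times the norm of [a]. The form is |k|^2 |a|^2 up to an error of that order times the
    norm of [a], so [e] can be chosen independently of [a] and [c]. *)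
Lemma boundary_form_limit (k : R[i]) : 0 < complex.Re k ->
  exists2 e : R, 0 < e & forall (M : 'M[R[i]]_m) (a c : 'cV[R[i]]_m),
    c - a = M *m (a + c) ->
    l1norm (M - (('i * k - 1) / ('i * k + 1))%:M) <= e ->
    0 <= complex.Im (k^* * inner a c).
Proof.
move=> k0; pose mu := ('i * k - 1) / ('i * k + 1).
have k1 : 'i * k + 1 != 0.
  apply/eqP; rewrite -complexiE; case: k k0 {mu} => p q /= p0 [] _; lra.
pose c1 := l1c ((1 + 'i * k) / 2); pose c2 := l1c (1 + 'i * k); pose c3 := l1c k.
have c10 : 0 <= c1 by exact: l1c_ge0.
have c20 : 0 <= c2 by exact: l1c_ge0.
have c30 : 0 <= c3 by exact: l1c_ge0.
pose N : R := m%:R ^+ 2 * 2; have N0 : 0 <= N by rewrite mulr_ge0// exprn_ge0.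
pose n := complex.Re k ^+ 2 + complex.Im k ^+ 2.
have n0 : 0 < n by rewrite ltr_wpDr ?sqr_ge0// exprn_gt0.
pose D := 2 * c1 * c2 * c3 * N.
have D0 : 0 <= D by rewrite !mulr_ge0.
have D1 : 0 < D + 1 by rewrite ltr_wpDl.
have E1 : 0 < 2 * (c1 + 1) by rewrite mulr_gt0// ltr_wpDl.
(* The first bound gives [c1 * e <= 1 / 2], which absorbs the residual on the right of its own
   estimate. The second gives [D * e <= n], which keeps the error below [n * normsq a]. *)
pose e := Num.min (1 / (2 * (c1 + 1))) (n / (D + 1)).
have e0 : 0 < e by rewrite lt_min !divr_gt0.
have e1 : c1 * e <= 1 / 2.
  have h1 : e <= 1 / (2 * (c1 + 1)) by rewrite ge_min lexx.
  apply: le_trans (ler_wpM2l c10 h1) _.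
  rewrite mulrA mulr1 ler_pdivrMr// mulrA mulrC.
  by rewrite (_ : 1 / 2 * 2 = 1) ?mulr1 ?mul1r ?lerDl//; field.
have e2 : D * e <= n.
  have h1 : e <= n / (D + 1) by rewrite ge_min lexx orbT.
  apply: le_trans (ler_wpM2l D0 h1) _.
  by rewrite mulrCA ger_pMr// ler_pdivrMr// mul1r lerDl.
exists e => // M a c Mac Me.
pose rho := c - ('i * k) *: a.
have rhoE : rho = ((1 + 'i * k) / 2) *: ((M - mu%:M) *m (a + c)).
  rewrite mulmxBl -Mac mul_scalar_mx /rho /mu.
  by apply/matrixP => i j; rewrite !mxE; field.
have sE : a + c = (1 + 'i * k) *: a + rho.
  by rewrite /rho; apply/matrixP => i j; rewrite !mxE; ring.
pose r := l1norm rho; pose s := l1norm (a + c); pose A := l1norm a.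
have r0 : 0 <= r by exact: l1norm_ge0.
have A0 : 0 <= A by exact: l1norm_ge0.
have rs : r <= c1 * (e * s).
  rewrite /r rhoE; apply: le_trans (l1normZc _ _) _; rewrite ler_wpM2l//.
  by apply: le_trans (l1normM _ _) _; rewrite ler_wpM2r ?l1norm_ge0.
have sA : s <= c2 * A + r.
  rewrite /s sE; apply: le_trans (l1normD _ _) _; rewrite lerD2r.
  exact: l1normZc.
have rA : r <= 2 * (c1 * e) * (c2 * A).
  have h1 : c1 * e * s <= c1 * e * (c2 * A + r).
    by rewrite ler_wpM2l// mulr_ge0// ltW.
  have h2 : c1 * e * r <= 1 / 2 * r by rewrite ler_wpM2r.
  rewrite mulrA in rs; rewrite mulrDr in h1; lra.
have AN : A ^+ 2 <= N * normsq a by rewrite /N -mulrA; exact: l1norm_sq_le.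
have cE : c = ('i * k) *: a + rho by rewrite /rho addrC subrK.
have inE : complex.Im (k^* * inner a c) =
    n * normsq a + complex.Im (k^* * inner a rho).
  rewrite {1}cE innerDr innerZr innerxx mulrDr cImD; congr (_ + _).
  by rewrite /n -complexiE; case: (k) => p q /=; ring.
rewrite inE; have nr : `|complex.Im (k^* * inner a rho)| <= c3 * (A * r).
  apply: (@le_trans _ _ (l1c (k^* * inner a rho))); first by rewrite lerDr.
  apply: le_trans (l1cM _ _) _; rewrite l1cJ ler_wpM2l//.
  exact: l1c_inner_le.
have bound : c3 * (A * r) <= n * normsq a.
  apply: (@le_trans _ _ (2 * c1 * c2 * c3 * e * A ^+ 2)).
    apply: (@le_trans _ _ (c3 * (A * (2 * (c1 * e) * (c2 * A))))).
      by rewrite ler_wpM2l// ler_wpM2l.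
    by rewrite le_eqVlt; apply/orP; left; apply/eqP; ring.
  apply: (@le_trans _ _ (2 * c1 * c2 * c3 * e * (N * normsq a))).
    by rewrite ler_wpM2l// !mulr_ge0// ltW.
  apply: (@le_trans _ _ (D * e * normsq a)).
    by rewrite le_eqVlt; apply/orP; left; apply/eqP; rewrite /D; ring.
  by rewrite ler_wpM2r ?normsq_ge0.
by move: nr; rewrite ler_norml => /andP[nr _]; lra.
Qed.

Lemma sqrtC_sqr (k : R[i]) : 0 < complex.Im k -> sqrtC (k ^+ 2) = k.
Proof.
move=> k0; have : sqrtC (k ^+ 2) ^+ 2 == k ^+ 2 by rewrite sqrtCK.
rewrite eqf_sqr => /orP[/eqP//|/eqP h].
have := @Im_rootC_ge0 _ 2 (k ^+ 2) isT; rewrite h -complexIm lecR cImN => h0.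
by exfalso; lra.
Qed.

(* The second argument of the form is the derivative at 0 of the Weyl solution
   of the initial profile whose value at 0 is [w]. *)
Lemma boundary_form_initial n (theta : 'M[R[i]]_(n, m)) (k : R[i])
    (w : 'cV[R[i]]_m) : k != 0 ->
  complex.Im (k^* * inner w (('i * k) *: w - k ^- 2 *: (theta^t* *m theta *m w)))
  = (complex.Re k ^+ 2 + complex.Im k ^+ 2) * normsq w
    + complex.Im (k ^+ 3) / (complex.Re k ^+ 2 + complex.Im k ^+ 2) ^+ 2
      * normsq (theta *m w).
Proof.
move=> k0; rewrite innerDr innerNr !innerZr -mulmxA inner_mulmx adjointK !innerxx.
pose q := complex.Re k ^+ 2 + complex.Im k ^+ 2.
have qE : q%:C = k * k^* by rewrite -normCK -add_Re2_Im2.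
have q0 : q != 0.
  by apply/eqP => h; move/eqP: qE; rewrite h eq_sym mulf_eq0 conjC_eq0 (negPf k0).
(* Written with denominator |k|^4, the inverse square makes conj(k) k^-2 a positive multiple of
   conj(k)^3, so that Im (k^3) appears here too. *)
have -> : k ^- 2 = (q ^- 2)%:C * (k^*) ^+ 2.
  by rewrite fmorphV rmorphXn /= qE; field; rewrite /= conjC_eq0 k0.
rewrite -/q; have -> : k^* * ('i * k * (normsq w)%:C - (q ^- 2)%:C * (k^*) ^+ 2 *
    (normsq (theta *m w))%:C) = 'i * (k * k^*) * (normsq w)%:C
    - (q ^- 2 * normsq (theta *m w))%:C * (k^*) ^+ 3 by rewrite rmorphM; ring.
have ImR (a : R) (b : R[i]) : complex.Im (a%:C * b) = a * complex.Im b.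
  by rewrite cImM /= mul0r addr0.
have -> : 'i * (k * k^*) * (normsq w)%:C = (q * normsq w)%:C * 'i.
  by rewrite -qE rmorphM; ring.
rewrite cImD cImN !ImR -complexiE /= mulr1.
have -> : complex.Im (k^* ^+ 3) = - complex.Im (k ^+ 3).
  by case: (k) => a b; rewrite !exprS !expr0 /=; ring.
ring.
Qed.

End Endgame.

Unset Implicit Arguments.

(* sqrtC z lies in the closed upper half-plane for every z, so on the upper
   half-plane it is the required branch of the square root. *)
Theorem proposition8 (R : realType) (m n : nat) (hm : (0 < m)%N)
    (hn : (0 < n)%N) (theta : 'M[R[i]]_(n, m))
    (htheta : posdefmx (theta^t* *m theta)) :
  ~ exists u : R -> R -> 'M[R[i]]_m,
      (forall x t : R, 0 <= x -> 0 <= t -> u x t = (u x t)^t*) /\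
      (forall x t : R, 0 <= x -> 0 <= t ->
         dt u x t + 3 *: (u x t *m dx u x t + dx u x t *m u x t)
         - dx (dx (dx u)) x t = 0) /\
      ([bounded u a.1 a.2 | a in quarter_plane] /\
       (forall z : R[i],
          quarter_C1 (fun x t : R => Gmx (u x t) z) /\
          quarter_C1 (fun x t : R =>
            Fmx (u x t) (dx u x t) (dx (dx u) x t) z))) /\
      ((forall t : R, 0 <= t -> u 0 t = 0 /\ dx (dx u) 0 t = 0) /\
       (forall x : R, 0 <= x -> u x 0 = initial_profile theta x)) /\
      (exists2 M : R -> R[i] -> 'M[R[i]]_m,
         (forall t : R, 0 <= t -> weyl_function (u ^~ t) (M t)) &
         (forall z : R[i], 0 < 'Im z ->
            M t z @[t --> +oo] -->
              (('i * sqrtC z - 1) / ('i * sqrtC z + 1))%:M)).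
Proof.
move=> [u [u_herm [u_kdv [[/l1norm_bounded[Cu u_bd] C1] [[u_bc u_ini] [M Mweyl Mlim]]]]]].
have [G_C1 F_C1] := C1 0.
pose w : 'cV[R[i]]_m := const_mx 1.
have w0 : w != 0.
  apply/eqP => /matrixP/(_ (Ordinal hm) 0); rewrite !mxE => /eqP.
  by rewrite oner_eq0.
have nw : 0 < normsq w.
  by rewrite ltNge; apply/negP => /normsq_eq0 /eqP; rewrite (negPf w0).
have nt : 0 < normsq (theta *m w).
  have := htheta w w0; rewrite -[(_ *m w) 0 0]/(((_ *m _) *m w) 0 0).
  rewrite (_ : (_ *m w) 0 0 = inner (theta *m w) (theta *m w)).
    by rewrite innerxx ltcR.
  by rewrite /inner adjointM !mulmxA.
(* For [k = r (1 + 2 i)] one has |k|^2 = 5 r^2 and Im (k^3) = - 2 r^3, so the initial form is (125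
   r^3 |w|^2 - 2 |theta w|^2) / (25 r). Since [r <= 1] gives r^3 <= r, the second bound leaves 125
   r^3 |w|^2 <= |theta w|^2, and the form is negative. *)
pose r := Num.min 1 (normsq (theta *m w) / (125 * normsq w)).
have r0 : 0 < r by rewrite lt_min ltr01 divr_gt0// mulr_gt0.
have r1 : r <= 1 by rewrite ge_min lexx.
have r2 : r * (125 * normsq w) <= normsq (theta *m w).
  by rewrite -ler_pdivlMr ?mulr_gt0// ge_min lexx orbT.
(* The argument of [k] lies between pi/3 and pi/2. *)
pose k : R[i] := Complex r (2 * r).
have Rek : complex.Re k = r by []. have Imk : complex.Im k = 2 * r by [].
have kR : 0 < complex.Re k by rewrite Rek.
have kI : 0 < complex.Im k by rewrite Imk mulr_gt0.
have k0 : k != 0 by apply: contraTneq kR => ->; rewrite ltxx.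
have Imk3 : complex.Im (k ^+ 3) = - 2 * r ^+ 3.
  by rewrite /k !exprS !expr0 /=; ring.
have k3 : complex.Im (k ^+ 3) <= 0.
  by rewrite Imk3 mulNr oppr_le0 mulr_ge0// exprn_ge0// ltW.
have zI : 0 < complex.Im (k ^+ 2).
  by rewrite expr2 cImM addr_gt0// mulr_gt0.
have zI' : 0 < 'Im (k ^+ 2) by rewrite -complexIm ltcR.
have [e e0 He] := @boundary_form_limit R m k kR.
have [T [T0 MT]] : exists T : R, 0 < T /\
    l1norm (M T (k ^+ 2) - (('i * k - 1) / ('i * k + 1))%:M) <= e.
  have := Mlim _ zI'; rewrite sqrtC_sqr// => /cvg_l1norm /(_ e e0) lim.
  apply: (@filter_ex _ (pinfty_nbhs R)); near=> t; split; last by near: t.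
  by near: t; exact: nbhs_pinfty_gt.
(* One family of fundamental matrices is chosen for all times together; for negative [t] the zero
   function is a placeholder. *)
have /choice[Psi PsiP] : forall t : R, exists P : R[i] -> R -> 'M[R[i]]_(m + m),
    0 <= t -> (forall z, fundamental_solution (u ^~ t) z (P z)) /\
    forall P' Q' : R -> R[i] -> 'M[R[i]]_m,
      (forall l, 0 < l -> admissible_pair (P' l) (Q' l)) ->
      forall z, 0 < 'Im z ->
        (\forall l \near +oo, holomorphic_at (P' l) z /\ holomorphic_at (Q' l) z) ->
        moebius (Amx P l z) (P' l z) (Q' l z) @[l --> +oo] --> M t z.
  move=> t; have [t0|nt0] := boolP (0 <= t); last by exists (fun _ _ => 0).
  by have [P P1 P2] := Mweyl t t0; exists P.
have Psi_sol t : 0 <= t -> forall z, fundamental_solution (u ^~ t) z (Psi t z).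
  by move=> t0; have [] := PsiP t t0.
have [y [y0 yd yf]] := initial_solution theta w kR kI.
have [Y [Y0 Yd]] := boundary_solution F_C1 u_bc (k ^+ 2) (y 0) (ltW T0).
have [K K0 GK] := Gmx_bounded u_bd (k ^+ 2).
(* [Psi 0] is the fundamental matrix that comes with the Weyl function, whereas [y] is explicit.
   Uniqueness for the linear equation identifies them, which transfers the known sign of the flux to
   the carried solution. *)
have yE x : 0 <= x -> Psi 0 (k ^+ 2) x *m Y 0 = y x.
  move=> x0; apply: (@ode_unique R _ _ (fun x => Gmx (u x 0) (k ^+ 2))
    (fun x => Psi 0 (k ^+ 2) x *m Y 0) y K K0 _ _ _ _ x x0).
  - by move=> s s0; exact: GK.
  - exact: (solution_diff (Psi_sol 0 (lexx 0))).
  - by move=> s s0; rewrite u_ini//; exact: yd.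
  - by rewrite (Psi_sol 0 (lexx 0) _).1 mul1mx Y0.
have Tf L : 0 < L -> 0 <= flux (Psi T (k ^+ 2) L *m Y T).
  have f0 x : 0 <= x -> 0 <= flux (Psi 0 (k ^+ 2) x *m Y 0).
    by move=> x0; rewrite yE// yf.
  have fp := flux_propagation u_herm u_kdv u_bd G_C1 F_C1 Psi_sol (ltW T0) zI Yd f0.
  by move=> L0; apply: fp; exact: ltW.
have [PT1 PT2] := PsiP T (ltW T0).
have hY := weyl_vector (fun x x0 => u_herm x T x0 (ltW T0)) PT1 PT2 zI Tf.
have pT := He _ _ _ hY MT.
have p0 := boundary_form_nonincreasing u_herm G_C1 u_bc (ltW T0) k3 Yd.
move: (le_trans pT p0); rewrite Y0 y0 col_mxKu col_mxKd boundary_form_initial//.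
rewrite Rek Imk Imk3.
have -> : (r ^+ 2 + (2 * r) ^+ 2) * normsq w +
    - 2 * r ^+ 3 / (r ^+ 2 + (2 * r) ^+ 2) ^+ 2 * normsq (theta *m w) =
  (125 * r ^+ 3 * normsq w - 2 * normsq (theta *m w)) / (25 * r).
  field; rewrite gt_eqF//= gt_eqF// addr_gt0// exprn_gt0// mulr_gt0.
rewrite pmulr_lge0 ?invr_gt0 ?mulr_gt0// => h.
have r3 : r ^+ 3 * (125 * normsq w) <= r * (125 * normsq w).
  rewrite ler_wpM2r ?mulr_ge0 ?normsq_ge0// -[leRHS]expr1.
  by rewrite ler_wiXn2l ?(ltW r0).
lra.
Unshelve. all: by end_near. Qed.
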